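(* Let $G$ be the fundamental group of a finite-dimensional special cube complex. Then either $G$ is abelian or $G$ surjects onto $F_2$, the free group of rank $2$.
   Context: A cube complex is a connected space obtained by gluing Euclidean cubes $[-1,1]^n$ along faces by isometries. It is non-positively curved (NPC) if the link of every vertex is a flag simplicial complex (equivalently, its universal cover is CAT(0)). A midcube of $[-1,1]^n$ is the subset obtained by restricting one coordinate to $0$; a hyperplane is a maximal connected subset that meets each cube in a midcube (hyperplanes correspond to equivalence classes of edges under the relation generated by being opposite edges of a square; the edges in the class are said to be dual to the hyperplane). An NPC cube complex $X$ (not necessarily compact) is special if: (1) every hyperplane is two-sided (its dual edges can be oriented so that opposite edges of every square have matching orientations); (2) no hyperplane self-intersects (no two consecutive edges of a square are dual to the same hyperplane); (3) no hyperplane directly self-osculates (with dual edges consistently oriented, no two distinct dual edges of the same hyperplane share their initial vertex, or share their terminal vertex, without spanning the corner of a square there); (4) no two distinct hyperplanes interosculate (i.e. it does not happen that they cross, and also have dual edges sharing a vertex without spanning the corner of a square at that vertex). *)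

(* Defs.v *)
From HB Require Import structures.
From Stdlib Require Import Relation_Operators.
From mathcomp Require Import all_boot all_order all_algebra.
From mathcomp Require Import generic_quotient.
From mathcomp Require Import mathcomp_extra boolp classical_sets functions.
From mathcomp Require Import set_interval reals topology normedtype.
From mathcomp Require Import ring lra.

Set Implicit Arguments.
Unset Strict Implicit.
Unset Printing Implicit Defensive.

Import Order.TTheory GRing.Theory Num.Theory.
Import numFieldNormedType.Exports.

Local Open Scope classical_set_scope.
Local Open Scope ring_scope.

(* The values of a loop outside [0, 1] are irrelevant: two loops that agree on
   [0, 1] are homotopic. *)
Record loop (R : realType) (T : topologicalType) (p : T) := Loop {
  loop_fun :> R -> T;
  loop_cts : {within `[0, 1], continuous loop_fun};
  loop0 : loop_fun 0 = p;
  loop1 : loop_fun 1 = p }.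

Arguments loop_cts {R T p} l.

HB.instance Definition _ (R : realType) (T : topologicalType) (p : T) :=
  gen_eqMixin (loop R p).
HB.instance Definition _ (R : realType) (T : topologicalType) (p : T) :=
  gen_choiceMixin (loop R p).

Section FundamentalGroup.
Context {R : realType} {T : topologicalType} {p : T}.
Implicit Types f g h : loop R p.

Definition homotopic f g : Prop :=
  exists H : R * R -> T,
    [/\ {within `[0, 1] `*` `[0, 1], continuous H},
        forall t : R, t \in `[0, 1] -> H (0, t) = f t,
        forall t : R, t \in `[0, 1] -> H (1, t) = g t &
        forall s : R, s \in `[0, 1] -> H (s, 0) = p /\ H (s, 1) = p].

Let I2 : set (R * R) := `[0, 1] `*` `[0, 1].

Lemma in01P (t : R) : reflect (0 <= t /\ t <= 1) (t \in `[0, 1]).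
Proof. by rewrite in_itv /=; apply: (iffP andP). Qed.

Lemma within_comp (U V W : topologicalType) (A : set U) (B : set V)
    (g : U -> V) (f : V -> W) :
  {within B, continuous f} -> {within A, continuous g} ->
  (forall x, A x -> B (g x)) -> {within A, continuous (f \o g)}.
Proof.
move=> /subspace_continuousP cf /subspace_continuousP cg AB.
apply/subspace_continuousP => x Ax S /= /(cf _ (AB _ Ax)) /=.
rewrite /nbhs /= /within /= => Sf.
have := cg x Ax _ Sf; rewrite /nbhs /= /within /= => near1.
by apply: filterS near1 => y /= H Ay; apply: H => //; apply: AB.
Qed.

Lemma within_eq (U V : topologicalType) (A : set U) (f g : U -> V) :
  (forall x, A x -> f x = g x) ->
  {within A, continuous f} -> {within A, continuous g}.
Proof.
move=> fg; apply: subspace_eq_continuous => x xA.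
by apply: fg; apply/set_mem.
Qed.

(* Reparametrisation: f \o a and f \o b are homotopic when the self-maps a and
   b of [0, 1] have the same end points. *)
Lemma reparam f (a b : R -> R) (g h : loop R p) :
  continuous a -> continuous b ->
  (forall t : R, t \in `[0, 1] -> a t \in `[0, 1]) ->
  (forall t : R, t \in `[0, 1] -> b t \in `[0, 1]) ->
  a 0 = b 0 -> a 1 = b 1 ->
  (forall t : R, t \in `[0, 1] -> g t = f (a t)) ->
  (forall t : R, t \in `[0, 1] -> h t = f (b t)) ->
  homotopic g h.
Proof.
move=> ca cb a01 b01 ab0 ab1 gE hE.
exists (f \o (fun x : R * R => (1 - x.1) * a x.2 + x.1 * b x.2)).
have I0 : (0 : R) \in `[0, 1] by apply/in01P; split; lra.
have I1 : (1 : R) \in `[0, 1] by apply/in01P; split; lra.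
split.
- apply: (within_comp (loop_cts f)).
    apply: continuous_subspaceT => x.
    apply: cvgD; apply: cvgM.
    + by apply: cvgB; [exact: cvg_cst|exact: cvg_fst].
    + by apply: cvg_comp; [exact: cvg_snd|exact: ca].
    + exact: cvg_fst.
    + by apply: cvg_comp; [exact: cvg_snd|exact: cb].
  move=> [s t] [/= /in01P [s0 s1] tI].
  have /in01P [? ?] := a01 t tI; have /in01P [? ?] := b01 t tI.
  by apply/in01P; split; nra.
- by move=> t tI /=; rewrite gE// subr0 mul1r mul0r addr0.
- by move=> t tI /=; rewrite hE// subrr mul0r mul1r add0r.
- move=> s sI /=; rewrite ab0 ab1 -!mulrDl subrK !mul1r -hE// -hE//.
  by rewrite loop0 loop1.
Qed.

Lemma cts_pair (U V W : topologicalType) (a : U -> V) (b : U -> W) :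
  continuous a -> continuous b -> continuous (fun x => (a x, b x)).
Proof. by move=> ca cb x; apply: cvg_pair; [exact: ca|exact: cb]. Qed.

Lemma homotopic_refl f : homotopic f f.
Proof.
by apply: (@reparam f id id) => // x; exact: cvg_id.
Qed.

Lemma homotopic_sym f g : homotopic f g -> homotopic g f.
Proof.
move=> [H [cH H0 H1 Hp]]; exists (H \o (fun x : R * R => (1 - x.1, x.2))); split.
- apply: (within_comp cH).
    apply: continuous_subspaceT; apply: cts_pair => x; last exact: cvg_snd.
    by apply: cvgB; [exact: cvg_cst|exact: cvg_fst].
  by move=> [s t] [/= /in01P [? ?] tI]; split => //=; apply/in01P; split; lra.
- by move=> t tI /=; rewrite subr0 H1.
- by move=> t tI /=; rewrite subrr H0.
- by move=> s /in01P [? ?] /=; apply: Hp; apply/in01P; split; lra.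
Qed.

(* Pasting along a continuous real-valued function. *)
Lemma paste (U W : topologicalType) (A : set U) (c : U -> R) (f g : U -> W) :
  continuous c ->
  closed A ->
  {within A `&` [set x | c x <= 0], continuous f} ->
  {within A `&` [set x | c x >= 0], continuous g} ->
  (forall x, A x -> c x = 0 -> f x = g x) ->
  {within A, continuous (fun x => if c x <= 0 then f x else g x)}.
Proof.
move=> cc cA cf cg fg.
have -> : A = (A `&` [set x | c x <= 0]) `|` (A `&` [set x | c x >= 0]).
  rewrite -setIUr; apply/seteqP; split=> [x Ax|x []//]; split=> //=.
  by case: (leP (c x) 0) => [?|/ltW ?]; [left|right].
apply: withinU_continuous.
- apply: closedI => //.
  by apply: (@preimage_closed _ _ c [set t | t <= 0]) => //; exact: closed_le.
- apply: closedI => //.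
  by apply: (@preimage_closed _ _ c [set t | t >= 0]) => //; exact: closed_ge.
- by apply: within_eq cf => x [_ /= ->].
- apply: within_eq cg => x [Ax /= c0]; case: ifPn => // c0'.
  by rewrite -fg//; apply/eqP; rewrite eq_le c0 c0'.
Qed.

Lemma I2_closed : closed I2.
Proof.
rewrite (_ : I2 = fst @^-1` `[0, 1] `&` snd @^-1` `[0, 1]) //.
apply: closedI; apply: preimage_closed; try exact: interval_closed.
- by move=> x _; exact: cvg_fst.
- by move=> x _; exact: cvg_snd.
Qed.

Lemma homotopic_trans g f h : homotopic f g -> homotopic g h -> homotopic f h.
Proof.
move=> [H [cH H0 H1 Hp]] [K [cK K0 K1 Kp]].
exists (fun x : R * R => if x.1 - 2^-1 <= 0 then H (2 * x.1, x.2)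
                         else K (2 * x.1 - 1, x.2)); split.
- apply: (@paste _ _ I2 (fun x => x.1 - 2^-1)
     (H \o (fun x : R * R => (2 * x.1, x.2)))
     (K \o (fun x : R * R => (2 * x.1 - 1, x.2)))).
  + by move=> x; apply: cvgB; [exact: cvg_fst|exact: cvg_cst].
  + exact: I2_closed.
  + apply: (within_comp cH).
      apply: continuous_subspaceT; apply: cts_pair => x; last exact: cvg_snd.
      by apply: cvgM; [exact: cvg_cst|exact: cvg_fst].
    move=> [s t] [[/= /in01P [? ?] tI] ?]; split => //=.
    by apply/in01P; split; lra.
  + apply: (within_comp cK).
      apply: continuous_subspaceT; apply: cts_pair => x; last exact: cvg_snd.
      apply: cvgB; last exact: cvg_cst.
      by apply: cvgM; [exact: cvg_cst|exact: cvg_fst].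
    move=> [s t] [[/= /in01P [? ?] tI] ?]; split => //=.
    by apply/in01P; split; lra.
  + move=> [s t] [/= /in01P [? ?] tI] s2.
    have -> : 2 * s = 1 by lra.
    by rewrite subrr H1// K0.
- by move=> t tI /=; rewrite ifT ?mulr0 ?H0//; lra.
- move=> t tI /=; rewrite ifF; last by apply/negbTE; rewrite -ltNge; lra.
  by have -> : 2 * 1 - 1 = 1 :> R; [lra|rewrite K1].
- move=> s /in01P [? ?] /=; case: ifPn => s2.
    by apply: Hp; apply/in01P; split; lra.
  by move: s2; rewrite -ltNge => s2; apply: Kp; apply/in01P; split; lra.
Qed.

Definition concat_fun (f g : R -> T) (t : R) : T :=
  if t - 2^-1 <= 0 then f (2 * t) else g (2 * t - 1).

Lemma concat_cts f g : {within `[0, 1], continuous (concat_fun f g)}.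
Proof.
rewrite /concat_fun.
apply: (@paste R T `[0, 1]%classic (fun x => x - 2^-1)
     (f \o (fun x : R => 2 * x)) (g \o (fun x : R => 2 * x - 1))).
- by move=> x; apply: cvgB; [exact: cvg_id|exact: cvg_cst].
- exact: interval_closed.
- apply: (within_comp (loop_cts f)).
    apply: continuous_subspaceT => x.
    by apply: cvgM; [exact: cvg_cst|exact: cvg_id].
  by move=> t [/= /in01P [? ?] ?]; apply/in01P; split; lra.
- apply: (within_comp (loop_cts g)).
    apply: continuous_subspaceT => x; apply: cvgB; last exact: cvg_cst.
    by apply: cvgM; [exact: cvg_cst|exact: cvg_id].
  by move=> t [/= /in01P [? ?] ?]; apply/in01P; split; lra.
- move=> t _ t2 /=; have -> : 2 * t = 1 by lra.
  by rewrite subrr loop1 loop0.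
Qed.

Lemma concat0 f g : concat_fun f g 0 = p.
Proof. by rewrite /concat_fun ifT ?mulr0 ?loop0//; lra. Qed.

Lemma concat1 f g : concat_fun f g 1 = p.
Proof.
rewrite /concat_fun ifF; last by apply/negbTE; rewrite -ltNge; lra.
by have -> : 2 * 1 - 1 = 1 :> R; [lra|rewrite loop1].
Qed.

Definition concat f g : loop R p :=
  Loop (@concat_cts f g) (concat0 f g) (concat1 f g).

Lemma rev_loop_cts f : {within `[0, 1], continuous (fun t => f (1 - t))}.
Proof.
apply: (@within_comp R R T _ `[0, 1]%classic (fun t : R => 1 - t) f).
- exact: loop_cts.
- apply: continuous_subspaceT => x.
  by apply: cvgB; [exact: cvg_cst|exact: cvg_id].
- by move=> t /= /in01P [? ?]; apply/in01P; split; lra.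
Qed.

Lemma rev_loop0 f : f (1 - 0) = p. Proof. by rewrite subr0 loop1. Qed.
Lemma rev_loop1 f : f (1 - 1) = p. Proof. by rewrite subrr loop0. Qed.

Definition rev_loop f : loop R p :=
  Loop (@rev_loop_cts f) (rev_loop0 f) (rev_loop1 f).

Lemma cst_loop_cts : {within `[0, 1], continuous (fun _ : R => p)}.
Proof. by apply: continuous_subspaceT => x; exact: cvg_cst. Qed.

Definition cst_loop : loop R p := Loop cst_loop_cts erefl erefl.

Lemma homotopic_concat f f' g g' :
  homotopic f f' -> homotopic g g' -> homotopic (concat f g) (concat f' g').
Proof.
move=> [H [cH H0 H1 Hp]] [K [cK K0 K1 Kp]].
exists (fun x : R * R => if x.2 - 2^-1 <= 0 then H (x.1, 2 * x.2)
                         else K (x.1, 2 * x.2 - 1)); split.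
- apply: (@paste _ _ I2 (fun x => x.2 - 2^-1)
     (H \o (fun x : R * R => (x.1, 2 * x.2)))
     (K \o (fun x : R * R => (x.1, 2 * x.2 - 1)))).
  + by move=> x; apply: cvgB; [exact: cvg_snd|exact: cvg_cst].
  + exact: I2_closed.
  + apply: (within_comp cH).
      apply: continuous_subspaceT; apply: cts_pair => x; first exact: cvg_fst.
      by apply: cvgM; [exact: cvg_cst|exact: cvg_snd].
    move=> [s t] [[/= sI /in01P [? ?]] ?]; split => //=.
    by apply/in01P; split; lra.
  + apply: (within_comp cK).
      apply: continuous_subspaceT; apply: cts_pair => x; first exact: cvg_fst.
      apply: cvgB; last exact: cvg_cst.
      by apply: cvgM; [exact: cvg_cst|exact: cvg_snd].
    move=> [s t] [[/= sI /in01P [? ?]] ?]; split => //=.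
    by apply/in01P; split; lra.
  + move=> [s t] [/= sI /in01P [? ?]] t2.
    have -> : 2 * t = 1 by lra.
    by rewrite subrr (Hp _ sI).2 (Kp _ sI).1.
- move=> t /in01P [? ?] /=; rewrite /concat_fun; case: ifPn => t2.
    by rewrite H0//; apply/in01P; split; lra.
  by move: t2; rewrite -ltNge => t2; rewrite K0//; apply/in01P; split; lra.
- move=> t /in01P [? ?] /=; rewrite /concat_fun; case: ifPn => t2.
    by rewrite H1//; apply/in01P; split; lra.
  by move: t2; rewrite -ltNge => t2; rewrite K1//; apply/in01P; split; lra.
- move=> s sI /=; rewrite ifT ?mulr0; last by lra.
  rewrite ifF; last by apply/negbTE; rewrite -ltNge; lra.
  have -> : 2 * 1 - 1 = 1 :> R by lra.
  by rewrite (Hp _ sI).1 (Kp _ sI).2.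
Qed.

Lemma homotopic_rev f g :
  homotopic f g -> homotopic (rev_loop f) (rev_loop g).
Proof.
move=> [H [cH H0 H1 Hp]]; exists (H \o (fun x : R * R => (x.1, 1 - x.2))); split.
- apply: (within_comp cH).
    apply: continuous_subspaceT; apply: cts_pair => x; first exact: cvg_fst.
    by apply: cvgB; [exact: cvg_cst|exact: cvg_snd].
  by move=> [s t] [/= sI /in01P [? ?]]; split => //=; apply/in01P; split; lra.
- by move=> t /in01P [? ?] /=; rewrite H0//; apply/in01P; split; lra.
- by move=> t /in01P [? ?] /=; rewrite H1//; apply/in01P; split; lra.
- by move=> s sI /=; rewrite subr0 subrr; case: (Hp _ sI).
Qed.

Let cts_min (a b : R -> R) :
  continuous a -> continuous b -> continuous (fun t => Num.min (a t) (b t)).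
Proof. by move=> ca cb x; apply: continuous_min; [exact: ca|exact: cb]. Qed.

Let cts_max (a b : R -> R) :
  continuous a -> continuous b -> continuous (fun t => Num.max (a t) (b t)).
Proof. by move=> ca cb x; apply: continuous_max; [exact: ca|exact: cb]. Qed.

Let cts_affine (a b : R) : continuous (fun t : R => a * t + b).
Proof.
move=> x; apply: cvgD; last exact: cvg_cst.
by apply: cvgM; [exact: cvg_cst|exact: cvg_id].
Qed.

Lemma concatA f g h :
  homotopic (concat f (concat g h)) (concat (concat f g) h).
Proof.
apply: homotopic_sym.
apply: (@reparam (concat f (concat g h))
  (fun t => Num.min (Num.min (2 * t + 0) (1 * t + 4^-1)) (2^-1 * t + 2^-1)) id).
- by do 2?[apply: cts_min]; exact: cts_affine.
- by move=> x; exact: cvg_id.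
- move=> t /in01P [? ?]; apply/in01P.
  by rewrite !le_min !ge_min; split; [apply/andP; split; [apply/andP; split|]|
    apply/orP; right]; lra.
- by [].
- by rewrite !minEle; do !case: ifPn; rewrite -?ltNge => *; lra.
- by rewrite !minEle; do !case: ifPn; rewrite -?ltNge => *; lra.
- move=> t /in01P [? ?] /=; rewrite /concat_fun.
  case: (leP (t - 2^-1) 0) => t2; last first.
    have -> : Num.min (Num.min (2 * t + 0) (1 * t + 4^-1)) (2^-1 * t + 2^-1)
              = 2^-1 * t + 2^-1.
      by rewrite !minEle; do !case: ifPn; rewrite -?ltNge => *; lra.
    rewrite !ifF; [|apply/negbTE; rewrite -ltNge; lra..].
    by congr (h _); lra.
  case: (leP (2 * t - 2^-1) 0) => t4.
    have -> : Num.min (Num.min (2 * t + 0) (1 * t + 4^-1)) (2^-1 * t + 2^-1)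
              = 2 * t.
      by rewrite !minEle; do !case: ifPn; rewrite -?ltNge => *; lra.
    by rewrite ifT//; lra.
  have -> : Num.min (Num.min (2 * t + 0) (1 * t + 4^-1)) (2^-1 * t + 2^-1)
            = t + 4^-1.
    by rewrite !minEle; do !case: ifPn; rewrite -?ltNge => *; lra.
  rewrite ifF; last by apply/negbTE; rewrite -ltNge; lra.
  by rewrite ifT; [congr (g _); lra|lra].
- by [].
Qed.

Lemma concat1f f : homotopic (concat cst_loop f) f.
Proof.
apply: (@reparam f (fun t => Num.max (0 * t + 0) (2 * t + -1)) id).
- by apply: cts_max; exact: cts_affine.
- by move=> x; exact: cvg_id.
- move=> t /in01P [? ?]; apply/in01P.
  by rewrite maxEle; case: ifPn; rewrite -?ltNge => *; split; lra.
- by [].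
- by rewrite maxEle; case: ifPn; rewrite -?ltNge => *; lra.
- by rewrite maxEle; case: ifPn; rewrite -?ltNge => *; lra.
- move=> t /in01P [? ?] /=; rewrite /concat_fun.
  case: (leP (t - 2^-1) 0) => t2.
    have -> : Num.max (0 * t + 0) (2 * t + -1) = 0.
      by rewrite maxEle; case: ifPn; rewrite -?ltNge => *; lra.
    by rewrite loop0.
  by congr (f _); rewrite maxEle; case: ifPn; rewrite -?ltNge => *; lra.
- by [].
Qed.

Lemma concatf1 f : homotopic (concat f cst_loop) f.
Proof.
apply: (@reparam f (fun t => Num.min (2 * t + 0) (0 * t + 1)) id).
- by apply: cts_min; exact: cts_affine.
- by move=> x; exact: cvg_id.
- move=> t /in01P [? ?]; apply/in01P.
  by rewrite minEle; case: ifPn; rewrite -?ltNge => *; split; lra.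
- by [].
- by rewrite minEle; case: ifPn; rewrite -?ltNge => *; lra.
- by rewrite minEle; case: ifPn; rewrite -?ltNge => *; lra.
- move=> t /in01P [? ?] /=; rewrite /concat_fun.
  case: (leP (t - 2^-1) 0) => t2.
    by congr (f _); rewrite minEle; case: ifPn; rewrite -?ltNge => *; lra.
  have -> : Num.min (2 * t + 0) (0 * t + 1) = 1.
    by rewrite minEle; case: ifPn; rewrite -?ltNge => *; lra.
  by rewrite loop1.
- by [].
Qed.

Lemma concatfV f : homotopic (concat f (rev_loop f)) cst_loop.
Proof.
apply: (@reparam f (fun t => Num.min (2 * t + 0) (- 2 * t + 2))
                   (fun t => 0 * t + 0)).
- by apply: cts_min; exact: cts_affine.
- exact: cts_affine.
- move=> t /in01P [? ?]; apply/in01P.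
  by rewrite minEle; case: ifPn; rewrite -?ltNge => *; split; lra.
- by move=> t _; apply/in01P; split; lra.
- by rewrite minEle; case: ifPn; rewrite -?ltNge => *; lra.
- by rewrite minEle; case: ifPn; rewrite -?ltNge => *; lra.
- move=> t /in01P [? ?] /=; rewrite /concat_fun /=.
  by case: (leP (t - 2^-1) 0) => t2;
    congr (f _); rewrite minEle; case: ifPn; rewrite -?ltNge => *; lra.
- by move=> t _ /=; rewrite mul0r addr0 loop0.
Qed.

Lemma concatVf f : homotopic (concat (rev_loop f) f) cst_loop.
Proof.
apply: (@reparam f (fun t => Num.max (- 2 * t + 1) (2 * t + -1))
                   (fun t => 0 * t + 1)).
- by apply: cts_max; exact: cts_affine.
- exact: cts_affine.
- move=> t /in01P [? ?]; apply/in01P.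
  by rewrite maxEle; case: ifPn; rewrite -?ltNge => *; split; lra.
- by move=> t _; apply/in01P; split; lra.
- by rewrite maxEle; case: ifPn; rewrite -?ltNge => *; lra.
- by rewrite maxEle; case: ifPn; rewrite -?ltNge => *; lra.
- move=> t /in01P [? ?] /=; rewrite /concat_fun /=.
  by case: (leP (t - 2^-1) 0) => t2;
    congr (f _); rewrite maxEle; case: ifPn; rewrite -?ltNge => *; lra.
- by move=> t _ /=; rewrite mul0r add0r loop1.
Qed.

Definition homotopicb f g : bool := `[< homotopic f g >].

Lemma homotopicb_refl : reflexive homotopicb.
Proof. by move=> f; apply/asboolP; exact: homotopic_refl. Qed.

Lemma homotopicb_sym : symmetric homotopicb.
Proof. by move=> f g; apply/asboolP/asboolP; exact: homotopic_sym. Qed.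

Lemma homotopicb_trans : transitive homotopicb.
Proof.
move=> g f h /asboolP fg /asboolP gh; apply/asboolP.
exact: homotopic_trans fg gh.
Qed.

Canonical homotopy_rel :=
  EquivRel homotopicb homotopicb_refl homotopicb_sym homotopicb_trans.

End FundamentalGroup.

Arguments homotopy_rel {R T} p.

Definition pi1 (R : realType) (T : topologicalType) (p : T) : Type :=
  {eq_quot @homotopy_rel R T p}%qT.

HB.instance Definition _ (R : realType) (T : topologicalType) (p : T) :=
  Choice.on (pi1 R p).
HB.instance Definition _ (R : realType) (T : topologicalType) (p : T) :=
  EqQuotient.on (pi1 R p).

Section Pi1Group.
Context (R : realType) (T : topologicalType) (p : T).
Local Open Scope quotient_scope.
Implicit Types (f g : loop R p) (x y z : pi1 R p).

Definition pi1_class f : pi1 R p := \pi f.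

Lemma pi1_classP f g : reflect (homotopic f g) (pi1_class f == pi1_class g).
Proof. by rewrite piE; exact: asboolP. Qed.

Lemma pi1_class_eq f g : homotopic f g -> pi1_class f = pi1_class g.
Proof. by move=> /pi1_classP /eqP. Qed.

Lemma pi1_class_repr x : pi1_class (repr x) = x.
Proof. exact: reprK. Qed.

Lemma homotopic_repr f : homotopic (repr (pi1_class f)) f.
Proof. by apply/pi1_classP; rewrite pi1_class_repr. Qed.

Definition pi1_mul x y : pi1 R p := pi1_class (concat (repr x) (repr y)).
Definition pi1_inv x : pi1 R p := pi1_class (rev_loop (repr x)).
Definition pi1_one : pi1 R p := pi1_class cst_loop.

Lemma pi1_mulE f g :
  pi1_mul (pi1_class f) (pi1_class g) = pi1_class (concat f g).
Proof. by apply: pi1_class_eq; apply: homotopic_concat; exact: homotopic_repr. Qed.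

Lemma pi1_invE f : pi1_inv (pi1_class f) = pi1_class (rev_loop f).
Proof. by apply: pi1_class_eq; apply: homotopic_rev; exact: homotopic_repr. Qed.

Lemma pi1_mulA : associative pi1_mul.
Proof.
move=> x y z; rewrite -(pi1_class_repr x) -(pi1_class_repr y).
rewrite -(pi1_class_repr z) !pi1_mulE.
by apply: pi1_class_eq; exact: concatA.
Qed.

Lemma pi1_mul1 : left_id pi1_one pi1_mul.
Proof.
move=> x; rewrite -(pi1_class_repr x) pi1_mulE.
by apply: pi1_class_eq; exact: concat1f.
Qed.

Lemma pi1_1mul : right_id pi1_one pi1_mul.
Proof.
move=> x; rewrite -(pi1_class_repr x) pi1_mulE.
by apply: pi1_class_eq; exact: concatf1.
Qed.

Lemma pi1_mulV : left_inverse pi1_one pi1_inv pi1_mul.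
Proof.
move=> x; rewrite -(pi1_class_repr x) pi1_invE pi1_mulE.
by apply: pi1_class_eq; exact: concatVf.
Qed.

Lemma pi1_Vmul : right_inverse pi1_one pi1_inv pi1_mul.
Proof.
move=> x; rewrite -(pi1_class_repr x) pi1_invE pi1_mulE.
by apply: pi1_class_eq; exact: concatfV.
Qed.

HB.instance Definition _ := isGroup.Build (pi1 R p)
  pi1_mulA pi1_mul1 pi1_1mul pi1_mulV pi1_Vmul.

End Pi1Group.

Section FreeGroup.
Context (A : choiceType).

(* (a, true) stands for the generator a and (a, false) for its inverse. *)
Definition letter : Type := (A * bool)%type.
HB.instance Definition _ := Choice.on letter.
Implicit Types (l : letter) (u v w : seq letter).

Definition letter_inv l : letter := (l.1, ~~ l.2).

Definition reduced w : bool := sorted (fun l m => m != letter_inv l) w.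

Record freeGroup : Type := FreeGroup { word :> seq letter; _ : reduced word }.
HB.instance Definition _ := [isSub for word].
HB.instance Definition _ := [Choice of freeGroup by <:].

Definition push_letter l w : seq letter :=
  if w is m :: w' then if m == letter_inv l then w' else l :: w else [:: l].

Definition word_act u w : seq letter := foldr push_letter w u.

Lemma letter_invK : involutive letter_inv.
Proof. by case=> a b; rewrite /letter_inv /= negbK. Qed.

Lemma reduced_behead l w : reduced (l :: w) -> reduced w.
Proof. exact: path_sorted. Qed.

Lemma push_reduced l w : reduced w -> reduced (push_letter l w).
Proof.
case: w => //= m w; case: ifPn => [_|ml rw]; first exact: path_sorted.
by rewrite /reduced /= ml.
Qed.

Lemma word_act_reduced u w : reduced w -> reduced (word_act u w).
Proof. by move=> rw; elim: u => //= l u; exact: push_reduced. Qed.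

Lemma pushK l w : reduced w -> push_letter l (push_letter (letter_inv l) w) = w.
Proof.
case: w => [|m w] /= rw; first by rewrite eqxx.
rewrite letter_invK; case: eqP => [ml|_]; last by rewrite /= eqxx.
by rewrite ml in rw *; case: w rw => //= n w /andP [/negbTE ->].
Qed.

Lemma word_act_push l v w : reduced w -> word_act (push_letter l v) w = push_letter l (word_act v w).
Proof.
case: v => //= m v rw; case: eqP => // ->.
by rewrite pushK//; exact: word_act_reduced.
Qed.

Lemma word_act_act u v w : reduced w -> word_act (word_act u v) w = word_act u (word_act v w).
Proof. by move=> rw; elim: u => //= l u IH; rewrite word_act_push// IH. Qed.

Lemma word_act_nil u : reduced u -> word_act u [::] = u.
Proof.
elim: u => //= l u IH ru; rewrite IH; last exact: reduced_behead ru.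
by case: u ru {IH} => //= m u /andP [/negbTE ->].
Qed.

Definition word_inv u : seq letter := rev (map letter_inv u).

Lemma word_invK : involutive word_inv.
Proof.
by move=> u; rewrite /word_inv map_rev revK -map_comp map_id_in // => l _ /=;
  rewrite letter_invK.
Qed.

Lemma word_inv_reduced u : reduced u -> reduced (word_inv u).
Proof.
rewrite /reduced /word_inv rev_sorted sorted_map; apply: sub_sorted => l m /=.
by rewrite letter_invK eq_sym.
Qed.

Lemma word_act_inv u w : reduced w -> word_act (word_inv u) (word_act u w) = w.
Proof.
elim: u w => //= l u IH w rw.
rewrite /word_inv /= rev_cons -cats1 /word_act foldr_cat /=.
have -> : push_letter (letter_inv l) (push_letter l (word_act u w)) = word_act u w; last exact: IH.
by rewrite -{2}(letter_invK l) pushK//; exact: word_act_reduced.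
Qed.

Fact freeGroup_mul_subproof (x y : freeGroup) : reduced (word_act x y).
Proof. by apply: word_act_reduced; exact: valP. Qed.
Definition freeGroup_mul x y := FreeGroup (freeGroup_mul_subproof x y).

Fact freeGroup_inv_subproof (x : freeGroup) : reduced (word_inv x).
Proof. by apply: word_inv_reduced; exact: valP. Qed.
Definition freeGroup_inv x := FreeGroup (freeGroup_inv_subproof x).

Definition freeGroup_one : freeGroup := @FreeGroup [::] isT.

Lemma freeGroup_mulA : associative freeGroup_mul.
Proof. by move=> x y z; apply: val_inj; rewrite /= word_act_act//; exact: valP. Qed.

Lemma freeGroup_mul1 : left_id freeGroup_one freeGroup_mul.
Proof. by move=> x; apply: val_inj. Qed.

Lemma freeGroup_1mul : right_id freeGroup_one freeGroup_mul.
Proof. by move=> x; apply: val_inj; rewrite /= word_act_nil//; exact: valP. Qed.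

Lemma freeGroup_mulV : left_inverse freeGroup_one freeGroup_inv freeGroup_mul.
Proof.
move=> x; apply: val_inj => /=.
by rewrite -{2}(word_act_nil (valP x)) word_act_inv.
Qed.

Lemma freeGroup_Vmul : right_inverse freeGroup_one freeGroup_inv freeGroup_mul.
Proof.
move=> x; apply: val_inj => /=.
rewrite -{1}(word_invK x) -{2}(word_act_nil (freeGroup_inv_subproof x)).
by rewrite word_act_inv.
Qed.

HB.instance Definition _ := isGroup.Build freeGroup
  freeGroup_mulA freeGroup_mul1 freeGroup_1mul freeGroup_mulV freeGroup_Vmul.

End FreeGroup.

Section Cubes.
Context {R : realType}.

Definition sgb (b : bool) : R := if b then 1 else -1.

Definition cube n : set 'rV[R]_n := [set x | forall i, -1 <= x 0 i <= 1].

Definition open_cube n : set 'rV[R]_n := [set x | forall i, -1 < x 0 i < 1].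

Definition facet n (i : 'I_n) (b : bool) : set 'rV[R]_n :=
  [set x | cube x /\ x 0 i = sgb b].

(* The norm of 'rV[R]_n in the library is the sup norm; the metric on cubes is
   the Euclidean one. *)
Definition sqdist n (x y : 'rV[R]_n) : R := \sum_i (x 0 i - y 0 i) ^+ 2.

Definition isometry_onto m n (A : set 'rV[R]_m) (B : set 'rV[R]_n)
    (phi : 'rV[R]_m -> 'rV[R]_n) : Prop :=
  phi @` A = B /\
  forall x y, A x -> A y -> sqdist (phi x) (phi y) = sqdist x y.

End Cubes.

(* A space presented as a gluing of cubes [-1, 1]^n along their faces by
   isometries. [cell n] indexes the n-cubes and [cmap c] is the characteristic
   map of c (only its values on the cube matter). As for Delta-complexes: the
   space is partitioned by the images of the open cubes, on which the
   characteristic maps are injective; the restriction of a characteristic map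
   to a codimension-1 face is the characteristic map of a cube of one dimension
   less, up to an isometry; and the space has the quotient topology. A cube may
   be glued to itself along its boundary (the circle with one vertex and one
   edge is a cube complex). *)
Record cubeComplex (R : realType) := CubeComplex {
  cc_space :> topologicalType;
  cell : nat -> Type;
  cmap : forall n, cell n -> 'rV[R]_n -> cc_space;
  cmap_cover : forall p : cc_space,
    exists n (c : cell n) x, open_cube x /\ cmap c x = p;
  cmap_disjoint : forall m n (c : cell m) (d : cell n) x y,
    open_cube x -> open_cube y -> cmap c x = cmap d y ->
    existT cell m c = existT cell n d;
  cmap_inj : forall n (c : cell n) x y,
    open_cube x -> open_cube y -> cmap c x = cmap c y -> x = y;
  cmap_facet : forall n (c : cell n.+1) (i : 'I_n.+1) (b : bool),
    exists (d : cell n) (phi : 'rV[R]_n -> 'rV[R]_n.+1),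
      isometry_onto (@cube R n) (facet i b) phi /\
      forall x, cube x -> cmap c (phi x) = cmap d x;
  cc_closedP : forall A : set cc_space,
    closed A <-> forall n (c : cell n), closed (@cube R n `&` cmap c @^-1` A);
  cc_connected : connected [set: cc_space] }.

Section CubeComplexes.
Context {R : realType} (X : cubeComplex R).

Definition finite_dimensional : Prop :=
  exists N, forall n, (N < n)%N -> cell X n -> False.

(* An oriented edge is a 1-cube with a direction of travel: true is that of
   increasing parameter. *)
Definition oedge : Type := (cell X 1 * bool)%type.

Definition oedge_map (a : oedge) (t : R) : X :=
  cmap a.1 (const_mx (sgb a.2 * t)).

Definition origin (a : oedge) : X := oedge_map a (-1).
Definition terminus (a : oedge) : X := oedge_map a 1.
Definition oedge_rev (a : oedge) : oedge := (a.1, ~~ a.2).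

(* A corner of an n-cube is a vertex of [-1, 1]^n, given by its signs. *)
Definition corner n : Type := (cell X n * {ffun 'I_n -> bool})%type.

Definition corner_vertex n (k : corner n) : X :=
  cmap k.1 (\row_i sgb (k.2 i)).

(* The oriented edge a is the i-th edge of the cube issuing from the corner. *)
Definition corner_edge n (k : corner n) (i : 'I_n) (a : oedge) : Prop :=
  forall t : R, -1 <= t <= 1 ->
    cmap k.1 (\row_j if j == i then - sgb (k.2 j) * t else sgb (k.2 j)) =
    oedge_map a t.

(* The link of a vertex v has as vertices the oriented edges with origin v and
   one (n-1)-simplex for each corner of an n-cube at v; this is the vertex set
   of that simplex. *)
Definition link_simplex n (k : corner n) : set oedge :=
  [set a | exists i, corner_edge k i a].

(* a and b span the corner of a square at their common origin. *)
Definition spans_corner (a b : oedge) : Prop :=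
  exists (k : corner 2) (i j : 'I_2),
    [/\ i != j, corner_edge k i a & corner_edge k j b].

Definition link_simplicial (v : X) : Prop :=
  (forall n (k : corner n) i j a, corner_vertex k = v ->
     corner_edge k i a -> corner_edge k j a -> i = j) /\
  (forall m n (k : corner m) (l : corner n),
     corner_vertex k = v -> corner_vertex l = v ->
     link_simplex k = link_simplex l -> existT corner m k = existT corner n l).

Definition link_flag (v : X) : Prop :=
  forall n (a : 'I_n -> oedge), injective a ->
    (forall i, origin (a i) = v) ->
    (forall i j, i != j -> spans_corner (a i) (a j)) ->
    exists k : corner n, corner_vertex k = v /\ link_simplex k = range a.

Definition NPC : Prop :=
  forall c : cell X 0, link_simplicial (cmap c 0) /\ link_flag (cmap c 0).

(* a is the side of the square q on which the coordinate other than i has sign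
   b, oriented by increasing i-th coordinate. *)
Definition square_side (q : cell X 2) (i : 'I_2) (b : bool) (a : oedge) : Prop :=
  forall t : R, -1 <= t <= 1 ->
    cmap q (\row_j if j == i then t else sgb b) = oedge_map a t.

(* Opposite sides of a square, with matching orientations. *)
Definition opposite_oedges (a b : oedge) : Prop :=
  exists (q : cell X 2) (i : 'I_2) (s : bool),
    square_side q i s a /\ square_side q i (~~ s) b.

Definition opposite_edges (e f : cell X 1) : Prop :=
  exists s t, opposite_oedges (e, s) (f, t).

Definition consecutive_edges (e f : cell X 1) : Prop :=
  exists (q : cell X 2) (i j : 'I_2) (s t b c : bool),
    [/\ i != j, square_side q i s (e, b) & square_side q j t (f, c)].

(* A hyperplane is represented by its set of dual edges. *)
Definition is_hyperplane (h : set (cell X 1)) : Prop :=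
  exists e, h = [set f | clos_refl_sym_trans _ opposite_edges e f].

(* o e is the direction given to e. *)
Definition consistent_orientation (h : set (cell X 1)) (o : cell X 1 -> bool) :
    Prop :=
  forall e f s t, h e -> h f -> opposite_oedges (e, s) (f, t) ->
    (o e == s) = (o f == t).

Definition two_sided (h : set (cell X 1)) : Prop :=
  exists o, consistent_orientation h o.

Definition cross (h h' : set (cell X 1)) : Prop :=
  exists e f, [/\ h e, h' f & consecutive_edges e f].

Definition directly_self_osculates (h : set (cell X 1)) : Prop :=
  exists o, consistent_orientation h o /\
  exists e f, [/\ h e, h f, e <> f &
    let a := (e, o e) in let b := (f, o f) in
    (origin a = origin b /\ ~ spans_corner a b) \/
    (terminus a = terminus b /\ ~ spans_corner (oedge_rev a) (oedge_rev b))].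

Definition interosculate (h h' : set (cell X 1)) : Prop :=
  cross h h' /\
  exists a b : oedge,
    [/\ h a.1, h' b.1, origin a = origin b & ~ spans_corner a b].

Definition special : Prop :=
  [/\ NPC,
      forall h, is_hyperplane h -> two_sided h,
      forall h, is_hyperplane h -> ~ cross h h,
      forall h, is_hyperplane h -> ~ directly_self_osculates h &
      forall h h', is_hyperplane h -> is_hyperplane h' -> h <> h' ->
        ~ interosculate h h'].

End CubeComplexes.

(* Main.v *)
(* The group is read off from edge paths and the hyperplanes that they cross: every
   loop is homotopic to an edge loop, since small stars of points contract along
   straight lines. Suppose that there are disjoint hyperplanes h and k and two
   loops whose signed crossing numbers with h and k are independent. Then the
   complement of h and k is connected in the 1-skeleton, and reading the crossings
   with h and k along a path maps the group onto the free group on h and k.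

   If there are no such hyperplanes, an edge loop p whose crossing numbers are all
   zero is null-homotopic, so commutators vanish. Indeed, consider two letters of
   the cyclic word p that cross the same hyperplane h in opposite directions, with
   no crossing of h in between. If all hyperplanes crossed in between cross h, the
   absence of osculations lets the first letter slide through squares until it
   cancels with the second one. If some pair does not cancel in this way, a
   hyperplane k disjoint from h is crossed in between. As h is connected, the
   segment closes up along h to a loop that misses h; when its crossing number
   with k is nonzero, h must be separating, and nesting such pairs on both sides
   of their hyperplanes yields two hyperplanes and loops as above. *)
Require Import Defs.
From HB Require Import structures.
From Stdlib Require Import Relation_Operators.
From mathcomp Require Import all_boot all_order all_algebra.
From mathcomp Require Import boolp classical_sets functions set_interval reals topology normedtype.
From mathcomp Require Import zify ring lra.

Set Implicit Arguments.
Unset Strict Implicit.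
Unset Printing Implicit Defensive.

Import Order.TTheory GRing.Theory Num.Theory.
Import numFieldNormedType.Exports.

(** * The combinatorics of hyperplane crossings *)

(** The universal cover and its geometry are avoided: specialness enters the combinatorics only
    through a few axioms on a graph whose oriented edges carry a label, the dual hyperplane, and a
    sign. What remains is to reach arbitrary loops. The base point need not be a vertex, the complex
    need not be locally finite, and a cube may be glued to itself along its boundary. Hence the
    stars of points have a radius depending on the point, chosen so small that a nearby point of a
    cube sees at most one preimage of the centre. The map to the free group is defined on all
    continuous paths, as the product of a locally defined cocycle along a fine subdivision; in this
    form its homotopy invariance needs no cellular approximation of homotopies. That loops are
    homotopic to edge loops serves the abelian case, where commutation is checked on edge loops. *)

Section LabelledGraph.
Context (V E : Type) (L : eqType) (src tgt : E -> V) (rev : E -> E)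
  (lab : E -> L) (pos : E -> bool).
Hypothesis src_rev : forall a, src (rev a) = tgt a.
Hypothesis tgt_rev : forall a, tgt (rev a) = src a.
Hypothesis lab_rev : forall a, lab (rev a) = lab a.
Hypothesis pos_rev : forall a, pos (rev a) = ~~ pos a.

Fixpoint edge_path (x : V) (p : seq E) (y : V) : Prop :=
  if p is a :: p' then src a = x /\ edge_path (tgt a) p' y else x = y.

Definition weight (k : L) (a : E) : int :=
  if lab a == k then (if pos a then 1 else -1)%R else 0%R.

Definition crossings (k : L) (p : seq E) : int := (\sum_(a <- p) weight k a)%R.

Definition inv_path (p : seq E) : seq E := seq.rev (map rev p).

Lemma edge_path_cat x p y q z :
  edge_path x p y -> edge_path y q z -> edge_path x (p ++ q) z.
Proof.
elim: p x => [x -> //|a p IH x [<- pp] qq] /=; split => //; exact: IH.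
Qed.

Lemma edge_path_inv x p y : edge_path x p y -> edge_path y (inv_path p) x.
Proof.
elim: p x => [x -> //|a p IH x [<- /IH pp]].
rewrite /inv_path /= rev_cons -cats1; apply: edge_path_cat pp _.
by rewrite /= src_rev tgt_rev.
Qed.

Lemma crossings_cat k p q : (crossings k (p ++ q) = crossings k p + crossings k q)%R.
Proof. exact: big_cat. Qed.

Lemma weight_rev k a : (weight k (rev a) = - weight k a)%R.
Proof. by rewrite /weight lab_rev pos_rev; case: ifP; case: (pos a); rewrite ?opprK ?oppr0. Qed.

Lemma crossings_inv k p : (crossings k (inv_path p) = - crossings k p)%R.
Proof.
elim: p => [|a p IH]; first by rewrite /crossings !big_nil oppr0.
rewrite /inv_path /= rev_cons -cats1 crossings_cat IH.
by rewrite /crossings big_seq1 big_cons weight_rev opprD addrC.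
Qed.

Lemma weight_neq0 a : weight (lab a) a != 0%R.
Proof. by rewrite /weight eqxx; case: (pos a). Qed.

Lemma weight_opp k a b : lab a = lab b -> pos a <> pos b ->
  (weight k a + weight k b = 0)%R.
Proof.
by move=> ab; rewrite /weight ab; case: ifP => _; case: (pos a); case: (pos b).
Qed.

Lemma crossings0 k p : k \notin map lab p -> crossings k p = 0%R.
Proof.
rewrite /crossings; elim: p => [_|a p IH]; first by rewrite big_nil.
rewrite inE negb_or => /andP [/negbTE ka kp].
by rewrite big_cons IH// /weight eq_sym ka.
Qed.

(** [hp x p q] stands for homotopy, relative to the end points, of edge paths from [x]. In the
    application [determined] expresses the absence of direct self-osculation and [square] that of
    interosculation; [parallel] holds because a hyperplane is connected and two-sided, and [corner]
    because two hyperplanes cross in a square. *)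
Context (cross : L -> L -> Prop) (hp : V -> seq E -> seq E -> Prop) (x0 : V).
Hypothesis cross_sym : forall h k, cross h k -> cross k h.
Hypothesis cross_irr : forall h, ~ cross h h.
Hypothesis determined : forall a b,
  src a = src b -> lab a = lab b -> pos a = pos b -> a = b.
Hypothesis square : forall a b, src a = src b -> cross (lab a) (lab b) ->
  exists a' b', [/\ src a' = tgt b, src b' = tgt a, tgt a' = tgt b' &
    [/\ lab a' = lab a, pos a' = pos a, lab b' = lab b, pos b' = pos b &
       hp (src a) [:: a; b'] [:: b; a']]].
Hypothesis parallel : forall a b, lab a = lab b -> pos a = pos b ->
  exists2 p, edge_path (src a) p (src b) &
    forall l, l \in map lab p -> cross (lab a) l.
Hypothesis corner : forall h k, cross h k ->
  exists a b, [/\ src a = src b, lab a = h & lab b = k].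
Hypothesis hp_refl : forall x p y, edge_path x p y -> hp x p p.
Hypothesis hp_sym : forall x p q, hp x p q -> hp x q p.
Hypothesis hp_trans : forall x p q r, hp x p q -> hp x q r -> hp x p r.
Hypothesis hp_cat : forall x y p p' q q', edge_path x p y -> edge_path x p' y ->
  hp x p p' -> hp y q q' -> hp x (p ++ q) (p' ++ q').
Hypothesis hp_cancel : forall a, hp (src a) [:: a; rev a] [::].

(** Restricting to vertices joined to [x0] by an edge path makes connectedness of the 1-skeleton
    unnecessary. *)
Definition reachable x := exists p, edge_path x0 p x.

Lemma reachable_path x p y : reachable x -> edge_path x p y -> reachable y.
Proof. by move=> [q xq] yp; exists (q ++ p); apply: edge_path_cat yp. Qed.

(** Intersection with [h] vanishes on loops, so the signed number of crossings of a path with [h]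
    depends only on its end points. *)
Definition separating h := forall x p,
  reachable x -> edge_path x p x -> crossings h p = 0%R.

Lemma separating_path h x y p q : separating h -> reachable x ->
  edge_path x p y -> edge_path x q y -> crossings h p = crossings h q.
Proof.
move=> sh rx xp xq; apply/eqP; rewrite -subr_eq0 -crossings_inv -crossings_cat.
by apply/eqP; apply: sh rx _; apply: edge_path_cat xp (edge_path_inv xq).
Qed.

Lemma parallel_crossings h a b : lab a = lab b -> pos a = pos b ->
  ~ cross h (lab a) ->
  exists2 p, edge_path (src a) p (src b) & crossings h p = 0%R.
Proof.
move=> labab posab nc; have [p ep cp] := parallel labab posab.
by exists p => //; apply: crossings0; apply/negP => /cp /cross_sym.
Qed.

(** [parallel] compares edges of equal sign. If the signs differ it is applied to [rev b], and
    crossing [b] backwards is free because its label is not [h]. *)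
Lemma same_label_path h a b : lab a = lab b -> ~ cross h (lab a) -> h <> lab a ->
  exists2 p, edge_path (src a) p (src b) & crossings h p = 0%R.
Proof.
move=> labab nc ha; have [|pab] := eqVneq (pos a) (pos b).
  by move=> pab; apply: parallel_crossings.
have [|||p ep cp] := @parallel_crossings h a (rev b) => //.
- by rewrite lab_rev.
- by rewrite pos_rev; move: pab; case: (pos a); case: (pos b).
exists (p ++ [:: rev b]); first by apply: (edge_path_cat ep) => /=; rewrite src_rev tgt_rev.
by rewrite crossings_cat cp /crossings big_seq1 /weight lab_rev -labab ifF ?addr0//;
  apply/eqP => /esym.
Qed.

(* [h] does not separate edges whose hyperplanes are disjoint from [h] and
   meet one another. *)
Lemma same_side h c d p : separating h -> reachable (src c) ->
  ~ cross h (lab c) -> h <> lab c -> ~ cross h (lab d) -> h <> lab d ->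
  lab c = lab d \/ cross (lab c) (lab d) ->
  edge_path (src c) p (src d) -> crossings h p = 0%R.
Proof.
move=> sh rc nc hc nd hd cd ep.
suff [q eq cq] : exists2 q, edge_path (src c) q (src d) & crossings h q = 0%R.
  by rewrite (separating_path sh rc ep eq).
case: cd => [cd|/corner [a [b [ab ac bd]]]]; first exact: same_label_path.
(* At a corner where the two hyperplanes cross, the path changes from one to the other. *)
have [q eq cq] := same_label_path (esym ac) nc hc.
have [|||r er cr] := @same_label_path h b d; rewrite ?bd//.
exists (q ++ r); last by rewrite crossings_cat cq cr addr0.
by apply: edge_path_cat er; rewrite -ab.
Qed.

(** The 2 by 2 matrix of crossing numbers is nonsingular. The loops may have different base points,
    as conjugation by a path does not change crossing numbers. *)
Definition independent_pair := exists h k x y p q,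
  [/\ h <> k, ~ cross h k, reachable x, reachable y &
   [/\ edge_path x p x, edge_path y q y &
       (crossings h p * crossings k q)%R <> (crossings k p * crossings h q)%R]].

(** * Opposite pairs of letters in a cyclic word *)

Section Cyclic.
Context (P : nat -> E).

Definition seg i j := map P (index_iota i j).
Definition segc k i j : int := (\sum_(i <= t < j) weight k (P t))%R.

Lemma crossings_seg k i j : crossings k (seg i j) = segc k i j.
Proof. by rewrite /crossings big_map. Qed.

Lemma seg_cat i j k : i <= j -> j <= k -> seg i j ++ seg j k = seg i k.
Proof.
move=> ij jk; rewrite /seg -map_cat /index_iota.
by congr map; rewrite (_ : k - i = (j - i) + (k - j)) ?iotaD ?subnKC//; lia.
Qed.

Lemma seg_cons i j : i < j -> seg i j = P i :: seg i.+1 j.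
Proof.
move=> ij; rewrite /seg /index_iota.
by rewrite (_ : j - i = (j - i.+1).+1)//; lia.
Qed.

Lemma segc_cat k i j l : i <= j -> j <= l -> segc k i l = (segc k i j + segc k j l)%R.
Proof. by move=> ij jl; rewrite /segc (big_cat_nat ij jl). Qed.

Lemma segc_cons k i j : i < j -> segc k i j = (weight k (P i) + segc k i.+1 j)%R.
Proof. by move=> ij; rewrite /segc big_ltn. Qed.

Lemma segc0 k i j : (forall t, i <= t < j -> lab (P t) <> k) -> segc k i j = 0%R.
Proof.
move=> H; rewrite /segc big_nat big1// => t tij.
by rewrite /weight ifF//; apply/eqP; exact: H.
Qed.

Hypothesis P_path : forall i, tgt (P i) = src (P i.+1).

Lemma edge_path_seg i j : i <= j -> edge_path (src (P i)) (seg i j) (src (P j)).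
Proof.
move=> ij; rewrite /seg /index_iota -{2}(subnKC ij); move: (j - i) => m {ij}.
elim: m i => [|m IH] i /=; first by rewrite addn0.
by split=> //; rewrite P_path addnS -addSn; exact: IH.
Qed.

Context (n : nat).
Hypothesis P_periodic : forall i, P (i + n) = P i.
Hypothesis n_gt0 : 0 < n.
Hypothesis P_reach : reachable (src (P 0)).
Hypothesis no_pair : ~ independent_pair.

Lemma reach_P i : reachable (src (P i)).
Proof. by apply: reachable_path P_reach (edge_path_seg (leq0n i)). Qed.

(** Neighbouring occurrences of one label with opposite signs: the candidates for a cancellation. *)
Definition opp_pair i j := [/\ i < j, lab (P i) = lab (P j), pos (P i) <> pos (P j) &
  forall t, i < t < j -> lab (P t) <> lab (P i)].

(** The cancellation is obstructed homologically, by a disjoint hyperplane with nonzero signed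
    crossing number in between. *)
Definition heavy i j :=
  opp_pair i j /\ exists2 k, ~ cross (lab (P i)) k & segc k i.+1 j <> 0%R.

(** A label that occurs with total weight zero occurs with both signs. Two occurrences of opposite
    sign at minimal distance have no occurrence in between: that one would be opposite to one of
    them and closer. *)
Lemma opp_pair_in k i j t : i <= t < j -> lab (P t) = k -> segc k i j = 0%R ->
  exists a b, [/\ i <= a, b < j, opp_pair a b & lab (P a) = k].
Proof.
move=> tij tk s0.
pose opp d := `[< exists a b, [/\ i <= a < b, b < j, b - a = d, lab (P a) = k &
    lab (P b) = k /\ pos (P a) <> pos (P b)] >].
have [[d dP]|nod] := pselect (exists d, opp d).
  case: (ex_minnP (ex_intro _ d dP)) => {d dP} d /asboolP [a [b [iab bj dE ak [bk ab]]]] dmin.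
  exists a, b; split=> //; try lia; split=> //; [lia|by rewrite ak bk|move=> u uab uk].
  have [pu|pu] := eqVneq (pos (P u)) (pos (P a)).
  - have : opp (b - u) by apply/asboolP; exists u, b; split=> //; [lia|by rewrite uk|by rewrite pu].
    by move=> /dmin; lia.
  - have : opp (u - a).
      apply/asboolP; exists a, u; split=> //; [lia|lia|].
      by split; [rewrite uk|move=> E1; move: pu; rewrite E1 eqxx].
    by move=> /dmin; lia.
have same u : i <= u < j -> lab (P u) = k -> pos (P u) = pos (P t).
  move=> uij uk; apply/eqP/negP => /negP/eqP ut; apply: nod.
  have [ltut|lttu|eut] := ltngtP u t.
  - exists (t - u); apply/asboolP; exists u, t; split=> //; lia.
  - exists (u - t); apply/asboolP; exists t, u; split=> //; [lia|lia|].
    by split => // /esym.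
  - by rewrite eut in ut.
(* All occurrences now have the sign of [P t], so no term can compensate that of [P t]. *)
exfalso; move: s0.
have it : i <= t by lia.
have tj : t.+1 <= j by lia.
rewrite (segc_cat _ it) ?(ltnW tj)// (segc_cons _ tj).
have wt : weight k (P t) = (if pos (P t) then 1 else -1)%R by rewrite /weight tk eqxx.
have sgn a b : i <= a -> b <= j ->
    (0 <= (if pos (P t) then 1 else -1) * segc k a b)%R.
  move=> ia bj; rewrite /segc mulr_sumr big_nat; apply: sumr_ge0 => u uab.
  rewrite /weight; case: eqP => [uk|_]; last by rewrite mulr0.
  by rewrite same//; [case: ifP|lia].
have := sgn i t (leqnn _) (ltnW tj); have := sgn t.+1 j (leqW it) (leqnn _).
rewrite wt; case: (pos (P t)); lia.
Qed.

Lemma heavyE i j k : opp_pair i j -> ~ cross (lab (P i)) k -> segc k i.+1 j <> 0%R ->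
  lab (P i) <> k.
Proof. by move=> [_ _ _ H] _ s0 ik; apply: s0; apply: segc0 => t tij; rewrite -ik; exact: H. Qed.

Lemma segc_has k i j : segc k i j <> 0%R -> exists2 t, i <= t < j & lab (P t) = k.
Proof.
move=> s0; apply: contrapT => no; apply: s0; apply: segc0 => t tij tk.
by apply: no; exists t.
Qed.

(* The path between the two letters closes up, along the hyperplane, to a loop
   that misses [lab (P i)]. *)
Lemma heavy_loop i j : opp_pair i j ->
  exists p, [/\ edge_path (src (P i.+1)) p (src (P i.+1)),
    crossings (lab (P i)) p = 0%R &
    forall k, ~ cross (lab (P i)) k -> crossings k p = segc k i.+1 j].
Proof.
move=> [ij lij pij bt].
have [||p ep cp] := @parallel (P j) (rev (P i)).
- by rewrite lab_rev.
- by rewrite pos_rev; move: pij; case: (pos (P i)); case: (pos (P j)) => // /(_ erefl).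
have Hk k : ~ cross (lab (P i)) k -> crossings k p = 0%R.
  by move=> nck; apply: crossings0; apply/negP => /cp; rewrite -lij.
exists (seg i.+1 j ++ p); split.
- by apply: edge_path_cat (edge_path_seg ij) _; rewrite -P_path -src_rev.
- rewrite crossings_cat Hk ?crossings_seg ?addr0; last exact: cross_irr.
  by apply: segc0 => t /andP [? ?]; apply: bt; apply/andP.
- by move=> k nck; rewrite crossings_cat Hk// crossings_seg addr0.
Qed.

(** The closed-up loop misses [lab (P i)] and crosses [k]; a loop with nonzero crossing number with
    [lab (P i)] would complete it to a triangular nonsingular matrix. *)
Lemma heavy_separating i j : heavy i j -> separating (lab (P i)).
Proof.
move=> [pij [k nck s0]] x q rx eq; apply: contrapT => q0; apply: no_pair.
have [p [ep ph pk]] := heavy_loop pij.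
exists (lab (P i)), k, x, (src (P i.+1)), q, p; split=> //.
- exact: heavyE pij nck s0.
- exact: reach_P.
- split=> //; rewrite ph mulr0 pk//.
  by move=> /eqP; rewrite mulf_eq0 => /orP [] /eqP.
Qed.


(** The pairs open in opposite directions across one separating hyperplane, so [P t] and [P t'] lie
    on different sides: the path from [P t] on to [P j], along the hyperplane to [P i'], through it
    and on to [P t'] crosses it exactly once. If their labels were equal or crossing, [same_side]
    would put them on one side. *)
Lemma heavy_opposite_apart i j i' j' t t' : heavy i j -> heavy i' j' ->
  lab (P i) = lab (P i') -> pos (P i) <> pos (P i') ->
  i < t < j -> i' < t' < j' ->
  ~ cross (lab (P i)) (lab (P t)) -> ~ cross (lab (P i)) (lab (P t')) ->
  lab (P t) = lab (P t') \/ cross (lab (P t)) (lab (P t')) -> False.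
Proof.
move=> hij hij' lE pE tij tij' nct nct' tt.
have sh := heavy_separating hij.
case: hij hij' => [[ij lij posij bt] _] [[ij' lij' posij' bt'] _].
have [||p ep cp] := @parallel (P j) (P i').
- by rewrite -lij.
- by move: posij pE; case: (pos (P i)); case: (pos (P j)); case: (pos (P i')).
have tj : t <= j by lia.
have it' : i' <= t' by lia.
have ht : lab (P i) <> lab (P t) by move=> /esym; apply: bt.
have ht' : lab (P i) <> lab (P t') by rewrite lE => /esym; apply: bt'.
have := @same_side _ _ _ (seg t j ++ p ++ seg i' t') sh (reach_P _) nct ht nct' ht' tt.
have -> : crossings (lab (P i)) (seg t j ++ p ++ seg i' t') = weight (lab (P i)) (P i').
  rewrite !crossings_cat (_ : crossings _ p = 0%R); last first.
    by apply: crossings0; apply/negP => /cp; rewrite -lij; exact: cross_irr.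
  rewrite !crossings_seg (@segc0 _ t j); last by move=> u ?; apply: bt; lia.
  rewrite segc_cons ?(@segc0 _ i'.+1 t'); [by rewrite !add0r addr0| |lia].
  by move=> u ?; rewrite lE; apply: bt'; lia.
rewrite lE => H; have /eqP := weight_neq0 (P i'); apply; apply: H.
apply: edge_path_cat (edge_path_seg tj) _.
exact: edge_path_cat ep (edge_path_seg it').
Qed.

(** The hyperplanes [k] and [k'] that make the pairs heavy lie on different sides, hence are
    distinct and disjoint, and neither occurs in the segment of the other. The crossing matrix of
    the two closed-up loops with [k] and [k'] is therefore diagonal and nonsingular. *)
Lemma heavy_opposite i j i' j' : heavy i j -> heavy i' j' ->
  lab (P i) = lab (P i') -> pos (P i) <> pos (P i') -> False.
Proof.
move=> hij hij' lE pE.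
have apart t t' := @heavy_opposite_apart i j i' j' t t' hij hij' lE pE.
case: (hij) (hij') => pij [k nck s0] [pij' [k' nck' s0']].
rewrite -lE in nck'.
have [t tij tk] := segc_has s0; have [t' tij' tk'] := segc_has s0'.
have it : i < t < j by lia.
have it' : i' < t' < j' by lia.
have nkk' : ~ (k = k' \/ cross k k').
  by rewrite -tk -tk'; apply: apart; rewrite ?tk ?tk'.
have k0 : segc k i'.+1 j' = 0%R.
  by apply: segc0 => u uij uk; apply: (apart t u); rewrite ?tk ?uk//; left.
have k'0 : segc k' i.+1 j = 0%R.
  by apply: segc0 => u uij uk; apply: (apart u t'); rewrite ?tk' ?uk//; left.
have [p [ep ph pk]] := heavy_loop pij; have [q [eq qh qk]] := heavy_loop pij'.
rewrite -lE in qk.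
apply: no_pair; exists k, k', (src (P i.+1)), (src (P i'.+1)), p, q; split.
- by move=> kk'; apply: nkk'; left.
- by move=> kk'; apply: nkk'; right.
- exact: reach_P.
- exact: reach_P.
- split=> //; rewrite !pk// !qk// k0 k'0 mulr0 => /eqP.
  by rewrite mulf_eq0 => /orP [] /eqP.
Qed.

Lemma next_letter i j : j < i ->  lab (P j) = lab (P i) ->
  exists j', [/\ j < j', j' <= i, lab (P j') = lab (P j) &
    forall t, j < t < j' -> lab (P t) <> lab (P j)].
Proof.
move=> ji lji; pose Q t := (j < t) && (lab (P t) == lab (P j)).
have Qi : Q i by rewrite /Q ji lji eqxx.
case: (ex_minnP (ex_intro Q i Qi)) => j' /andP [jj' /eqP lj'] jmin.
exists j'; split=> // [|t /andP [jt tj] tl]; first exact: jmin.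
by have /jmin : Q t by [rewrite /Q jt tl eqxx]; rewrite leqNgt tj.
Qed.

Lemma previous_letter i j : j < i ->  lab (P j) = lab (P i) ->
  exists i', [/\ j <= i', i' < i, lab (P i') = lab (P i) &
    forall t, i' < t < i -> lab (P t) <> lab (P i)].
Proof.
move=> ji lji; pose Q t := (t < i) && (lab (P t) == lab (P i)).
have Qi : Q j by rewrite /Q ji lji eqxx.
have Qb t : Q t -> t <= i by case/andP => /ltnW.
case: (ex_maxnP (ex_intro Q j Qi) Qb) => i' /andP [ii' /eqP li'] imax.
exists i'; split=> // [|t /andP [jt tj] tl]; first exact: imax.
by have /imax : Q t by [rewrite /Q tj tl eqxx]; rewrite leqNgt jt.
Qed.

(** With equal signs, the segment would cross the hyperplane once, while a path along the hyperplane
    between the same vertices does not cross it. *)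
Lemma separating_alternate i j : separating (lab (P i)) -> i < j ->
  lab (P i) = lab (P j) ->
  (forall t, i < t < j -> lab (P t) <> lab (P i)) -> opp_pair i j.
Proof.
move=> sh ij lij bt; split=> // pij.
have [p ep cp] := @parallel_crossings (lab (P i)) (P i) (P j) lij pij (@cross_irr _).
have := separating_path sh (reach_P i) (edge_path_seg (ltnW ij)) ep.
rewrite cp crossings_seg segc_cons// (@segc0 _ i.+1 j); last first.
  by move=> t ?; apply: bt; lia.
by rewrite addr0 => /eqP; rewrite (negbTE (weight_neq0 _)).
Qed.

Hypothesis irreducible : forall i j, opp_pair i j ->
  exists2 t, i < t < j & ~ cross (lab (P i)) (lab (P t)).
Hypothesis balanced : forall k, segc k 0 n = 0%R.

(* A shortest opposite pair is heavy; heavy pairs lie on one side of their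
   hyperplane only, so there is a pair that is not heavy. In a shortest pair of
   the latter kind lies a heavy pair of some other hyperplane, and what makes it
   heavy makes the outer pair heavy. *)
Lemma irreducible_cycle : False.
Proof.
have [i0 [j0 h0]] : exists i j, heavy i j.
  pose Q d := `[< exists i j, opp_pair i j /\ j - i = d >].
  have [d dP] : exists d, Q d.
    have [|||a [b [_ _ ab _]]] := @opp_pair_in (lab (P 0)) 0 n 0 => //.
    by exists (b - a); apply/asboolP; exists a, b.
  case: (ex_minnP (ex_intro _ d dP)) => {d dP} d /asboolP [i [j [pij dE]]] dmin.
  have [t tij nct] := irreducible pij.
  (* If the hyperplane of [P t] had crossing number zero, its letters would contain a shorter
     opposite pair. *)
  exists i, j; split=> //; exists (lab (P t)) => // s0.
  have [|||a [b [ia bj pab _]]] := @opp_pair_in (lab (P t)) i.+1 j t => //.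
  have : Q (b - a) by apply/asboolP; exists a, b.
  by move=> /dmin; case: pab; lia.
have [i1 [j1 [p1 l1]]] : exists i j, opp_pair i j /\ ~ heavy i j.
  have sh := heavy_separating h0; case: (h0) => [[ij lij pij bt] _].
  (* By periodicity the label returns after [j0]. Its signs alternate, so the next pair opens in the
     opposite direction and cannot be heavy as well. *)
  have [||j1 [j01 _ lj1 bt1]] := @next_letter (j0 + n) j0; [lia|by rewrite P_periodic|].
  have p1 : opp_pair j0 j1.
    by apply: separating_alternate => //; rewrite -lij.
  by exists j0, j1; split => // h1; apply: (heavy_opposite h0 h1).
pose Q d := `[< exists i j, [/\ opp_pair i j, ~ heavy i j & j - i = d] >].
have Q1 : Q (j1 - i1) by apply/asboolP; exists i1, j1.
case: (ex_minnP (ex_intro Q _ Q1)) => {i1 j1 p1 l1 Q1} d /asboolP [i [j [pij lij dE]]] dmin.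
have shorter a b : opp_pair a b -> b - a < j - i -> heavy a b.
  move=> pab ab; apply: contrapT => nh.
  have /dmin : Q (b - a) by apply/asboolP; exists a, b.
  by rewrite -dE leqNgt ab.
have light m : ~ cross (lab (P i)) m -> segc m i.+1 j = 0%R.
  by move=> ncm; apply: contrapT => sm; apply: lij; split=> //; exists m.
case: (pij) => ij lij' posij bt.
have [t tij nct] := irreducible pij.
have [|||a [b [ia bj pab lak]]] := @opp_pair_in (lab (P t)) i.+1 j t => //.
  exact: light.
have [ab lab_ab posab btab] := pab.
have hab : heavy a b by apply: shorter => //; lia.
have sk := heavy_separating hab.
set k := lab (P a) in sk lab_ab btab.
have ki : k <> lab (P i) by rewrite /k lak; apply: bt.
have nck : ~ cross k (lab (P i)) by rewrite /k lak => /cross_sym.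
(* A further occurrence of [k] between [i] and [j] would form with [a] or [b] a shorter, hence
   heavy, pair that opens in the direction opposite to [(a, b)]. *)
have after u : b < u < j -> lab (P u) <> k.
  move=> /andP [bu uj] uk.
  have [||c [bc cu lc bt']] := @next_letter u b => //; first by rewrite uk.
  have pbc : opp_pair b c by apply: separating_alternate => //; rewrite -lab_ab.
  apply: (heavy_opposite hab (shorter _ _ pbc _)) => //; lia.
have before u : i < u < a -> lab (P u) <> k.
  move=> /andP [iu ua] uk.
  have [||c [uc ca lc bt']] := @previous_letter a u => //.
  have pca : opp_pair c a.
    by apply: separating_alternate; rewrite ?lc.
  apply: (heavy_opposite (shorter _ _ pca _) hab) => //; first lia.
  by case: pca.
have between u v : i <= u <= a -> a < v <= b -> segc k u v = weight k (P a).
  move=> iua avb; rewrite (@segc_cat k u a v) ?(@segc_cons k a v); [|lia|lia|lia].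
  rewrite (@segc0 k u a) ?(@segc0 k a.+1 v) ?addr0 ?add0r//.
    by move=> w wv; apply: btab; lia.
  move=> w wa; have [<-|iw] := eqVneq i w; first exact/nesym.
  by apply: before; lia.
have wk : weight k (P a) != 0%R := weight_neq0 (P a).
case: hab => _ [m ncm sm].
have hm := heavyE pab ncm sm.
have [u uab um] := segc_has sm.
(* [P c] and [P v] are on different sides of [k], since the segment between them meets [k] only at
   [a]. *)
have side c v : i <= c <= a -> a < v <= b -> k <> lab (P c) -> ~ cross k (lab (P c)) ->
    k <> lab (P v) -> ~ cross k (lab (P v)) ->
    lab (P c) = lab (P v) \/ cross (lab (P c)) (lab (P v)) -> False.
  move=> ica avb kc nckc kv nckv cv; move/eqP: wk; apply.
  rewrite -(between c v)// -crossings_seg.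
  apply: (same_side sk (reach_P c) nckc kc nckv kv cv).
  by apply: edge_path_seg; lia.
have m_before v : i < v < a -> lab (P v) <> m.
  move=> iva vm; apply: (side v u); rewrite ?vm ?um//; first [lia|by left].
have m_after v : b < v < j -> lab (P v) <> m.
  move=> bvj vm; have := weight_neq0 (P b); rewrite -lab_ab => /eqP; apply.
  have bv : b < v by lia.
  have ub : u <= b by lia.
  have <- : segc k u v = weight k (P b).
    rewrite (segc_cat k ub (ltnW bv)) (@segc0 k u b) ?(segc_cons k bv) ?(@segc0 k b.+1 v);
      rewrite ?addr0 ?add0r//.
      by move=> w wbv; apply: after; lia.
    by move=> w wub; apply: btab; lia.
  rewrite -crossings_seg; apply: (@same_side k (P u) (P v)); rewrite ?um ?vm//.
  - exact: reach_P.
  - by left.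
  - by apply: edge_path_seg; lia.
(* [P i] lies outside [k] and the letter [P u], labelled [m], lies inside, so their hyperplanes
   cannot cross. Hence [light] applies to [m]; as the letters [m] between [i] and [j] all lie
   between [a] and [b], this contradicts [sm]. *)
have nim : ~ cross (lab (P i)) m.
  by move=> im; apply: (side i u); rewrite ?um//; first [lia|exact/nesym|by right].
apply: sm; move: (light m nim).
have ia' : i.+1 <= a by [].
rewrite (@segc_cat m i.+1 a j) ?(@segc_cons m a j) ?(@segc_cat m a.+1 b j) ?(@segc_cons m b j); try lia.
rewrite (@segc0 m i.+1 a) ?(@segc0 m b.+1 j) ?addr0 ?add0r//.
  by rewrite /weight -lab_ab -/k !ifF ?addr0 ?add0r//; exact/eqP.
Qed.

End Cyclic.

(** * Sliding letters through squares, and balanced loops *)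

Lemma hp_cancel_path x p y : edge_path x p y -> hp x (p ++ inv_path p) [::].
Proof.
elim: p x => [x xy|a p IH x [<- ap]]; first exact: (hp_refl (y := y)).
have ip := edge_path_inv ap.
have pip := edge_path_cat ap ip.
have ara : edge_path (src a) [:: a; rev a] (src a) by rewrite /= src_rev tgt_rev.
rewrite /inv_path /= rev_cons -cats1 catA -/(inv_path p).
apply: hp_trans (hp_cancel a).
have -> : a :: (p ++ inv_path p) ++ [:: rev a] = [:: a] ++ ((p ++ inv_path p) ++ [:: rev a]) by [].
apply: (@hp_cat _ (tgt a) [:: a] [:: a]); rewrite //=; first by apply: (hp_refl (y := tgt a)).
apply: (@hp_cat _ (tgt a) _ [::]) => //; first exact: IH.
by apply: (hp_refl (y := src a)); rewrite /= src_rev tgt_rev.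
Qed.

(** [square] speaks of edges with a common origin, so it is applied to [rev a] and [c], and the new
    edge [b] parallel to [rev a] is traversed backwards. The homotopy inserts [b] with its inverse
    and removes [a] with its inverse. *)
Lemma slide_one a c : src c = tgt a -> cross (lab a) (lab c) ->
  exists a' c', [/\ src c' = src a, tgt c' = src a', tgt a' = tgt c,
    lab c' = lab c /\ pos c' = pos c & [/\ lab a' = lab a, pos a' = pos a &
    hp (src a) [:: a; c] [:: c'; a']]].
Proof.
move=> ca cr; have [||b [c' [sb sc' tt [lb pb lc' pc' H]]]] := @square (rev a) c.
- by rewrite src_rev.
- by rewrite lab_rev.
rewrite src_rev tgt_rev in sc' H.
exists (rev b), c'; rewrite src_rev tgt_rev lab_rev pos_rev lb pb lab_rev pos_rev negbK.
split=> //; split=> //.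
have e1 : edge_path (src a) [:: a; c] (tgt c) by [].
have e2 : edge_path (src a) [:: c'; rev b] (tgt c) by rewrite /= src_rev tgt_rev.
have ea : edge_path (src a) [:: a] (tgt a) by [].
have eb : edge_path (tgt c) [:: b; rev b] (tgt c) by rewrite /= src_rev tgt_rev.
have era : edge_path (tgt a) [:: rev a; c'] (tgt b) by rewrite /= src_rev tgt_rev.
have ecb : edge_path (tgt a) [:: c; b] (tgt b) by [].
have erb : edge_path (tgt b) [:: rev b] (tgt c) by rewrite /= src_rev tgt_rev.
have eaa : edge_path (src a) [:: a; rev a] (src a) by rewrite /= src_rev tgt_rev.
have h1 : hp (src a) ([:: a; c] ++ [:: b; rev b]) ([:: a; c] ++ [::]).
  apply: (hp_cat e1 e1); first exact: hp_refl e1.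
  by rewrite -sb; exact: hp_cancel.
have h2 : hp (src a) ([:: a] ++ ([:: rev a; c'] ++ [:: rev b])) ([:: a] ++ ([:: c; b] ++ [:: rev b])).
  apply: (hp_cat ea ea); first exact: hp_refl ea.
  by apply: (hp_cat era ecb) => //; exact: hp_refl erb.
have h3 : hp (src a) ([:: a; rev a] ++ [:: c'; rev b]) ([::] ++ [:: c'; rev b]).
  apply: (@hp_cat _ (src a)) => //; exact: hp_refl e2.
exact: hp_trans (hp_sym h1) (hp_trans (hp_sym h2) h3).
Qed.

(** The letter [a] passes through those of [v] one by one, keeping its label and sign. When it meets
    [b], of opposite sign, [determined] identifies [b] with its inverse. The letters of [v] become
    parallel ones, so crossing numbers do not change. *)
Lemma slide_cancel v a b : edge_path (tgt a) v (src b) -> lab a = lab b ->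
  pos a <> pos b -> (forall l, l \in map lab v -> cross (lab a) l) ->
  exists v', [/\ edge_path (src a) v' (tgt b), hp (src a) (a :: v ++ [:: b]) v' &
    [seq (lab c, pos c) | c <- v'] = [seq (lab c, pos c) | c <- v]].
Proof.
elim: v a => [|c v IH] a /=.
  move=> tab lab_ab pab _; have -> : b = rev a.
    apply: determined; rewrite ?src_rev ?lab_rev ?pos_rev//.
    by move: pab; case: (pos a); case: (pos b).
  exists [::]; rewrite tgt_rev; split=> //; exact: hp_cancel.
move=> [ca vb] lab_ab pab cv.
have [a' [c' [sc' tc' ta' [lc' pc'] [la' pa' H]]]] := slide_one ca (cv (lab c) (mem_head _ _)).
have [||||v' [ev' hv' kv']] := IH a'.
- by rewrite ta'.
- by rewrite la'.
- by rewrite pa'.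
- by move=> d dv; rewrite la'; apply: cv; rewrite inE dv orbT.
exists (c' :: v'); split; rewrite /= ?tc' ?sc' ?lc' ?pc' ?kv'//.
have vb' : edge_path (tgt c) (v ++ [:: b]) (tgt b) by apply: edge_path_cat vb _.
have e1 : edge_path (src a) [:: a; c] (tgt c) by [].
have e2 : edge_path (src a) [:: c'; a'] (tgt c) by [].
have ec : edge_path (src a) [:: c'] (src a') by [].
apply: (@hp_trans _ _ ([:: c'; a'] ++ (v ++ [:: b]))).
  by apply: (hp_cat e1 e2 H); exact: hp_refl vb'.
by apply: (hp_cat ec ec _ hv'); exact: hp_refl ec.
Qed.

Lemma nth_edge_path a0 x p y i : edge_path x p y -> i < size p ->
  tgt (nth a0 p i) = (if i.+1 < size p then src (nth a0 p i.+1) else y) /\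
  (i = 0 -> src (nth a0 p i) = x).
Proof.
elim: p x i => //= a p IH x [|i] [ax]; last first.
  by move=> ep ip; have [-> _] := IH _ i ep ip.
by case: p {IH} => [|b p] /= [ab].
Qed.

Lemma crossings_key k p q : [seq (lab c, pos c) | c <- p] = [seq (lab c, pos c) | c <- q] ->
  crossings k p = crossings k q.
Proof.
move=> pq.
have H r : crossings k r = (\sum_(c <- [seq (lab c, pos c) | c <- r])
    (if c.1 == k then (if c.2 then 1 else -1) else 0))%R by rewrite big_map.
by rewrite !H pq.
Qed.

(** Induction on the length. Read cyclically, the loop becomes a periodic sequence, and by
    [irreducible_cycle] some opposite pair has only letters crossing it in between. Rotated to start
    at this pair, the loop loses two letters and stays balanced. *)
Theorem balanced_loop_null x p : ~ independent_pair -> reachable x ->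
  edge_path x p x -> (forall k, crossings k p = 0%R) -> hp x p [::].
Proof.
move=> noi; have [m] := ubnP (size p); elim: m x p => // m IH x [|a0 p'].
  by move=> _ _ ep _; exact: hp_refl ep.
set p := a0 :: p'; move=> pm rx ep bal.
set n := size p; pose P t := nth a0 p (t %% n).
have n0 : 0 < n by [].
have P_path i : tgt (P i) = src (P i.+1).
  have [-> _] := nth_edge_path a0 ep (ltn_pmod i n0); rewrite /P -/n.
  case: ltnP => H.
    by rewrite -[in RHS](addn1 i) -modnDml addn1 (modn_small H).
  have E1 : (i %% n).+1 = n by apply/eqP; rewrite eqn_leq H ltn_pmod.
  rewrite -[in RHS](addn1 i) -modnDml addn1 E1 modnn.
  by have [_ ->] := nth_edge_path a0 ep n0.
have P_per i : P (i + n) = P i by rewrite /P modnDr.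
have P0 : src (P 0) = x by rewrite /P mod0n; have [_ ->] := nth_edge_path a0 ep n0.
have pE : p = seg P 0 n.
  rewrite /seg /index_iota subn0; apply: (@eq_from_nth _ a0).
    by rewrite size_map size_iota.
  by move=> i ip; rewrite (nth_map 0) ?size_iota// nth_iota// add0n /P modn_small.
have rP : reachable (src (P 0)) by rewrite P0.
apply: contrapT => nnull.
apply: (@irreducible_cycle P P_path n P_per n0 rP noi); last first.
  by move=> k; rewrite -crossings_seg -pE.
move=> i j oij; apply: contrapT => nt; apply: nnull.
have cr t : i < t < j -> cross (lab (P i)) (lab (P t)).
  by move=> tij; apply: contrapT => nc; apply: nt; exists t.
case: oij => ij lij pij bt.
(* The pair ends within one period, as [P (i + n)] repeats the label and the sign of [P i]. *)
have jn : j < i + n.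
  rewrite ltnNge; apply/negP => nj.
  have [Ej|nej] := eqVneq (i + n) j; first by apply: pij; rewrite -Ej P_per.
  by apply: (bt (i + n)); [lia|rewrite P_per].
have [||v' [ev' hv' kv']] := @slide_cancel (seg P i.+1 j) (P i) (P j) _ lij pij.
- by rewrite P_path; exact: edge_path_seg.
- move=> l; rewrite /seg -map_comp => /mapP [t tI ->]; apply: cr.
  by rewrite mem_index_iota in tI.
set w := seg P j.+1 (i + n).
have ew : edge_path (tgt (P j)) w (src (P i)).
  by rewrite P_path -(P_per i); apply: edge_path_seg.
have pushE : seg P i (i + n) = (P i :: seg P i.+1 j ++ [:: P j]) ++ w.
  by rewrite -(seg_cat P (ltnW ij) (ltnW jn)) (seg_cons P ij) (seg_cons P jn) /= -catA.
have balq k : segc P k i (i + n) = 0%R.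
  have := segc_cat P k (leq0n i) (leq_addr n i).
  rewrite (segc_cat P k (leq0n n) (leq_addl i n)) -(crossings_seg P k 0 n) -pE bal add0r.
  rewrite (_ : segc P k n (i + n) = segc P k 0 i).
    by move/eqP; rewrite -subr_eq0 opprD addrA subrr add0r oppr_eq0 => /eqP.
  rewrite /segc -{1}(add0n n) big_addn addnK; apply: eq_bigr => t _; by rewrite P_per.
have ri : reachable (src (P i)) := reach_P P_path rP i.
have ea : edge_path (src (P i)) (P i :: seg P i.+1 j ++ [:: P j]) (tgt (P j)).
  split=> //; apply: (@edge_path_cat _ _ (src (P j))) => //.
  by rewrite P_path; exact: edge_path_seg.
have nullq : hp (src (P i)) (seg P i (i + n)) [::].
  rewrite pushE; apply: (@hp_trans _ _ (v' ++ w)).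
    by apply: (hp_cat ea ev' hv'); exact: hp_refl ew.
  apply: IH => //; last 2 first.
  - exact: edge_path_cat ev' ew.
  - move=> k; rewrite crossings_cat (crossings_key k kv').
    rewrite -[RHS](balq k) -crossings_seg pushE crossings_cat; congr (_ + _)%R.
    have -> : crossings k (P i :: seg P i.+1 j ++ [:: P j]) =
        (weight k (P i) + (crossings k (seg P i.+1 j) + weight k (P j)))%R.
      by rewrite {1}/crossings big_cons -/(crossings k _) crossings_cat /crossings big_seq1.
    by rewrite addrCA weight_opp// addr0.
  - have -> : size (v' ++ w) = n - 2.
      rewrite size_cat -(size_map (fun c => (lab c, pos c)) v') kv' size_map.
      by rewrite !size_map !size_iota; lia.
    by rewrite /n; move: pm; rewrite /p /=; lia.
set s := seg P 0 i.
have es : edge_path x s (src (P i)) by rewrite -P0; exact: edge_path_seg.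
have eq : edge_path (src (P i)) (seg P i (i + n)) (src (P i)).
  by rewrite -{2}(P_per i); apply: (edge_path_seg P_path); exact: leq_addr.
(* The rotated loop is conjugate to [p] by the initial segment [s]. *)
have psE : p ++ s = s ++ seg P i (i + n).
  rewrite (seg_cat P (leq0n i) (leq_addr n i)).
  rewrite -(seg_cat P (leq0n n) (leq_addl i n)) -pE; congr (_ ++ _).
  rewrite /s /seg /index_iota subn0 addnK -{1}(addn0 n) iotaDl -map_comp.
  by apply: eq_map => t /=; rewrite addnC P_per.
have eis := edge_path_inv es.
have ess : edge_path x (s ++ inv_path s) x := edge_path_cat es eis.
have h1 : hp x (p ++ (s ++ inv_path s)) (p ++ [::]).
  by apply: (hp_cat ep ep (hp_refl ep)); exact: hp_cancel_path es.
have h2 : hp x ((s ++ seg P i (i + n)) ++ inv_path s) ((s ++ [::]) ++ inv_path s).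
  apply: (@hp_cat _ (src (P i))); last exact: hp_refl eis.
  - exact: edge_path_cat es eq.
  - by rewrite cats0.
  - by apply: (hp_cat es es (hp_refl es)).
rewrite cats0 catA psE in h1; rewrite cats0 in h2.
exact: hp_trans (hp_sym h1) (hp_trans h2 (hp_cancel_path es)).
Qed.


(** * Loops that cross two disjoint hyperplanes only once *)

Definition dual_word (h k : L) (p : seq E) :=
  [seq (lab a, pos a) | a <- p & (lab a == h) || (lab a == k)].

Lemma dual_word_cat h k p q : dual_word h k (p ++ q) = dual_word h k p ++ dual_word h k q.
Proof. by rewrite /dual_word filter_cat map_cat. Qed.

Lemma dual_word_inv h k p : dual_word h k p = [::] -> dual_word h k (inv_path p) = [::].
Proof.
elim: p => // a p IH; rewrite /inv_path /= rev_cons -cats1 dual_word_cat -/(inv_path p).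
rewrite {1 3}/dual_word /= lab_rev.
by case: ifP => // _ /IH ->.
Qed.

Lemma reachable_edge x p y k : reachable x -> edge_path x p y -> crossings k p <> 0%R ->
  exists a, [/\ reachable (src a), lab a = k & pos a = true].
Proof.
move=> rx ep c0; have : k \in map lab p.
  by apply: contrapT => /negP/crossings0.
elim: p x rx ep {c0} => // a p IH z rz [az ap].
rewrite /= inE => /orP [/eqP ka|kp]; last first.
  by apply: (IH _ _ ap kp); apply: reachable_path rz (conj az (erefl _) : edge_path z [:: a] (tgt a)).
case pa : (pos a); first by exists a; rewrite az.
exists (rev a); rewrite src_rev lab_rev pos_rev pa; split=> //.
by apply: reachable_path rz (conj az (erefl _) : edge_path z [:: a] (tgt a)).
Qed.

(* A 0/1-valued function constant on the components of the complement of two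
   hyperplanes changes by a constant across each of them; two loops with
   independent crossing numbers force both constants to vanish. *)
Theorem independent_pair_connected : independent_pair ->
  exists h k, [/\ h <> k, ~ cross h k &
    forall l, l = h \/ l = k -> exists2 p, edge_path x0 p x0 & dual_word h k p = [:: (l, true)]].
Proof.
move=> [h [k [x [y [p [q [hk nhk rx ry [ep eq det]]]]]]]].
exists h, k; split=> //.
pose conn z z' := exists2 r, edge_path z r z' & dual_word h k r = [::].
have conn_sym z z' : conn z z' -> conn z' z.
  by move=> [r er kr]; exists (inv_path r); [exact: edge_path_inv|exact: dual_word_inv].
have conn_trans z z' z'' : conn z z' -> conn z' z'' -> conn z z''.
  move=> [r er kr] [r' er' kr']; exists (r ++ r'); first exact: edge_path_cat er er'.
  by rewrite dual_word_cat kr kr'.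
(* The indicator of the component of [x0] in the complement of [h] and [k], with integer values so
   that changes along a path can be summed. *)
pose f z : int := if `[< conn x0 z >] then 1%R else 0%R.
have f_conn z z' : conn z z' -> f z = f z'.
  move=> zz; rewrite /f; congr (if _ then _ else _).
  apply/asboolP/asboolP => H; first exact: conn_trans H zz.
  exact: conn_trans H (conn_sym _ _ zz).
have par_conn a b : lab a = lab b -> pos a = pos b -> (lab a = h \/ lab a = k) ->
    conn (src a) (src b).
  move=> lab_ab pab lahk; have [r er cr] := parallel lab_ab pab.
  exists r => //; rewrite /dual_word (_ : [seq a0 <- r | (lab a0 == h) || (lab a0 == k)] = [::])//.
  have ncr l : l = h \/ l = k -> ~ cross (lab a) l.
    move=> [->|->]; case: lahk => ->; try exact: cross_irr; try exact: nhk.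
    by move/cross_sym; exact: nhk.
  have : forall l, l \in map lab r -> (l != h) && (l != k).
    move=> l /cr cl; apply/andP; split; apply/eqP => le; apply: (ncr l _ cl); [by left|by right].
  elim: r {er cr} => //= b' r IH H.
  have /andP [/negbTE -> /negbTE ->] := H _ (mem_head _ _).
  by apply: IH => l lr; apply: H; rewrite inE lr orbT.
have [ah [rah lah pah]] : exists a, [/\ reachable (src a), lab a = h & pos a = true].
  have [c0|] := eqVneq (crossings h p) 0%R; last by move/eqP => c0; exact: reachable_edge rx ep c0.
  apply: (reachable_edge ry eq) => d0; apply: det; by rewrite c0 d0 mul0r mulr0.
have [ak [rak lak pak]] : exists a, [/\ reachable (src a), lab a = k & pos a = true].
  have [c0|] := eqVneq (crossings k p) 0%R; last by move/eqP => c0; exact: reachable_edge rx ep c0.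
  apply: (reachable_edge ry eq) => d0; apply: det; by rewrite c0 d0 mul0r mulr0.
pose d a := (f (tgt a) - f (src a))%R.
have dE a b : lab a = lab b -> pos b -> (lab b = h \/ lab b = k) ->
    d a = ((if pos a then 1 else -1) * d b)%R.
  move=> lab_ab pb lb; case pa : (pos a); rewrite ?mul1r ?mulN1r /d.
    have -> : f (src a) = f (src b) by apply/f_conn/par_conn; rewrite ?pa ?pb ?lab_ab.
    have -> // : f (tgt a) = f (tgt b).
    by rewrite -!src_rev; apply/f_conn/par_conn; rewrite ?pos_rev ?lab_rev ?pa ?pb ?lab_ab.
  have -> : f (src a) = f (tgt b).
    by rewrite -src_rev; apply/f_conn/par_conn; rewrite ?pos_rev ?lab_rev ?pa ?pb ?lab_ab.
  have -> : f (tgt a) = f (src b).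
    by rewrite -src_rev; apply/f_conn/par_conn; rewrite ?pos_rev ?lab_rev ?pa ?pb ?lab_ab.
  by rewrite opprB.
have step a : d a = (weight h a * d ah + weight k a * d ak)%R.
  rewrite /weight; case: eqP => [ha|nh].
    rewrite (_ : (lab a == k) = false); last by apply/eqP; rewrite ha.
    by rewrite mul0r addr0; apply: dE; rewrite ?ha ?lah//; left.
  case: eqP => [ka|nk].
    by rewrite mul0r add0r; apply: dE; rewrite ?ka ?lak//; right.
  rewrite !mul0r addr0 /d; apply/eqP; rewrite subr_eq0; apply/eqP/esym/f_conn.
  by exists [:: a] => //; rewrite /dual_word /= (introF eqP nh) (introF eqP nk).
have change z r z' : edge_path z r z' ->
    (f z' - f z = crossings h r * d ah + crossings k r * d ak)%R.
  elim: r z => [z ->|a r IH z [<- /IH H]]; first by rewrite subrr /crossings !big_nil !mul0r addr0.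
  rewrite /crossings !big_cons -/(crossings h r) -/(crossings k r).
  have -> : (f z' - f (src a) = d a + (f z' - f (tgt a)))%R by rewrite /d; ring.
  by rewrite H step; ring.
have e1 := change _ _ _ ep; have e2 := change _ _ _ eq; rewrite !subrr in e1 e2.
(* Cramer's rule for the homogeneous system [e1], [e2] in the unknowns [d ah] and [d ak]. *)
pose D := (crossings h p * crossings k q - crossings k p * crossings h q)%R.
have D0 : D != 0%R by rewrite subr_eq0; apply/eqP.
have dh0 : d ah = 0%R.
  apply: (mulfI D0); rewrite mulr0.
  transitivity (crossings k q * 0 - crossings k p * 0)%R; last by rewrite !mulr0 subrr.
  by rewrite {1}e1 e2 /D; ring.
have dk0 : d ak = 0%R.
  apply: (mulfI D0); rewrite mulr0.
  transitivity (crossings h p * 0 - crossings h q * 0)%R; last by rewrite !mulr0 subrr.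
  by rewrite {1}e2 e1 /D; ring.
have all_conn z : reachable z -> conn x0 z.
  move=> [r er]; have := change _ _ _ er; rewrite dh0 dk0 !mulr0 addr0 /f.
  have -> : `[< conn x0 x0 >] by apply/asboolP; exists [::].
  by case: asboolP.
(* Both ends of a dual edge can be joined to [x0] off the two hyperplanes, so the resulting loop
   crosses them only in that edge. *)
have loop a : reachable (src a) -> lab a = h \/ lab a = k -> pos a ->
    exists2 p, edge_path x0 p x0 & dual_word h k p = [:: (lab a, true)].
  move=> ra la pa; have [r er kr] := all_conn _ ra.
  have rt : reachable (tgt a).
    by apply: reachable_path ra ((conj erefl erefl) : edge_path (src a) [:: a] (tgt a)).
  have [r' er' kr'] := all_conn _ rt.
  exists (r ++ a :: inv_path r').
    by apply: edge_path_cat er _; split=> //; exact: edge_path_inv.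
  rewrite dual_word_cat kr -(cat1s a (inv_path r')) dual_word_cat (dual_word_inv kr').
  rewrite cats0 /dual_word /=.
  by case: la => le; rewrite le eqxx ?orbT /= le pa.
move=> l [->|->].
  by have := loop ah rah (or_introl lah) pah; rewrite lah.
by have := loop ak rak (or_intror lak) pak; rewrite lak.
Qed.

End LabelledGraph.

Local Open Scope classical_set_scope.
Local Open Scope ring_scope.

(** * Homotopies of paths *)

Section PathHomotopy.
Context {R : realType} {T : topologicalType}.
Implicit Types (f g h : R -> T) (x y z : T).

Let I2 : set (R * R) := `[0, 1] `*` `[0, 1].

Definition is_path x f y :=
  [/\ {within `[0, 1], continuous f}, f 0 = x & f 1 = y].

(** The analogue of [homotopic] for paths with arbitrary end points. Paths are total functions of
    which only the values on [[0, 1]] matter. *)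
Definition path_homotopic f g : Prop :=
  exists H : R * R -> T,
    [/\ {within `[0, 1] `*` `[0, 1], continuous H},
        forall t : R, t \in `[0, 1] -> H (0, t) = f t,
        forall t : R, t \in `[0, 1] -> H (1, t) = g t &
        forall s : R, s \in `[0, 1] -> H (s, 0) = f 0 /\ H (s, 1) = f 1].

Lemma mem01_0 : (0 : R) \in `[0, 1]. Proof. by apply/in01P; split; lra. Qed.
Lemma mem01_1 : (1 : R) \in `[0, 1]. Proof. by apply/in01P; split; lra. Qed.

Lemma path_homotopic_ends f g : path_homotopic f g -> f 0 = g 0 /\ f 1 = g 1.
Proof.
move=> [H [_ _ H1 Hp]]; have [p0 p1] := Hp 1 mem01_1.
by rewrite -p0 -p1 !H1 ?mem01_0 ?mem01_1.
Qed.

Lemma path_homotopic_cts f g : path_homotopic f g -> {within `[0, 1], continuous f}.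
Proof.
move=> [H [cH H0 _ _]].
refine (within_eq (f := H \o (fun t : R => (0, t))) _ _) => [t /H0//|].
apply: (within_comp cH).
  by apply: continuous_subspaceT; apply: cts_pair => x; [exact: cvg_cst|exact: cvg_id].
by move=> t /= tI; split=> //=; exact: mem01_0.
Qed.

(** The straight-line homotopy, pushed forward by [q]. Reparametrizations and homotopies inside one
    cube are both instances. *)
Lemma convex_homotopic (W : normedModType R) (C : set W) (q : W -> T) (a b : R -> W) f g :
  {within C, continuous q} ->
  {within `[0, 1], continuous a} -> {within `[0, 1], continuous b} ->
  (forall s t : R, s \in `[0, 1] -> t \in `[0, 1] -> C ((1 - s) *: a t + s *: b t)) ->
  a 0 = b 0 -> a 1 = b 1 ->
  (forall t : R, t \in `[0, 1] -> f t = q (a t)) ->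
  (forall t : R, t \in `[0, 1] -> g t = q (b t)) ->
  path_homotopic f g.
Proof.
move=> cq ca cb Cab ab0 ab1 fE gE.
exists (q \o (fun x : R * R => (1 - x.1) *: a x.2 + x.1 *: b x.2)); split.
- apply: (within_comp cq); last by move=> [s t] [/= sI tI]; apply: Cab.
  have c2 (e : R -> W) : {within `[0, 1], continuous e} ->
      {within `[0, 1] `*` `[0, 1], continuous (fun x : R * R => e x.2)}.
    move=> ce; apply: (within_comp ce); last by move=> x [].
    by apply: continuous_subspaceT => x; exact: cvg_snd.
  have c1 : {within `[0, 1] `*` `[0, 1], continuous (fun x : R * R => x.1)}.
    by apply: continuous_subspaceT => x; exact: cvg_fst.
  move=> x; apply: cvgD; apply: cvgZ.
  - by apply: cvgB; [exact: cvg_cst|exact: c1].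
  - exact: c2.
  - exact: c1.
  - exact: c2.
- by move=> t tI /=; rewrite subr0 scale1r scale0r addr0 fE.
- by move=> t tI /=; rewrite subrr scale1r scale0r add0r gE.
- move=> s sI /=; rewrite ab0 ab1 -!scalerDl subrK !scale1r.
  by rewrite !fE ?mem01_0 ?mem01_1// ab0 ab1.
Qed.

Lemma reparam_homotopic h (a b : R -> R) f g :
  {within `[0, 1], continuous h} ->
  continuous a -> continuous b ->
  (forall t : R, t \in `[0, 1] -> a t \in `[0, 1]) ->
  (forall t : R, t \in `[0, 1] -> b t \in `[0, 1]) ->
  a 0 = b 0 -> a 1 = b 1 ->
  (forall t : R, t \in `[0, 1] -> f t = h (a t)) ->
  (forall t : R, t \in `[0, 1] -> g t = h (b t)) ->
  path_homotopic f g.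
Proof.
move=> ch ca cb a01 b01 ab0 ab1 fE gE.
apply: (@convex_homotopic R^o `[0, 1]%classic h a b) => //.
- exact: continuous_subspaceT.
- exact: continuous_subspaceT.
- move=> s t /in01P [? ?] tI /=; have /in01P [? ?] := a01 t tI; have /in01P [? ?] := b01 t tI.
  by apply/in01P; rewrite /GRing.scale /=; split; nra.
Qed.

Lemma path_homotopic_refl f : {within `[0, 1], continuous f} -> path_homotopic f f.
Proof. by move=> cf; apply: (@reparam_homotopic f id id) => // x; exact: cvg_id. Qed.

Lemma path_homotopic_sym f g : path_homotopic f g -> path_homotopic g f.
Proof.
move=> fg; have [e0 e1] := path_homotopic_ends fg; move: fg => [H [cH H0 H1 Hp]].
exists (H \o (fun x : R * R => (1 - x.1, x.2))); split.
- apply: (within_comp cH).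
    apply: continuous_subspaceT; apply: cts_pair => x; last exact: cvg_snd.
    by apply: cvgB; [exact: cvg_cst|exact: cvg_fst].
  by move=> [s t] [/= /in01P [? ?] tI]; split => //=; apply/in01P; split; lra.
- by move=> t tI /=; rewrite subr0 H1.
- by move=> t tI /=; rewrite subrr H0.
- by move=> s /in01P [? ?] /=; rewrite -e0 -e1; apply: Hp; apply/in01P; split; lra.
Qed.

Lemma path_homotopic_trans g f h :
  path_homotopic f g -> path_homotopic g h -> path_homotopic f h.
Proof.
move=> fg; have [e0 e1] := path_homotopic_ends fg.
move: fg => [H [cH H0 H1 Hp]] [K [cK K0 K1 Kp]].
exists (fun x : R * R => if x.1 - 2^-1 <= 0 then H (2 * x.1, x.2)
                         else K (2 * x.1 - 1, x.2)); split.
- apply: (@paste R _ _ I2 (fun x : R * R => x.1 - 2^-1)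
     (H \o (fun x : R * R => (2 * x.1, x.2)))
     (K \o (fun x : R * R => (2 * x.1 - 1, x.2)))).
  + by move=> x; apply: cvgB; [exact: cvg_fst|exact: cvg_cst].
  + exact: I2_closed.
  + apply: (within_comp cH).
      apply: continuous_subspaceT; apply: cts_pair => x; last exact: cvg_snd.
      by apply: cvgM; [exact: cvg_cst|exact: cvg_fst].
    move=> [s t] [[/= /in01P [? ?] tI] ?]; split => //=.
    by apply/in01P; split; lra.
  + apply: (within_comp cK).
      apply: continuous_subspaceT; apply: cts_pair => x; last exact: cvg_snd.
      apply: cvgB; last exact: cvg_cst.
      by apply: cvgM; [exact: cvg_cst|exact: cvg_fst].
    move=> [s t] [[/= /in01P [? ?] tI] ?]; split => //=.
    by apply/in01P; split; lra.
  + move=> [s t] [/= /in01P [? ?] tI] s2.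
    have -> : 2 * s = 1 by lra.
    by rewrite subrr H1// K0.
- by move=> t tI /=; rewrite ifT ?mulr0 ?H0//; lra.
- move=> t tI /=; rewrite ifF; last by apply/negbTE; rewrite -ltNge; lra.
  by have -> : 2 * 1 - 1 = 1 :> R; [lra|rewrite K1].
- move=> s /in01P [? ?] /=; case: ifPn => s2.
    by apply: Hp; apply/in01P; split; lra.
  move: s2; rewrite -ltNge => s2; rewrite e0 e1; apply: Kp; apply/in01P; split; lra.
Qed.

Lemma path_homotopic_ext f g : {within `[0, 1], continuous f} ->
  (forall t : R, t \in `[0, 1] -> f t = g t) -> path_homotopic f g.
Proof.
move=> cf fg; apply: (@reparam_homotopic f id id) => //; try (by move=> x; exact: cvg_id).
by move=> t /fg.
Qed.

Lemma is_path_homotopic x f y g : is_path x f y -> path_homotopic f g -> is_path x g y.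
Proof.
move=> [_ f0 f1] fg; have [g0 g1] := path_homotopic_ends fg.
by split; [exact: path_homotopic_cts (path_homotopic_sym fg)|rewrite -g0|rewrite -g1].
Qed.

Lemma concat_fun0 f g : concat_fun f g 0 = f 0.
Proof. by rewrite /concat_fun ifT ?mulr0//; lra. Qed.

Lemma concat_fun1 f g : concat_fun f g 1 = g 1.
Proof.
rewrite /concat_fun ifF; last by apply/negbTE; rewrite -ltNge; lra.
by have -> : 2 * 1 - 1 = 1 :> R; [lra|].
Qed.

Lemma is_path_cat x f y g z : is_path x f y -> is_path y g z ->
  is_path x (concat_fun f g) z.
Proof.
move=> [cf f0 f1] [cg g0 g1]; split; rewrite ?concat_fun0 ?concat_fun1//.
rewrite /concat_fun.
apply: (@paste R R T `[0, 1]%classic (fun x : R => x - 2^-1)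
     (f \o (fun x : R => 2 * x)) (g \o (fun x : R => 2 * x - 1))).
- by move=> t; apply: cvgB; [exact: cvg_id|exact: cvg_cst].
- exact: interval_closed.
- apply: (within_comp cf).
    apply: continuous_subspaceT => t.
    by apply: cvgM; [exact: cvg_cst|exact: cvg_id].
  by move=> t [/= /in01P [? ?] ?]; apply/in01P; split; lra.
- apply: (within_comp cg).
    apply: continuous_subspaceT => t; apply: cvgB; last exact: cvg_cst.
    by apply: cvgM; [exact: cvg_cst|exact: cvg_id].
  by move=> t [/= /in01P [? ?] ?]; apply/in01P; split; lra.
- move=> t _ t2 /=; have -> : 2 * t = 1 by lra.
  by rewrite subrr f1 g0.
Qed.

Lemma path_homotopic_cat f f' g g' : f 1 = g 0 ->
  path_homotopic f f' -> path_homotopic g g' ->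
  path_homotopic (concat_fun f g) (concat_fun f' g').
Proof.
move=> fg [H [cH H0 H1 Hp]] [K [cK K0 K1 Kp]].
exists (fun x : R * R => if x.2 - 2^-1 <= 0 then H (x.1, 2 * x.2)
                         else K (x.1, 2 * x.2 - 1)); split.
- apply: (@paste R _ _ I2 (fun x : R * R => x.2 - 2^-1)
     (H \o (fun x : R * R => (x.1, 2 * x.2)))
     (K \o (fun x : R * R => (x.1, 2 * x.2 - 1)))).
  + by move=> x; apply: cvgB; [exact: cvg_snd|exact: cvg_cst].
  + exact: I2_closed.
  + apply: (within_comp cH).
      apply: continuous_subspaceT; apply: cts_pair => x; first exact: cvg_fst.
      by apply: cvgM; [exact: cvg_cst|exact: cvg_snd].
    move=> [s t] [[/= sI /in01P [? ?]] ?]; split => //=.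
    by apply/in01P; split; lra.
  + apply: (within_comp cK).
      apply: continuous_subspaceT; apply: cts_pair => x; first exact: cvg_fst.
      apply: cvgB; last exact: cvg_cst.
      by apply: cvgM; [exact: cvg_cst|exact: cvg_snd].
    move=> [s t] [[/= sI /in01P [? ?]] ?]; split => //=.
    by apply/in01P; split; lra.
  + move=> [s t] [/= sI /in01P [? ?]] t2.
    have -> : 2 * t = 1 by lra.
    by rewrite subrr (Hp _ sI).2 (Kp _ sI).1.
- move=> t /in01P [? ?] /=; rewrite /concat_fun; case: ifPn => t2.
    by rewrite H0//; apply/in01P; split; lra.
  by move: t2; rewrite -ltNge => t2; rewrite K0//; apply/in01P; split; lra.
- move=> t /in01P [? ?] /=; rewrite /concat_fun; case: ifPn => t2.
    by rewrite H1//; apply/in01P; split; lra.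
  by move: t2; rewrite -ltNge => t2; rewrite K1//; apply/in01P; split; lra.
- move=> s sI; rewrite concat_fun0 concat_fun1 /= ifT ?mulr0; last by lra.
  rewrite ifF; last by apply/negbTE; rewrite -ltNge; lra.
  have -> : 2 * 1 - 1 = 1 :> R by lra.
  by rewrite (Hp _ sI).1 (Kp _ sI).2.
Qed.

Let cts_min (a b : R -> R) :
  continuous a -> continuous b -> continuous (fun t => Num.min (a t) (b t)).
Proof. by move=> ca cb x; apply: continuous_min; [exact: ca|exact: cb]. Qed.

Let cts_max (a b : R -> R) :
  continuous a -> continuous b -> continuous (fun t => Num.max (a t) (b t)).
Proof. by move=> ca cb x; apply: continuous_max; [exact: ca|exact: cb]. Qed.

Lemma cts_affine (a b : R) : continuous (fun t : R => a * t + b).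
Proof.
move=> x; apply: cvgD; last exact: cvg_cst.
by apply: cvgM; [exact: cvg_cst|exact: cvg_id].
Qed.

Definition path_between f (a b : R) (t : R) : T := f ((b - a) * t + a).

Lemma is_path_between f (a b : R) : {within `[0, 1], continuous f} ->
  0 <= a -> a <= b -> b <= 1 -> is_path (f a) (path_between f a b) (f b).
Proof.
move=> cf a0 ab b1; split; rewrite /path_between ?mulr0 ?add0r ?mulr1 ?subrK//.
apply: (within_comp cf); first by apply: continuous_subspaceT; exact: cts_affine.
by move=> t /= /in01P [? ?]; apply/in01P; split; nra.
Qed.

Lemma path_between_cat f (a b c : R) : {within `[0, 1], continuous f} ->
  0 <= a -> a <= b -> b <= c -> c <= 1 ->
  path_homotopic (concat_fun (path_between f a b) (path_between f b c)) (path_between f a c).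
Proof.
move=> cf a0 ab bc c1.
have cmin : continuous (fun t : R => Num.min (2 * (b - a) * t + a) b).
  by apply: cts_min; [exact: cts_affine|move=> ?; exact: cvg_cst].
have cmax : continuous (fun t : R => Num.max (2 * (c - b) * t + (2 * b - c)) b).
  by apply: cts_max; [exact: cts_affine|move=> ?; exact: cvg_cst].
(* The minimum runs from [a] to [b] during the first half and then rests; the maximum rests at [b]
   and runs to [c] during the second half. *)
apply: (@reparam_homotopic f
  (fun t => Num.min (2 * (b - a) * t + a) b + (Num.max (2 * (c - b) * t + (2 * b - c)) b - b))
  (fun t => (c - a) * t + a)) => //.
- move=> x; apply: cvgD; [exact: cmin|apply: cvgB; [exact: cmax|exact: cvg_cst]].
- exact: cts_affine.
- move=> t /in01P [? ?]; apply/in01P.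
  rewrite minEle maxEle; do !case: ifPn; rewrite -?ltNge => *; split; nra.
- by move=> t /in01P [? ?]; apply/in01P; split; nra.
- rewrite minEle maxEle; do !case: ifPn; rewrite -?ltNge => *; nra.
- rewrite minEle maxEle; do !case: ifPn; rewrite -?ltNge => *; nra.
move=> t /in01P [? ?]; rewrite /concat_fun /path_between; case: ifPn; rewrite -?ltNge => t2; congr f.
  have e1 : 2 * (b - a) * t + a <= b by nra.
  have e2 : 2 * (c - b) * t + (2 * b - c) <= b by nra.
  by rewrite (min_idPl e1) (max_idPr e2); ring.
have e1 : b <= 2 * (b - a) * t + a by nra.
have e2 : b <= 2 * (c - b) * t + (2 * b - c) by nra.
by rewrite (min_idPr e1) (max_idPl e2); ring.
Qed.

Lemma path_between01 f : path_between f 0 1 = f.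
Proof. by apply/funext => t; rewrite /path_between subr0 mul1r addr0. Qed.

Lemma path_cat1 x f y : is_path x f y -> path_homotopic (concat_fun f (fun=> y)) f.
Proof.
move=> [cf f0 f1].
apply: (@reparam_homotopic f (fun t => Num.min (2 * t + 0) 1) id) => //.
- by apply: cts_min; [exact: cts_affine|move=> ?; exact: cvg_cst].
- by move=> t; exact: cvg_id.
- move=> t /in01P [? ?]; apply/in01P.
  by rewrite minEle; case: ifPn; rewrite -?ltNge => *; split; lra.
- by rewrite minEle; case: ifPn; rewrite -?ltNge => *; lra.
- by rewrite minEle; case: ifPn; rewrite -?ltNge => *; lra.
move=> t /in01P [? ?]; rewrite /concat_fun; case: ifPn; rewrite -?ltNge => t2.
  have e1 : 2 * t + 0 <= 1 by lra.
  by rewrite (min_idPl e1) addr0.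
have e1 : 1 <= 2 * t + 0 by lra.
by rewrite (min_idPr e1) f1.
Qed.

Lemma path_1cat x f y : is_path x f y -> path_homotopic (concat_fun (fun=> x) f) f.
Proof.
move=> [cf f0 f1].
apply: (@reparam_homotopic f (fun t => Num.max (2 * t + -1) 0) id) => //.
- by apply: cts_max; [exact: cts_affine|move=> ?; exact: cvg_cst].
- by move=> t; exact: cvg_id.
- move=> t /in01P [? ?]; apply/in01P.
  by rewrite maxEle; case: ifPn; rewrite -?ltNge => *; split; lra.
- by rewrite maxEle; case: ifPn; rewrite -?ltNge => *; lra.
- by rewrite maxEle; case: ifPn; rewrite -?ltNge => *; lra.
move=> t /in01P [? ?]; rewrite /concat_fun; case: ifPn; rewrite -?ltNge => t2.
  have e1 : 2 * t + -1 <= 0 by lra.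
  by rewrite (max_idPr e1) f0.
have e1 : 0 <= 2 * t + -1 by lra.
by rewrite (max_idPl e1).
Qed.

Definition reverse_path f (t : R) : T := f (1 - t).

Lemma is_reverse_path x f y : is_path x f y -> is_path y (reverse_path f) x.
Proof.
move=> [cf f0 f1]; split; rewrite /reverse_path ?subr0 ?subrr//.
apply: (within_comp cf).
  by apply: continuous_subspaceT => t; apply: cvgB; [exact: cvg_cst|exact: cvg_id].
by move=> t /= /in01P [? ?]; apply/in01P; split; lra.
Qed.

Lemma path_cat_rev x f y : is_path x f y ->
  path_homotopic (concat_fun f (reverse_path f)) (fun=> x).
Proof.
move=> [cf f0 f1].
apply: (@reparam_homotopic f (fun t => Num.min (2 * t + 0) (- 2 * t + 2)) (fun=> 0)) => //.
- by apply: cts_min; exact: cts_affine.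
- by move=> t; exact: cvg_cst.
- move=> t /in01P [? ?]; apply/in01P.
  by rewrite minEle; case: ifPn; rewrite -?ltNge => *; split; lra.
- by move=> t _; exact: mem01_0.
- by rewrite minEle; case: ifPn; rewrite -?ltNge => *; lra.
- by rewrite minEle; case: ifPn; rewrite -?ltNge => *; lra.
move=> t /in01P [? ?]; rewrite /concat_fun /reverse_path; case: ifPn; rewrite -?ltNge => t2;
  congr f; rewrite minEle; case: ifPn; rewrite -?ltNge => *; lra.
Qed.

Lemma reverse_pathK f : reverse_path (reverse_path f) = f.
Proof. by apply/funext => t; rewrite /reverse_path; congr f; lra. Qed.

Lemma path_rev_cat x f y : is_path x f y ->
  path_homotopic (concat_fun (reverse_path f) f) (fun=> y).
Proof. by move=> /is_reverse_path/path_cat_rev; rewrite reverse_pathK. Qed.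

Lemma path_catA x f y g z h w : is_path x f y -> is_path y g z -> is_path z h w ->
  path_homotopic (concat_fun f (concat_fun g h)) (concat_fun (concat_fun f g) h).
Proof.
move=> pf pg ph; have [cfgh _ _] := is_path_cat pf (is_path_cat pg ph).
apply: path_homotopic_sym.
(* The piecewise linear map that carries one bracketing to the other: slopes 2, 1 and 1/2, with
   breaks at 1/4 and 1/2. *)
apply: (@reparam_homotopic (concat_fun f (concat_fun g h))
  (fun t => Num.min (Num.min (2 * t + 0) (1 * t + 4^-1)) (2^-1 * t + 2^-1)) id) => //.
- by do 2?[apply: cts_min]; exact: cts_affine.
- by move=> t; exact: cvg_id.
- move=> t /in01P [? ?]; apply/in01P.
  by rewrite !le_min !ge_min; split; [apply/andP; split; [apply/andP; split|]|
    apply/orP; right]; lra.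
- by rewrite !minEle; do !case: ifPn; rewrite -?ltNge => *; lra.
- by rewrite !minEle; do !case: ifPn; rewrite -?ltNge => *; lra.
move=> t /in01P [? ?] /=; rewrite /concat_fun.
case: (leP (t - 2^-1) 0) => t2; last first.
  have -> : Num.min (Num.min (2 * t + 0) (1 * t + 4^-1)) (2^-1 * t + 2^-1)
            = 2^-1 * t + 2^-1.
    by rewrite !minEle; do !case: ifPn; rewrite -?ltNge => *; lra.
  rewrite !ifF; [|apply/negbTE; rewrite -ltNge; lra..].
  by congr (h _); lra.
case: (leP (2 * t - 2^-1) 0) => t4.
  have -> : Num.min (Num.min (2 * t + 0) (1 * t + 4^-1)) (2^-1 * t + 2^-1)
            = 2 * t.
    by rewrite !minEle; do !case: ifPn; rewrite -?ltNge => *; lra.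
  by rewrite ifT//; lra.
have -> : Num.min (Num.min (2 * t + 0) (1 * t + 4^-1)) (2^-1 * t + 2^-1)
          = t + 4^-1.
  by rewrite !minEle; do !case: ifPn; rewrite -?ltNge => *; lra.
rewrite ifF; last by apply/negbTE; rewrite -ltNge; lra.
by rewrite ifT; [congr (g _); lra|lra].
Qed.

End PathHomotopy.

(** * Transport along paths of a local cocycle *)

(** Half of a radius that works at a point works at all points within that half; the near-covering
    form of compactness makes this uniform. *)
Lemma lebesgue_number (R : realType) (M : pseudoMetricType R) (T : topologicalType)
    (I : Type) (U : I -> set T) (K : set M) (f : M -> T) :
  compact K -> {within K, continuous f} -> (forall i, open (U i)) ->
  (forall x, K x -> exists i, U i (f x)) ->
  exists2 d : R, 0 < d &
    forall x, K x -> exists i, forall y, K y -> ball x d y -> U i (f y).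
Proof.
move=> /compact_near_coveringP cK /subspace_continuousP cf oU cov.
pose P (d : R) (x : M) := K x -> exists i, forall y, K y -> ball x d y -> U i (f y).
have PK : \forall d \near 0^'+, K `<=` P d.
  apply: cK.
  move=> x Kx; have [i Ui] := cov x Kx.
  have : nbhs (f x) (U i) by apply: open_nbhs_nbhs; split.
  move=> /(cf x Kx); rewrite /nbhs /= /within /= => /nbhs_ballP [e e0 He].
  rewrite /prop_near1 /=.
  exists (ball x (e / 2), [set d : R | 0 < d < e / 2]) => /=.
    have e20 : 0 < e / 2 by rewrite divr_gt0.
    split; first exact: nbhsx_ballx.
    have : \forall d \near 0^'+, 0 < d < e / 2.
      near=> d; apply/andP; split; near: d; [exact: nbhs_right_gt|exact: nbhs_right_lt].
    by [].
  move=> [y d] /= [xy /andP [d0 de]] Ky; exists i => z Kz yz; apply: He => //.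
  rewrite (splitr e); apply: ball_triangle xy _; exact: le_ball (ltW de) _ yz.
have : \forall d \near 0^'+, 0 < d /\ (K `<=` P d).
  near=> d; split; near: d; [exact: nbhs_right_gt|exact: PK].
move=> /(@filter_ex _ _ _)[d [d0 Kd]]; exists d => // x Kx.
exact: Kd.
Unshelve. all: by end_near.
Qed.

Section Transport.
Context {R : realType} {T : topologicalType} {I : Type} (U : I -> set T).
Context {F : groupType} (c : T -> T -> F).
Hypothesis U_open : forall i, open (U i).
Hypothesis U_cover : forall x, exists i, U i x.
Hypothesis cocycle : forall i x y z, U i x -> U i y -> U i z ->
  (c x y * c y z)%g = c x z.
Implicit Types f g : R -> T.

Let node (N j : nat) : R := j%:R / N%:R.

Fixpoint transport_upto f N k : F :=
  if k is k'.+1 then (transport_upto f N k' * c (f (node N k')) (f (node N k)))%g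
  else 1%g.

Definition good_subdivision f N := (0 < N)%N /\
  forall j, (j < N)%N -> exists i, forall t, node N j <= t <= node N j.+1 -> U i (f t).

(** A non-commutative line integral: the product of the local cocycle along a subdivision each piece
    of which lies in one member of the cover. [transportE] shows that the chosen subdivision does
    not matter. *)
Definition transport f : F :=
  let N := xget 0%N [set N | good_subdivision f N] in transport_upto f N N.

Lemma cocycle_refl x : c x x = 1%g.
Proof.
have [i Ui] := U_cover x; apply: (mulgI (c x x)).
by rewrite (cocycle Ui)// mulg1.
Qed.

Lemma node_le N j k : (j <= k)%N -> node N j <= node N k.
Proof. by move=> jk; rewrite ler_wpM2r ?invr_ge0 ?ler0n ?ler_nat. Qed.

Lemma node0 N : node N 0 = 0. Proof. by rewrite /node mul0r. Qed.

Lemma nodeN N : (0 < N)%N -> node N N = 1.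
Proof. by move=> N0; rewrite /node divff// pnatr_eq0 -lt0n. Qed.

Lemma node01 N j : (j <= N)%N -> (0 < N)%N -> 0 <= node N j <= 1.
Proof. by move=> jN N0; rewrite -(node0 N) -(nodeN N0) !node_le. Qed.

Lemma node_mul N m j : (0 < m)%N -> node (N * m) (j * m) = node N j.
Proof.
move=> m0; rewrite /node !natrM invfM mulrACA divff ?mulr1//.
by rewrite pnatr_eq0 -lt0n.
Qed.

Lemma node_block N j t : (0 < N)%N -> node N j <= t <= node N j.+1 ->
  `|node N j - t| <= N%:R^-1.
Proof.
move=> N0 /andP [jt tj]; rewrite ler_distlC; apply/andP; split.
  by rewrite (le_trans _ jt)// gerBl invr_ge0 ler0n.
by rewrite (le_trans tj)// /node -natr1 mulrDl mul1r.
Qed.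

Lemma exists_inv_lt (d : R) : 0 < d -> exists2 N, (0 < N)%N & N%:R^-1 < d.
Proof.
move=> d0; have /(archi_boundP) H : 0 <= d^-1 by rewrite invr_ge0 ltW.
have N0 : 0 < (Num.bound d^-1)%:R :> R by apply: le_lt_trans H; rewrite invr_ge0 ltW.
exists (Num.bound d^-1); first by rewrite -(ltr0n R).
by rewrite -[ltRHS]invrK ltf_pV2 ?posrE// invr_gt0.
Qed.

Lemma good_subdivision_exists f : {within `[0, 1], continuous f} ->
  exists N, good_subdivision f N.
Proof.
move=> cf; have [|d d0 Hd] := lebesgue_number (@segment_compact R 0 1) cf U_open.
  by move=> x _; exact: U_cover.
have [N N0 Nd] := exists_inv_lt d0; exists N; split=> // j jN.
have j01 : node N j \in `[0, 1] by rewrite in_itv /=; apply: node01 => //; exact: ltnW.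
have [i Hi] := Hd _ j01; exists i => t tb; apply: Hi.
  have /andP [a0 _] := node01 (ltnW jN) N0; have /andP [_ b1] := node01 jN N0.
  by case/andP: tb => jt tj /=; rewrite in_itv /= (le_trans a0 jt) (le_trans tj b1).
by rewrite -ball_normE /=; exact: le_lt_trans (node_block N0 tb) Nd.
Qed.

(** Inside a block, which lies in one [U i], the finer product telescopes by the cocycle identity.
    Any two subdivisions have a common refinement of this kind. *)
Lemma good_subdivision_mul f N m : good_subdivision f N -> (0 < m)%N ->
  good_subdivision f (N * m) /\
  transport_upto f (N * m) (N * m) = transport_upto f N N.
Proof.
move=> [N0 gf] m0.
have sub j k t : (k < m)%N -> node (N * m) (j * m + k) <= t <= node (N * m) (j * m + k).+1 ->
    node N j <= t <= node N j.+1.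
  move=> km /andP [a b]; rewrite -!(node_mul N _ m0).
  rewrite (le_trans _ a) ?(le_trans b)//; apply: node_le; first by rewrite mulSn; lia.
  by rewrite leq_addr.
split; first split.
- by rewrite muln_gt0 N0.
- move=> j jN; have [|i Hi] := gf (j %/ m)%N; first by rewrite ltn_divLR.
  exists i => t tb; apply: Hi; apply: (sub _ (j %% m)%N); first by rewrite ltn_mod.
  by rewrite -divn_eq.
have H j : (j <= N)%N -> transport_upto f (N * m) (j * m) = transport_upto f N j.
  elim: j => [//|j IH] jN; have [i Hi] := gf _ jN.
  have inU k : (k <= m)%N -> U i (f (node (N * m) (j * m + k))).
    move=> km; apply: Hi; rewrite -!(node_mul N _ m0).
    by rewrite !node_le//; [rewrite mulSn; lia|rewrite leq_addr].
  have blk k : (k <= m)%N -> transport_upto f (N * m) (j * m + k) =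
      (transport_upto f N j * c (f (node N j)) (f (node (N * m) (j * m + k))))%g.
    elim: k => [|k IHk] km; first by rewrite addn0 IH ?(ltnW jN)// node_mul// cocycle_refl mulg1.
    rewrite addnS /= IHk ?(ltnW km)// -mulgA; congr (_ * _)%g.
    apply: cocycle; rewrite -?addnS; [|exact: (inU _ (ltnW km))|exact: inU].
    by have := inU 0%N (leq0n _); rewrite addn0 node_mul.
  have -> : (j.+1 * m = j * m + m)%N by rewrite mulSn addnC.
  by rewrite blk//= -mulSnr node_mul.
by rewrite H.
Qed.

Lemma transportE f N : good_subdivision f N -> transport f = transport_upto f N N.
Proof.
move=> gN; rewrite /transport; set M := xget _ _.
have gM : good_subdivision f M.
  exact: (@xgetPex _ 0%N [set N | good_subdivision f N] (ex_intro _ N gN)).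
have [[M0 _] [N0 _]] := (gM, gN).
rewrite -(good_subdivision_mul gN M0).2 mulnC.
by rewrite (good_subdivision_mul gM N0).2.
Qed.

(** The square is cut into cells each mapped into one member of the cover. Products along
    neighbouring rows differ by the factors on the two vertical sides, which are trivial because the
    end points stay fixed. *)
Lemma transport_homotopic f g : path_homotopic f g -> transport f = transport g.
Proof.
move=> fg; have [e0 e1] := path_homotopic_ends fg; move: fg => [H [cH H0 H1 Hp]].
have cI : compact (`[0, 1] `*` `[0, 1] : set (R * R)).
  by apply: compact_setX; exact: segment_compact.
have [|d d0 Hd] := lebesgue_number cI cH U_open.
  by move=> x _; exact: U_cover.
have [N N0 Nd] := exists_inv_lt d0.
have mem t j : (j < N)%N -> node N j <= t <= node N j.+1 -> t \in `[0, 1].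
  move=> jN /andP [jt tj]; rewrite in_itv /=.
  have /andP [a0 _] := node01 (ltnW jN) N0; have /andP [_ b1] := node01 jN N0.
  by rewrite (le_trans a0 jt) (le_trans tj b1).
have blk j : (j < N)%N -> node N j <= node N j <= node N j.+1.
  by move=> _; rewrite lexx node_le.
have blk' j : (j < N)%N -> node N j <= node N j.+1 <= node N j.+1.
  by move=> _; rewrite lexx node_le.
have grid i j : (i < N)%N -> (j < N)%N -> exists u, forall s t,
    node N i <= s <= node N i.+1 -> node N j <= t <= node N j.+1 -> U u (H (s, t)).
  move=> iN jN; have [|u Hu] := Hd (node N i, node N j).
    by split=> /=; [exact: mem (blk _ iN)|exact: mem (blk _ jN)].
  exists u => s t sb tb; apply: Hu; first by split; [exact: mem sb|exact: mem tb].
  split; rewrite -ball_normE /=; first exact: le_lt_trans (node_block N0 sb) Nd.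
  exact: le_lt_trans (node_block N0 tb) Nd.
have mem0 i : (i <= N)%N -> node N i \in `[0, 1] by move=> iN; rewrite in_itv /= node01.
pose row i t := H (node N i, t).
have rowE i k : (i < N)%N -> (k <= N)%N ->
    (transport_upto (row i) N k * c (row i (node N k)) (row i.+1 (node N k)))%g =
    (c (row i 0) (row i.+1 0) * transport_upto (row i.+1) N k)%g.
  move=> iN; elim: k => [_|k IH kN] /=; first by rewrite node0 mulg1 mul1g.
  have [u Hu] := grid _ _ iN kN.
  rewrite mulgA -IH ?(ltnW kN)// -!mulgA; congr (_ * _)%g.
  have bi := blk _ iN; have bi' := blk' _ iN; have bk := blk _ kN; have bk' := blk' _ kN.
  by rewrite !(cocycle (i := u)); rewrite /row; do ?apply: Hu.
have row0 i : (i <= N)%N -> row i 0 = f 0 by move=> iN; have [] := Hp _ (mem0 _ iN).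
have row1 i : (i <= N)%N -> row i 1 = f 1 by move=> iN; have [] := Hp _ (mem0 _ iN).
have all i : (i <= N)%N -> transport_upto (row i) N N = transport_upto (row 0) N N.
  elim: i => [//|i IH iN]; have := rowE _ _ iN (leqnn N).
  by rewrite nodeN// !row0 ?row1 ?(ltnW iN)// !cocycle_refl mulg1 mul1g => <-; apply: IH; exact: ltnW.
have gd i h : (i < N)%N -> forall s, node N i <= s <= node N i.+1 ->
    (forall t, t \in `[0, 1] -> h t = H (s, t)) -> good_subdivision h N.
  move=> iN s sb hE; split=> // j jN; have [u Hu] := grid _ _ iN jN.
  by exists u => t tb; rewrite hE ?(mem _ _ jN)//; apply: Hu.
have ext h h' k : (forall t, t \in `[0, 1] -> h t = h' t) -> (k <= N)%N ->
    transport_upto h N k = transport_upto h' N k.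
  move=> hh; elim: k => //= k IH kN; rewrite IH ?(ltnW kN)// !hh// mem0//; exact: ltnW.
have N1 : (N.-1 < N)%N by rewrite prednK.
rewrite (@transportE f N); last first.
  by apply: (gd 0%N _ N0 0) => [|t /H0 //]; rewrite -(node0 N) lexx node_le.
rewrite (@transportE g N); last first.
  apply: (gd _ _ N1 1) => [|t /H1 //]; rewrite prednK// nodeN// lexx andbT.
  by case/andP: (node01 (ltnW N1) N0).
transitivity (transport_upto (row 0) N N).
  by apply: ext => // t tI; rewrite /row node0 H0.
rewrite -(all N)//; apply: ext => // t tI; by rewrite /row nodeN// H1.
Qed.

Lemma transport_cat x f y g z : is_path x f y -> is_path y g z ->
  transport (concat_fun f g) = (transport f * transport g)%g.
Proof.
move=> [cf f0 f1] [cg g0 g1].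
have [N1 G1] := good_subdivision_exists cf; have [N2 G2] := good_subdivision_exists cg.
have [[N10 _] [N20 _]] := (G1, G2).
have [Gf _] := good_subdivision_mul G1 N20; have [Gg _] := good_subdivision_mul G2 N10.
rewrite (mulnC N2) in Gg; set N := (N1 * N2)%N in Gf Gg *.
have N0 : (0 < N)%N by case: Gf.
have NR : (N%:R : R) != 0 by rewrite pnatr_eq0 -lt0n.
have nf j : node (N * 2) j * 2 = node N j.
  by rewrite /node natrM; field.
have ng j : node (N * 2) (N + j) * 2 - 1 = node N j.
  by rewrite nf /node natrD mulrDl divff//; ring.
have nE j : (j <= N)%N -> concat_fun f g (node (N * 2) j) = f (node N j).
  move=> jN; rewrite /concat_fun -nf mulrC ifT//.
  have /andP [_] := node01 jN N0; rewrite -nf; lra.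
(* At the junction [concat_fun] is still in its first branch, so the case [j = 0] rests on
   [f 1 = g 0]. *)
have nE' j : concat_fun f g (node (N * 2) (N + j)) = g (node N j).
  rewrite /concat_fun; case: ifPn => H; last by rewrite mulrC ng.
  have H0 : node N j = 0.
    apply/eqP; rewrite eq_le; apply/andP; split; first by rewrite -ng; lra.
    by rewrite -(node0 N) node_le.
  have -> : 2 * node (N * 2) (N + j) = 1 by rewrite mulrC -(subrK 1 (_ * 2)) ng H0 add0r.
  by rewrite f1 H0 g0.
have G : good_subdivision (concat_fun f g) (N * 2).
  split; first by rewrite muln_gt0 N0.
  move=> j jN; case: (ltnP j N) => jN'.
    have [i Hi] := Gf.2 _ jN'; exists i => t /andP [ta tb].
    have tb' : t * 2 <= node N j.+1 by rewrite -nf ler_pM2r.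
    have ta' : node N j <= t * 2 by rewrite -nf ler_pM2r.
    have /andP [_ ?] := node01 jN' N0.
    rewrite /concat_fun ifT; last by lra.
    by apply: Hi; rewrite mulrC ta' tb'.
  have jj : j = (N + (j - N))%N by rewrite subnKC.
  have jN2 : (j - N < N)%N by lia.
  have [i Hi] := Gg.2 _ jN2; exists i => t; rewrite jj -addnS => /andP [ta tb].
  have tb' : t * 2 - 1 <= node N (j - N).+1 by rewrite -ng lerD2r ler_pM2r.
  have ta' : node N (j - N) <= t * 2 - 1 by rewrite -ng lerD2r ler_pM2r.
  have := Hi (t * 2 - 1); rewrite ta' tb' /concat_fun => /(_ isT).
  case: ifPn => [t2|_]; last by rewrite mulrC.
  have p0 : 0 <= node N (j - N) by rewrite -(node0 N) node_le.
  have tE : t * 2 = 1 by lra.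
  by rewrite tE (mulrC 2) tE subrr f1 g0.
rewrite (transportE Gf) (transportE Gg) (transportE G).
have Hf k : (k <= N)%N -> transport_upto (concat_fun f g) (N * 2) k = transport_upto f N k.
  by elim: k => //= k IH kN; rewrite IH ?(ltnW kN)// !nE// ltnW.
have Hg k : transport_upto (concat_fun f g) (N * 2) (N + k) =
    (transport_upto f N N * transport_upto g N k)%g.
  elim: k => [|k IH]; first by rewrite addn0 Hf// mulg1.
  by rewrite addnS /= -addnS IH !nE' mulgA.
by rewrite -Hg muln2 addnn.
Qed.

(** A constant path is homotopic to its own square, so its transport is idempotent. *)
Lemma transport_cst x : transport (fun=> x) = 1%g.
Proof.
have px : is_path x (fun _ : R => x) x.
  by split=> //; apply: continuous_subspaceT => ?; exact: cvg_cst.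
apply: (mulgI (transport (fun=> x))); rewrite mulg1 -(transport_cat px px).
exact: transport_homotopic (path_cat1 px).
Qed.

Lemma transport_rev x f y : is_path x f y -> transport (reverse_path f) = (transport f)^-1%g.
Proof.
move=> pf; apply: (mulgI (transport f)); rewrite mulgV.
rewrite -(transport_cat pf (is_reverse_path pf)) -(transport_cst x).
exact: transport_homotopic (path_cat_rev pf).
Qed.

End Transport.

(** * Faces of cubes *)

Section FaceMaps.
Context {R : realType}.
Local Notation sgb := (@sgb R).

Lemma sgb_eq a b : sgb (a == b) = sgb a * sgb b.
Proof. by case: a; case: b; rewrite /sgb /= ?mulr1 ?mul1r ?mulrNN ?mulr1. Qed.

Lemma sgb_sq b : sgb b * sgb b = 1.
Proof. by rewrite -sgb_eq eqxx. Qed.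

Lemma sgb_inj : injective sgb.
Proof. by case=> [] [] //; rewrite /sgb => H; exfalso; lra. Qed.

Lemma normr_sgb b : `|sgb b| = 1.
Proof. by case: b; rewrite /sgb ?normrN normr1. Qed.

(* [F j = (Some i, b)]: the j-th coordinate is plus or minus the i-th
   coordinate of the face; [F j = (None, b)]: it is constant. *)
Definition face_embed m n (F : 'I_n -> option 'I_m * bool) (w : 'rV[R]_m) : 'rV[R]_n :=
  \row_j (sgb (F j).2 * oapp (w 0) 1 (F j).1).

Definition face_type m n (F : 'I_n -> option 'I_m * bool) :=
  (forall i, exists j, (F j).1 = Some i) /\
  (forall i j j', (F j).1 = Some i -> (F j').1 = Some i -> j = j').

Definition face_comp l m n (F : 'I_n -> option 'I_m * bool)
    (G : 'I_m -> option 'I_l * bool) (j : 'I_n) : option 'I_l * bool :=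
  if (F j).1 is Some i then ((G i).1, (F j).2 == (G i).2) else (None, (F j).2).

Lemma face_comp_type l m n (F : 'I_n -> option 'I_m * bool) (G : 'I_m -> option 'I_l * bool) :
  face_type F -> face_type G -> face_type (face_comp F G).
Proof.
move=> [F1 F2] [G1 G2]; split.
  move=> i; have [k Gk] := G1 i; have [j Fj] := F1 k.
  by exists j; rewrite /face_comp Fj.
move=> i j j'; rewrite /face_comp.
case Fj : (F j).1 => [k|//] /= Gk; case Fj' : (F j').1 => [k'|//] /= Gk'.
by have kk' := G2 _ _ _ Gk Gk'; subst k'; exact: F2 Fj Fj'.
Qed.

Lemma face_embed_comp l m n (F : 'I_n -> option 'I_m * bool) (G : 'I_m -> option 'I_l * bool) w :
  face_embed (face_comp F G) w = face_embed F (face_embed G w).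
Proof.
apply/rowP => j; rewrite !mxE /face_comp.
by case: (F j).1 => [k|] //=; rewrite !mxE sgb_eq mulrA.
Qed.

Lemma cubeP n (x : 'rV[R]_n) : cube x <-> forall i, `|x 0 i| <= 1.
Proof. by split=> H i; have := H i; rewrite ler_norml. Qed.

Lemma open_cubeP n (x : 'rV[R]_n) : open_cube x <-> forall i, `|x 0 i| < 1.
Proof. by split=> H i; have := H i; rewrite ltr_norml. Qed.

Lemma open_cube_cube n (x : 'rV[R]_n) : open_cube x -> cube x.
Proof. by move=> /open_cubeP H; apply/cubeP => i; exact: ltW. Qed.

Lemma face_embed_cube m n (F : 'I_n -> option 'I_m * bool) w :
  cube w -> cube (face_embed F w).
Proof.
move=> /cubeP cw; apply/cubeP => j; rewrite mxE normrM normr_sgb mul1r.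
by case: (F j).1 => [i|] /=; rewrite ?normr1.
Qed.

Lemma sum_eq0_all (I : finType) (P : pred I) (a : I -> R) :
  (forall i, P i -> 0 <= a i) -> \sum_(i | P i) a i <= 0 -> forall i, P i -> a i = 0.
Proof.
move=> a0 s0 i Pi; apply/eqP; rewrite eq_le a0// andbT (le_trans _ s0)//.
by rewrite (bigD1 i)//= lerDl sumr_ge0// => k /andP [? _]; exact: a0.
Qed.

(** The centre goes to the centre [c], and preservation of inner products makes [phi] affine with
    orthonormal [u k]. As the image stays in the cube, the absolute values of the [u k 0 j] for a
    fixed [j] sum to at most one. There are as many coordinates off [i] as vectors, so counting
    squares forces equality everywhere: every entry is 0, 1 or -1, and [phi] is a signed permutation
    of coordinates. *)
Lemma facet_isometry_face n (i : 'I_n.+1) (b : bool) (phi : 'rV[R]_n -> 'rV[R]_n.+1) :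
  isometry_onto (@cube R n) (facet i b) phi ->
  exists F : 'I_n.+1 -> option 'I_n * bool,
    face_type F /\ forall w, cube w -> phi w = face_embed F w.
Proof.
move=> [phi_onto iso].
have cube_phi x : cube x -> cube (phi x) /\ phi x 0 i = sgb b.
  by move=> cx; have : (phi @` @cube R n) (phi x) by [exists x]; rewrite phi_onto.
have cube0 : cube (0 : 'rV[R]_n) by apply/cubeP => k; rewrite mxE normr0.
pose c := phi 0.
have c0 j : j != i -> c 0 j = 0.
  (* A vertex of the facet farthest from [c]. Its preimage has squared distance at most [n] from the
     origin, while [y] has squared distance at least [n] from [c], with equality only if [c]
     vanishes off [i]. *)
  pose y : 'rV[R]_n.+1 := \row_k if k == i then sgb b else if 0 <= c 0 k then -1 else 1.
  have [x cx xy] : (phi @` @cube R n) y.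
    rewrite phi_onto; split; last by rewrite mxE eqxx.
    apply/cubeP => k; rewrite mxE; case: ifP => _; first by rewrite normr_sgb.
    by case: ifP; rewrite ?normrN normr1.
  have := iso 0 x cube0 cx; rewrite xy -/c /sqdist => E1.
  have le : \sum_(k | k != i) (2 * `|c 0 k| + c 0 k ^+ 2) <= 0.
    have : \sum_k ((0 : 'rV[R]_n) 0 k - x 0 k) ^+ 2 <= n%:R.
      rewrite -[n in n%:R]card_ord -sum1_card natr_sum; apply: ler_sum => k _.
      rewrite mxE sub0r sqrrN; have /cubeP/(_ k) := cx; rewrite -real_normK ?num_real//.
      by move=> H; rewrite -(expr1n _ 2) lerXn2r// nnegrE.
    rewrite -E1 (bigD1 i)//= /y mxE eqxx (cube_phi _ cube0).2 subrr expr0n add0r.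
    have -> : \sum_(k | k != i) (c 0 k -
        (\row_k0 (if k0 == i then sgb b else if 0 <= c 0 k0 then -1 else 1)) 0 k) ^+ 2
        = \sum_(k | k != i) (2 * `|c 0 k| + c 0 k ^+ 2) + n%:R.
      have -> : n%:R = \sum_(k < n.+1 | k != i) (1 : R).
        by rewrite sumr_const cardC1 card_ord.
      rewrite -big_split /=; apply: eq_bigr => k ki; rewrite mxE (negbTE ki).
      by case: ifPn => ck; [rewrite ger0_norm//|rewrite ltr0_norm ?ltNge//]; ring.
    by rewrite gerDr.
  move=> ji; have := sum_eq0_all _ le ji.
  move=> /(_ _) H; have {}H := H (fun k _ => addr_ge0 (mulr_ge0 (ler0n _ 2) (normr_ge0 _)) (sqr_ge0 _)).
  have := normr_ge0 (c 0 j); have := sqr_ge0 (c 0 j) => h1 h2.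
  by apply/eqP; rewrite -normr_eq0; apply/eqP; lra.
have ci : c 0 i = sgb b := (cube_phi _ cube0).2.
pose ip p (x y : 'rV[R]_p) : R := \sum_k x 0 k * y 0 k.
have sqdistE p (x y z : 'rV[R]_p) :
    2 * ip _ (x - z) (y - z) = sqdist x z + sqdist y z - sqdist x y.
  rewrite /ip /sqdist mulr_sumr -big_split -sumrB /=; apply: eq_bigr => k _.
  by rewrite !mxE; ring.
have ipE x y : cube x -> cube y -> ip _ (phi x - c) (phi y - c) = ip _ x y.
  move=> cx cy; have two : (2 : R) != 0 by rewrite pnatr_eq0.
  apply: (mulfI two); rewrite sqdistE !iso// -(sqdistE _ x y 0).
  by rewrite !subr0.
pose u k := phi (delta_mx 0 k) - c.
have cube_delta k : cube (delta_mx 0 k : 'rV[R]_n).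
  by apply/cubeP => l; rewrite mxE; case: (_ && _); rewrite ?normr1 ?normr0.
have ip_delta (x : 'rV[R]_n) k : ip _ x (delta_mx 0 k) = x 0 k.
  rewrite /ip (bigD1 k)//= big1 ?mxE ?eqxx ?mulr1 ?addr0// => l lk.
  by rewrite mxE (negbTE lk) mulr0.
have linear x : cube x -> forall j, phi x 0 j = c 0 j + \sum_k x 0 k * u k 0 j.
  move=> cx; pose v := \sum_k x 0 k *: u k.
  have ipDl p (y z w : 'rV[R]_p) : ip _ (y - z) w = ip _ y w - ip _ z w.
    by rewrite /ip -sumrB; apply: eq_bigr => k _; rewrite !mxE mulrBl.
  have ipC p (y z : 'rV[R]_p) : ip _ y z = ip _ z y.
    by rewrite /ip; apply: eq_bigr => k _; rewrite mulrC.
  have ipv w : ip _ v w = \sum_k x 0 k * ip _ (u k) w.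
    rewrite /ip /v; under eq_bigr do rewrite summxE mulr_suml.
    rewrite exchange_big /=; apply: eq_bigr => k _; rewrite mulr_sumr.
    by apply: eq_bigr => l _; rewrite mxE mulrA.
  have ipuv k : ip _ (u k) v = x 0 k.
    rewrite ipC ipv (bigD1 k)//= big1 => [|l lk].
      by rewrite ipE// ip_delta mxE !eqxx mulr1 addr0.
    by rewrite ipE// ip_delta mxE eq_sym (negbTE lk) andbF mulr0.
  have ipux k : ip _ (u k) (phi x - c) = x 0 k by rewrite ipE// ipC ip_delta.
  have z0 : ip _ ((phi x - c) - v) ((phi x - c) - v) = 0.
    have ipBB p (y z : 'rV[R]_p) :
        ip _ (y - z) (y - z) = ip _ y y - ip _ z y - (ip _ z y - ip _ z z).
      by rewrite ipDl ![ip _ _ (y - z)]ipC !ipDl [ip _ y z]ipC.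
    have S1 : ip _ v (phi x - c) = ip _ x x.
      by rewrite ipv; apply: eq_bigr => k _; rewrite ipux.
    have S2 : ip _ v v = ip _ x x.
      by rewrite ipv; apply: eq_bigr => k _; rewrite ipuv.
    by rewrite ipBB S1 S2 ipE// subrr.
  move=> j; have := sum_eq0_all (P := predT) (a := fun k => (phi x - c - v) 0 k * (phi x - c - v) 0 k).
  move=> /(_ _ _ j isT) H.
  have {}H : (phi x - c - v) 0 j * (phi x - c - v) 0 j = 0.
    by apply: H => [k _|]; [exact: sqr_ge0|rewrite -/(ip _ (phi x - c - v) (phi x - c - v)) z0].
  move/eqP: H; rewrite mulf_eq0 orbb => /eqP.
  rewrite /v !mxE summxE => H.
  have -> : phi x 0 j = c 0 j + (phi x 0 j - c 0 j) by ring.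
  congr (_ + _); move/eqP: H; rewrite subr_eq0 => /eqP ->.
  by apply: eq_bigr => k _; rewrite mxE.
have ui k : u k 0 i = 0.
  by rewrite /u !mxE (cube_phi _ (cube_delta k)).2 ci subrr.
have abs_sum j : j != i -> \sum_k `|u k 0 j| <= 1.
  (* The corner at which the [j]-th coordinate of [phi] is largest. *)
  move=> ji; pose s : 'rV[R]_n := \row_k (if 0 <= u k 0 j then 1 else -1).
  have sE k : s 0 k * u k 0 j = `|u k 0 j|.
    rewrite /s mxE; case: ifPn => h; first by rewrite mul1r; exact/esym/ger0_norm.
    by rewrite mulN1r; apply/esym/ltr0_norm; rewrite ltNge.
  have cs : cube s by apply/cubeP => k; rewrite mxE; case: ifP; rewrite ?normrN normr1.
  have /cubeP/(_ j) := (cube_phi _ cs).1; rewrite linear// c0// add0r.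
  by under eq_bigr do rewrite sE; rewrite ger0_norm// sumr_ge0.
have sq_sum k : \sum_(j | j != i) u k 0 j ^+ 2 = 1.
  have : ip _ (u k) (u k) = 1 by rewrite ipE// ip_delta mxE !eqxx.
  by rewrite /ip (bigD1 i)//= ui mul0r add0r => <-; apply: eq_bigr => j _; rewrite expr2.
have abs_le k j : j != i -> `|u k 0 j| <= 1.
  move=> ji; apply: le_trans (abs_sum j ji).
  by rewrite (bigD1 k)//= lerDl sumr_ge0.
have sq_le k j : j != i -> u k 0 j ^+ 2 <= `|u k 0 j|.
  move=> ji; rewrite -real_normK ?num_real// expr2 ler_piMr//; exact: abs_le.
(* Double counting: [n] coordinates other than [i] against [n] unit vectors. *)
have total : \sum_(j | j != i) (1 - \sum_k u k 0 j ^+ 2) <= 0.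
  rewrite sumrB exchange_big /=; under [X in _ - X]eq_bigr do rewrite sq_sum.
  by rewrite !sumr_const cardC1 !card_ord subrr.
have row_sq j : j != i -> \sum_k u k 0 j ^+ 2 = 1.
  move=> ji; apply/eqP; rewrite eq_sym -subr_eq0; apply/eqP.
  apply: (sum_eq0_all (P := fun j => j != i) (a := fun j => 1 - \sum_k u k 0 j ^+ 2)) => // l li.
  by rewrite subr_ge0 (le_trans _ (abs_sum l li))// ler_sum// => k _; exact: sq_le.
have sq_abs k j : j != i -> `|u k 0 j| - u k 0 j ^+ 2 = 0.
  move=> ji; apply: (sum_eq0_all (P := predT) (a := fun k => `|u k 0 j| - u k 0 j ^+ 2)) => // [l _|].
    by rewrite subr_ge0; exact: sq_le.
  by rewrite sumrB row_sq// subr_le0; exact: abs_sum.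
have u01 k j : u k 0 j != 0 -> `|u k 0 j| = 1.
  have [->|ji] := eqVneq j i; first by rewrite ui eqxx.
  move=> nz; have := sq_abs k j ji; rewrite -[u k 0 j ^+ 2]real_normK ?num_real//.
  rewrite expr2 -{1}[`|u k 0 j|]mulr1 -mulrBr => /eqP.
  by rewrite mulf_eq0 normr_eq0 (negbTE nz) /= subr_eq0 => /eqP.
have sq1 k j : u k 0 j != 0 -> u k 0 j ^+ 2 = 1.
  by move=> nz; rewrite -real_normK ?num_real// u01// expr1n.
have col_uniq j k l : u k 0 j != 0 -> u l 0 j != 0 -> k = l.
  have [->|ji] := eqVneq j i; first by rewrite ui eqxx.
  move=> uk ul; apply/eqP; apply: contraT => kl.
  have := abs_sum j ji; rewrite (bigD1 k)//= (bigD1 l) ?(eq_sym l) //=.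
  rewrite (u01 _ _ uk) (u01 _ _ ul) => H.
  have : 0 <= \sum_(m < n | (m != k) && (m != l)) `|u m 0 j| by apply: sumr_ge0.
  lra.
have row_uniq k j l : u k 0 j != 0 -> u k 0 l != 0 -> j = l.
  move=> uj ul; apply/eqP; apply: contraT => jl.
  have ji : j != i by apply: contraNneq uj => ->; rewrite ui.
  have li : l != i by apply: contraNneq ul => ->; rewrite ui.
  have := sq_sum k; rewrite (bigD1 j)//= (bigD1 l) ?li ?(eq_sym l) //=.
  rewrite (sq1 _ _ uj) (sq1 _ _ ul) => H.
  have : 0 <= \sum_(m < n.+1 | [&& m != i, m != j & m != l]) u k 0 m ^+ 2.
    by apply: sumr_ge0 => m _; exact: sqr_ge0.
  under [X in 0 <= X -> _]eq_bigl do rewrite andbA.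
  lra.
have ex_k j : j != i -> exists k, u k 0 j != 0.
  move=> ji; apply: contrapT => no; have := row_sq j ji; rewrite big1 => [H|k _].
    by have := oner_neq0 R; rewrite -H eqxx.
  apply/eqP; rewrite sqrf_eq0; apply: contrapT => /negP nz; by apply: no; exists k.
have ex_j k : exists j, u k 0 j != 0.
  apply: contrapT => no; have := sq_sum k; rewrite big1 => [H|j _].
    by have := oner_neq0 R; rewrite -H eqxx.
  apply/eqP; rewrite sqrf_eq0; apply: contrapT => /negP nz; by apply: no; exists j.
pose F (j : 'I_n.+1) : option 'I_n * bool :=
  if [pick k | u k 0 j != 0] is Some k then (Some k, 0 < u k 0 j) else (None, 0 < c 0 j).
have FP k j : (F j).1 = Some k <-> u k 0 j != 0.
  rewrite /F; case: pickP => [l ul|none]; last by split => //; rewrite none.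
  by split => [[<-]//|uk] /=; congr Some; exact: col_uniq ul uk.
exists F; split.
  split=> [k|k j j']; first by have [j uj] := ex_j k; exists j; apply/FP.
  by move=> /FP uj /FP uj'; exact: row_uniq uj uj'.
move=> w cw; apply/rowP => j; rewrite linear// mxE /F; case: pickP => [k uk|none] /=.
  have ji : j != i by apply: contraNneq uk => ->; rewrite ui.
  rewrite c0// add0r (bigD1 k)//= big1 ?addr0 => [|l lk].
    have /eqP := u01 _ _ uk; rewrite eqr_norml => /andP [/orP [] /eqP -> _]; rewrite /Defs.sgb.
      by rewrite ltr01 mulrC.
    by rewrite oppr_gt0 ltr10 mulrC.
  have [->|ul] := eqVneq (u l 0 j) 0; first by rewrite mulr0.
  by rewrite (col_uniq _ _ _ ul uk) eqxx in lk.
have ji : j = i.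
  by apply/eqP; apply: contraT => /ex_k [k]; rewrite none.
rewrite big1 ?addr0 => [|k _]; last by have /negbT := none k; rewrite negbK => /eqP ->; rewrite mulr0.
by rewrite ji ci mulr1; case: b {phi_onto cube_phi ci} => //=; rewrite /Defs.sgb ?ltr01 ?oppr_gt0 ?ltr10.
Qed.

End FaceMaps.

(** * Carriers of points, and stars *)

Section Faces.
Context {R : realType} (X : cubeComplex R).
Local Notation sgb := (@sgb R).
Implicit Types (x p : X).

Lemma sgb_far (a r : R) s s' : `|a| <= 1 - 2 * r -> `|sgb s - sgb s' * a| < 2 * r -> False.
Proof.
rewrite ler_norml ltr_norml => /andP [? ?] /andP [].
by case: s; case: s'; rewrite /Defs.sgb; lra.
Qed.

Lemma sgb_near (r : R) s s' : r <= 2^-1 -> `|sgb s - sgb s'| < 2 * r -> s = s'.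
Proof.
by rewrite ltr_norml => ? /andP []; case: s; case: s'; rewrite /Defs.sgb //; lra.
Qed.

Definition is_face_of m n (d : cell X n) (g : cell X m)
    (F : 'I_n -> option 'I_m * bool) :=
  face_type F /\ forall w, cube w -> cmap d (face_embed F w) = cmap g w.

Lemma face_refl n (d : cell X n) : is_face_of d d (fun j => (Some j, true)).
Proof.
split; first by split=> [i|i j j' [->] [->]//]; exists i.
by move=> w _; congr (cmap d); apply/rowP => j; rewrite mxE /= /Defs.sgb mul1r.
Qed.

Lemma face_trans l m n (d : cell X n) (g : cell X m) (f : cell X l) F G :
  is_face_of d g F -> is_face_of g f G -> is_face_of d f (face_comp F G).
Proof.
move=> [tF dF] [tG gG]; split; first exact: face_comp_type.
by move=> w cw; rewrite face_embed_comp dF ?gG//; exact: face_embed_cube.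
Qed.

(** A point with a coordinate 1 or -1 lies on a facet; [facet_isometry_face] turns the gluing
    isometry of this facet into a face map, and the induction continues there. *)
Lemma open_face n (d : cell X n) (z : 'rV[R]_n) : cube z ->
  exists m (g : cell X m) F z0, [/\ is_face_of d g F, open_cube z0 & face_embed F z0 = z].
Proof.
elim: n d z => [|n IH] d z cz.
  by exists 0%N, d, (fun j => (Some j, true)), z; split; [exact: face_refl|case|apply/rowP; case].
have [oz|/existsNP [i zi]] := pselect (open_cube z).
  exists n.+1, d, (fun j => (Some j, true)), z; split=> //; first exact: face_refl.
  by apply/rowP => j; rewrite mxE /= /Defs.sgb mul1r.
have [b zb] : exists b, z 0 i = sgb b.
  have /cubeP/(_ i) := cz; rewrite le_eqVlt => /orP [|]; last by rewrite ltr_norml => /zi.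
  by rewrite eqr_norml => /andP [/orP [] /eqP ->]; [exists true|exists false].
have [g0 [phi [iso gE]]] := cmap_facet d i b.
have [F [tF FE]] := facet_isometry_face iso.
have [w cw wz] : (phi @` @cube R n) z by rewrite iso.1.
have fF : is_face_of d g0 F by split=> // v cv; rewrite -FE// gE.
have [m [g [G [z0 [fG oz0 z0E]]]]] := IH g0 w cw.
exists m, g, (face_comp F G), z0; split=> //; first exact: face_trans fF fG.
by rewrite face_embed_comp z0E -FE.
Qed.

Lemma carrier_exists x : {n : nat & {c : cell X n & {y | open_cube y /\ cmap c y = x}}}.
Proof.
have [n P] := cid (cmap_cover x); exists n.
have [c P'] := cid P; exists c; exact: cid P'.
Qed.

Definition cdim x := projT1 (carrier_exists x).
Definition ccell x : cell X (cdim x) := projT1 (projT2 (carrier_exists x)).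
Definition ccoord x : 'rV[R]_(cdim x) := proj1_sig (projT2 (projT2 (carrier_exists x))).

Lemma ccoord_open x : open_cube (ccoord x).
Proof. exact: (proj2_sig (projT2 (projT2 (carrier_exists x)))).1. Qed.

Lemma ccoord_cube x : cube (ccoord x).
Proof. exact/open_cube_cube/ccoord_open. Qed.


Arguments ccoord_open x i : clear implicits.
Arguments ccoord_cube x i : clear implicits.

Lemma ccoordE x : cmap (ccell x) (ccoord x) = x.
Proof. exact: (proj2_sig (projT2 (projT2 (carrier_exists x)))).2. Qed.

(** [cmap_disjoint] equates dependent pairs only. A predicate over all dimensions moves the cell and
    the coordinates together and replaces casts. *)
Lemma open_cell_ind (P : forall m, cell X m -> 'rV[R]_m -> Prop) m (g : cell X m) z
    n (c : cell X n) y :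
  open_cube z -> open_cube y -> cmap g z = cmap c y -> P m g z -> P n c y.
Proof.
move=> oz oy gc Pz; have e := cmap_disjoint oz oy gc.
pose Q (s : {k & cell X k}) := forall w : 'rV[R]_(projT1 s),
  open_cube w -> cmap g z = cmap (projT2 s) w -> P _ (projT2 s) w.
have Qg : Q (existT _ m g) by move=> w ow /= zw; rewrite -(cmap_inj oz ow zw).
suff : Q (existT _ n c) by apply.
by rewrite -e.
Qed.

Lemma carrier_ind x (P : forall m, cell X m -> 'rV[R]_m -> Prop) m (g : cell X m) z :
  open_cube z -> cmap g z = x -> P m g z -> P (cdim x) (ccell x) (ccoord x).
Proof.
move=> oz gz Pz; have e : cmap g z = cmap (ccell x) (ccoord x) by rewrite ccoordE.
exact: (open_cell_ind oz (ccoord_open x) e Pz).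
Qed.

Lemma carrier_face n (d : cell X n) (z : 'rV[R]_n) x : cube z -> cmap d z = x ->
  exists F, is_face_of d (ccell x) F /\ face_embed F (ccoord x) = z.
Proof.
move=> cz zx; have [m [g [F [z0 [fF oz0 z0E]]]]] := open_face d cz.
have gz : cmap g z0 = x by rewrite -fF.2 ?z0E//; exact: open_cube_cube.
apply: (@carrier_ind _ (fun m g y => exists F, is_face_of d g F /\ face_embed F y = z) m g z0 oz0 gz).
by exists F.
Qed.

Lemma face_const m n (F : 'I_n -> option 'I_m * bool) (w : 'rV[R]_m) j :
  open_cube w -> ((F j).1 = None <-> `|face_embed F w 0 j| = 1).
Proof.
move=> /open_cubeP ow; rewrite mxE normrM normr_sgb mul1r.
case: (F j).1 => [i|] /=; last by rewrite normr1.
by split => // wi; have := ow i; rewrite wi ltxx.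
Qed.

Lemma face_embed_onto m n (F : 'I_n -> option 'I_m * bool) (v : 'rV[R]_n) :
  face_type F -> cube v -> (forall j, (F j).1 = None -> v 0 j = sgb (F j).2) ->
  exists2 w, cube w & face_embed F w = v.
Proof.
move=> [F1 F2] /cubeP cv vc; have [s sE] := choice F1.
exists (\row_i (sgb (F (s i)).2 * v 0 (s i))).
  by apply/cubeP => i; rewrite mxE normrM normr_sgb mul1r.
apply/rowP => j; rewrite mxE; case Fj : (F j).1 => [i|] /=; last by rewrite mulr1 vc.
by rewrite mxE (F2 _ _ _ (sE i) Fj) mulrA sgb_sq mul1r.
Qed.

Definition sup_coord n (y : 'rV[R]_n) : R := \big[Num.max/0]_i `|y 0 i|.

(* Half the sup-norm distance from [p] to the boundary of its open cube: within
   this distance of a point of a closed cube lies at most one preimage of [p]. *)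
Definition star_radius p : R := (1 - sup_coord (ccoord p)) / 2.

Lemma star_radius_gt0 p : 0 < star_radius p.
Proof.
rewrite /star_radius divr_gt0// subr_gt0; apply: bigmax_lt => // i _.
by have /open_cubeP := ccoord_open p.
Qed.

Lemma star_radius_le p : star_radius p <= 2^-1.
Proof.
rewrite /star_radius ler_pdivrMr// mulVf ?pnatr_eq0// gerBl.
exact: bigmax_ge_id.
Qed.

Lemma star_radius_coord p i : `|ccoord p 0 i| <= 1 - 2 * star_radius p.
Proof.
have : `|ccoord p 0 i| <= sup_coord (ccoord p) by exact: le_bigmax.
rewrite /star_radius; lra.
Qed.


Arguments star_radius_coord p i : clear implicits.

Lemma row_ballE n (x y : 'rV[R]_n) e : ball x e y <-> 0 < e /\ forall i, `|x 0 i - y 0 i| < e.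
Proof.
split=> [[e0 H]|[e0 H]]; split=> //.
  by move=> i; have := H 0 i; rewrite -ball_normE.
by move=> i j; rewrite ord1 -ball_normE /=; exact: H.
Qed.

Lemma over_coord p n (d : cell X n) (y : 'rV[R]_n) j : cube y -> cmap d y = p ->
  `|y 0 j| = 1 \/ `|y 0 j| <= 1 - 2 * star_radius p.
Proof.
move=> cy yp; have [F [_ <-]] := carrier_face cy yp.
rewrite mxE normrM normr_sgb mul1r.
by case: (F j).1 => [i|] /=; [right; exact: star_radius_coord|left; rewrite normr1].
Qed.

(** By [over_coord], a coordinate of [y] that differs from the value 1 or -1 of [z] is at distance
    at least [2 * star_radius p] from it. *)
Lemma near_const p n (d : cell X n) (y z : 'rV[R]_n) j : cube y -> cmap d y = p ->
  ball y (star_radius p) z -> `|z 0 j| = 1 -> y 0 j = z 0 j.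
Proof.
move=> cy yp /row_ballE [r0 /(_ j)]; rewrite ltr_norml => /andP [a b] z1.
have r12 := star_radius_le p.
have /eqP := z1; rewrite eqr_norml => /andP [/orP [] /eqP zE _];
  case: (over_coord j cy yp) => [/eqP|]; rewrite ?eqr_norml ?ler_norml.
- by case/andP => /orP [] /eqP yE _; lra.
- by case/andP => ? ?; lra.
- by case/andP => /orP [] /eqP yE _; lra.
- by case/andP => ? ?; lra.
Qed.

(** The two preimages have the same constant coordinates with the same signs, hence lie in the
    interior of one face, where the characteristic map is injective. *)
Lemma over_unique p n (d : cell X n) (y y' z : 'rV[R]_n) : cube y -> cube y' ->
  cmap d y = p -> cmap d y' = p ->
  ball y (star_radius p) z -> ball y' (star_radius p) z -> y = y'.
Proof.
move=> cy cy' yp yp' /row_ballE [r0 bz] /row_ballE [_ bz'].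
have r12 := star_radius_le p.
have dist j : `|y 0 j - y' 0 j| < 2 * star_radius p.
  by have := bz j; have := bz' j; rewrite !ltr_norml => /andP [? ?] /andP [? ?]; apply/andP; split; lra.
have [F [fF yE]] := carrier_face cy yp; have [F' [fF' yE']] := carrier_face cy' yp'.
have opp j : (F j).1 = None -> (F' j).1 = None /\ (F' j).2 = (F j).2.
  move=> Fj; have := dist j; rewrite -yE -yE' !mxE Fj /= mulr1.
  case: (F' j).1 => [i|] /=; first by move=> /(sgb_far (star_radius_coord p i)).
  by rewrite mulr1 => /(sgb_near r12).
have opp' j : (F' j).1 = None -> (F j).1 = None /\ (F' j).2 = (F j).2.
  move=> Fj; have := dist j; rewrite distrC -yE -yE' !mxE Fj /= mulr1.
  case: (F j).1 => [i|] /=; first by move=> /(sgb_far (star_radius_coord p i)).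
  by rewrite mulr1 => /(sgb_near r12).
have [|w cw wy] := @face_embed_onto _ _ F' y fF'.1 cy.
  by move=> j /opp' [Fj ->]; rewrite -yE mxE Fj /= mulr1.
have ow : open_cube w.
  apply/open_cubeP => i; have [j Fj] := fF'.1.1 i.
  have : `|y 0 j| < 1.
    rewrite lt_neqAle; have /cubeP/(_ j) -> := cy; rewrite andbT; apply/eqP.
    rewrite -yE => /(face_const F j (ccoord_open p)) /opp [].
    by rewrite Fj.
  by rewrite -wy mxE Fj normrM normr_sgb mul1r.
suff -> : y' = face_embed F' w by [].
rewrite -yE'; congr face_embed; apply: (@cmap_inj _ _ _ (ccell p) _ _ (ccoord_open p) ow).
by rewrite ccoordE -fF'.2// wy.
Qed.

Definition star p : set X := [set x | exists n (d : cell X n) z y,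
  [/\ cube z, cube y, cmap d z = x, cmap d y = p & ball y (star_radius p) z]].

Lemma star_center p : star p p.
Proof.
exists (cdim p), (ccell p), (ccoord p), (ccoord p); split; rewrite ?ccoordE//.
- exact: ccoord_cube.
- exact: ccoord_cube.
- by apply: ballxx; exact: star_radius_gt0.
Qed.

(** By [near_const], the face that carries [x] also contains the preimage [y] of [p], so the witness
    can be moved from any cube to the carrier of [x]. *)
Lemma star_carrier p x : star p x -> exists y,
  [/\ cube y, cmap (ccell x) y = p & ball y (star_radius p) (ccoord x)].
Proof.
move=> [n [d [z [y [cz cy zx yp bz]]]]].
have [F [fF zE]] := carrier_face cz zx.
have [|w cw wy] := @face_embed_onto _ _ F y fF.1 cy.
  move=> j Fj; rewrite (near_const cy yp bz (j := j)).
    by rewrite -zE mxE Fj mulr1.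
  by rewrite -zE; apply/(face_const F j (ccoord_open x)).
exists w; split => //; first by rewrite -fF.2// wy.
move/row_ballE: bz => [r0 bz]; apply/row_ballE; split=> // i.
have [j Fj] := fF.1.1 i; have := bz j.
by rewrite -wy -zE !mxE Fj /= -mulrBr normrM normr_sgb mul1r.
Qed.

Lemma star_cell p n (d : cell X n) (z : 'rV[R]_n) x : cube z -> cmap d z = x ->
  star p x -> exists y,
  [/\ cube y, cmap d y = p & ball y (star_radius p) z].
Proof.
move=> cz zx /star_carrier [y [cy yp by_]].
have [F [fF zE]] := carrier_face cz zx.
exists (face_embed F y); split; [exact: face_embed_cube|by rewrite fF.2|].
move/row_ballE: by_ => [r0 H]; apply/row_ballE; split=> // j.
rewrite -zE !mxE -mulrBr normrM normr_sgb mul1r.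
by case: (F j).1 => [i|] /=; rewrite ?subrr ?normr0.
Qed.

Definition star_coord p x : 'rV[R]_(cdim x) :=
  xget 0 [set y | [/\ cube y, cmap (ccell x) y = p & ball y (star_radius p) (ccoord x)]].

Lemma star_coordP p x : star p x ->
  [/\ cube (star_coord p x), cmap (ccell x) (star_coord p x) = p &
      ball (star_coord p x) (star_radius p) (ccoord x)].
Proof. by move=> /star_carrier; exact: xgetPex. Qed.

Definition contract p x (s : R) : X :=
  cmap (ccell x) ((1 - s) *: ccoord x + s *: star_coord p x).

Lemma segment_cube n (y z : 'rV[R]_n) (s : R) : cube y -> cube z -> s \in `[0, 1] ->
  cube ((1 - s) *: y + s *: z).
Proof.
move=> cy cz /in01P [s0 s1] i; have := cy i; have := cz i; rewrite !mxE.
by move=> /andP [? ?] /andP [? ?]; apply/andP; split; nra.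
Qed.

Lemma face_embed_segment m n (F : 'I_n -> option 'I_m * bool) (y z : 'rV[R]_m) (s : R) :
  face_embed F ((1 - s) *: y + s *: z) = (1 - s) *: face_embed F y + s *: face_embed F z.
Proof.
apply/rowP => j; rewrite !mxE; case: (F j).1 => [i|] /=; rewrite ?mxE; ring.
Qed.

(** Face embeddings preserve segments, and [over_unique] identifies [y] with the embedded
    [star_coord]; so the contraction can be computed in any cube over [x]. *)
Lemma contract_cell p n (d : cell X n) (z y : 'rV[R]_n) x (s : R) :
  cube z -> cube y -> cmap d z = x -> cmap d y = p ->
  ball y (star_radius p) z -> s \in `[0, 1] ->
  contract p x s = cmap d ((1 - s) *: z + s *: y).
Proof.
move=> cz cy zx yp bz sI; rewrite /contract.
have sx : star p x by exists n, d, z, y.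
have [c0 y0p b0] := star_coordP sx.
have [F [fF zE]] := carrier_face cz zx.
have cs := segment_cube (ccoord_cube x) c0 sI.
rewrite -fF.2// face_embed_segment zE; congr (cmap d (_ + _ *: _)).
apply: (@over_unique p _ d _ _ z) => //.
- exact: face_embed_cube.
- by rewrite fF.2.
- move/row_ballE: b0 => [r0 H]; apply/row_ballE; split=> // j.
  rewrite -zE !mxE -mulrBr normrM normr_sgb mul1r.
  by case: (F j).1 => [i|] /=; rewrite ?subrr ?normr0.
Qed.

Lemma contract0 p x : contract p x 0 = x.
Proof. by rewrite /contract subr0 scale1r scale0r addr0 ccoordE. Qed.

Lemma contract1 p x : star p x -> contract p x 1 = p.
Proof. by move=> /star_coordP [_ H _]; rewrite /contract subrr scale1r scale0r add0r. Qed.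

End Faces.

Arguments ccoord_open {R X} x i.
Arguments ccoord_cube {R X} x i.
Arguments star_radius_coord {R X} p i.

(** * Stars of points *)

Section StarTopology.
Context {R : realType} (X : cubeComplex R).
Implicit Types (x p : X).

Lemma cube_closed n : closed (@cube R n).
Proof.
rewrite (_ : @cube R n = \bigcap_(i in [set: 'I_n]) ((fun x : 'rV[R]_n => x 0 i) @^-1` `[-1, 1])).
  apply: closed_bigI => i _; apply: preimage_closed; last exact: interval_closed.
  by move=> x _; exact: coord_continuous.
apply/seteqP; split=> [x cx i _|x cx i]; first by rewrite /= in_itv /=; exact: cx.
by have := cx i I; rewrite /= in_itv.
Qed.

Lemma cmap_cts n (d : cell X n) : {within @cube R n, continuous cmap d}.
Proof.
apply/subspace_continuousP => z cz O /=; rewrite nbhsE => -[O' [oO' O'z] O'O].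
have : closed (@cube R n `&` cmap d @^-1` (~` O')).
  by have /cc_closedP H : closed (~` O') by [rewrite closedC]; exact: H.
move=> /closed_openC oC; have : nbhs z (~` (@cube R n `&` cmap d @^-1` (~` O'))).
  by apply: open_nbhs_nbhs; split=> //= -[_]; apply.
apply: filterS => z' /= nz cz'; apply: O'O; apply: contrapT => nO; exact: nz.
Qed.

Lemma open_cells (W : set X) :
  (forall n (d : cell X n) z, cube z -> W (cmap d z) ->
     nbhs z [set z' | cube z' -> W (cmap d z')]) -> open W.
Proof.
move=> H; rewrite -closedC; apply/cc_closedP => n d; rewrite -[X in closed X]setCK.
apply: open_closedC; rewrite openE => z /= nz.
have [cz|ncz] := pselect (cube z).
  have Wz : W (cmap d z) by apply: contrapT => nW; apply: nz.
  by apply: filterS (H _ _ _ cz Wz) => z' cW [cz' nW]; apply: nW; exact: cW.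
have : nbhs z (~` @cube R n).
  by apply: open_nbhs_nbhs; split=> //; apply: closed_openC; exact: cube_closed.
by apply: filterS => z' nc [].
Qed.

Lemma star_open p : open (star p).
Proof.
apply: open_cells => n d z cz sz; have [y [cy yp bz]] := star_cell cz erefl sz.
have : nbhs z (ball y (star_radius p)) by apply: open_nbhs_nbhs; split=> //; exact: ball_open.
by apply: filterS => z' bz' cz'; exists n, d, z', y.
Qed.

(** Openness in the complex is tested on cubes, which says nothing directly about its product with
    an interval. For a compact set [K] of times, however, the points whose track over [K] stays in
    [O] form a subset of the complex; its openness is tested cube by cube, and there it is the tube
    lemma. *)
Lemma contract_cts p x (s : R) (O : set X) : open O -> star p x -> s \in `[0, 1] ->
  O (contract p x s) -> exists2 e, 0 < e &
    \forall x' \near x, star p x' /\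
      forall s', s' \in `[0, 1] -> `|s - s'| <= e -> O (contract p x' s').
Proof.
move=> oO sx sI Os.
have line n (d : cell X n) (y z : 'rV[R]_n) (s1 : R) : cube y -> cube z -> s1 \in `[0, 1] ->
    O (cmap d ((1 - s1) *: z + s1 *: y)) ->
    nbhs (z, s1) [set w : 'rV[R]_n * R | cube w.1 -> w.2 \in `[0, 1] ->
      O (cmap d ((1 - w.2) *: w.1 + w.2 *: y))].
  move=> cy cz s1I Oz; pose v := (1 - s1) *: z + s1 *: y.
  have cv : cube v := segment_cube cz cy s1I.
  have /subspace_continuousP /(_ v cv O) := cmap_cts (d := d).
  have Ov : nbhs (cmap d v) O by apply: open_nbhs_nbhs.
  move=> /(_ Ov); rewrite /nbhs /= /within /= => nv.
  have cont : (fun w : 'rV[R]_n * R => (1 - w.2) *: w.1 + w.2 *: y) @ (z, s1) --> v.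
    apply: cvgD; apply: cvgZ.
    - by apply: cvgB; [exact: cvg_cst|exact: cvg_snd].
    - exact: cvg_fst.
    - exact: cvg_snd.
    - exact: cvg_cst.
  have nc : nbhs (z, s1) ((fun w : 'rV[R]_n * R => (1 - w.2) *: w.1 + w.2 *: y) @^-1`
      [set v' | cube v' -> O (cmap d v')]) := cont _ nv.
  refine (filterS _ nc) => -[z' s'] /= H cz' s'I.
  by apply: H; exact: segment_cube.
have [y [cy yp bz]] := star_cell (ccoord_cube x) (ccoordE x) sx.
have [e e0 He] : exists2 e, 0 < e & forall s', s' \in `[0, 1] -> `|s - s'| <= e -> O (contract p x s').
  have := line _ (ccell x) y (ccoord x) s cy (ccoord_cube x) sI.
  rewrite -(contract_cell (ccoord_cube x) cy (ccoordE x) yp bz sI) => /(_ Os).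
  move=> /nbhs_ballP [e /= e0 H]; exists (e / 2); first exact: divr_gt0.
  move=> s' s'I ss'; rewrite (contract_cell (ccoord_cube x) cy (ccoordE x) yp bz s'I).
  apply: (H (ccoord x, s')); rewrite /=; [split => /=|exact: ccoord_cube|by []].
    exact: ballxx.
  rewrite -ball_normE /=; apply: le_lt_trans ss' _; by rewrite ltr_pdivrMr// ltr_pMr// ltr1n.
exists e => //.
pose K : set R := `[0, 1] `&` [set s' | `|s - s'| <= e].
have cK : compact K.
  apply: compact_closedI; first exact: segment_compact.
  apply: (@closed_comp _ _ (fun s' : R => `|s - s'|) [set t | t <= e]); last exact: closed_le.
  by move=> s' _; apply: cvg_norm; apply: cvgB; [exact: cvg_cst|exact: cvg_id].
pose W : set X := [set x' | star p x' /\ forall s', K s' -> O (contract p x' s')].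
suff oW : open W.
  have : nbhs x W by apply: open_nbhs_nbhs; split=> //; split=> // s' [s'I ss']; exact: He.
  by apply: filterS => x' [sx' H]; split=> // s' s'I ss'; apply: H.
apply: open_cells => n d z cz [sz Hz].
have [y' [cy' yp' bz']] := star_cell cz erefl sz.
have nb : nbhs z (ball y' (star_radius p)) by apply: open_nbhs_nbhs; split=> //; exact: ball_open.
have /compact_near_coveringP/(_ _ (nbhs z) (fun z' s' => cube z' -> s' \in `[0, 1] ->
   O (cmap d ((1 - s') *: z' + s' *: y')))) H := cK.
have {}H : \forall z' \near z, K `<=` (fun s' => cube z' -> s' \in `[0, 1] ->
   O (cmap d ((1 - s') *: z' + s' *: y'))).
  apply: H => s1 Ks1; have s1I : s1 \in `[0, 1] by case: Ks1.
  have := line _ d y' z s1 cy' cz s1I.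
  rewrite -(contract_cell cz cy' erefl yp' bz' s1I) => /(_ (Hz _ Ks1)).
  move=> [[A B] [/= nA nB] AB]; exists (B, A) => // -[s' z'] /= [Bs' Az'].
  exact: (AB (z', s')).
apply: filterS2 nb H => z' bz'' H cz'; split; first by exists n, d, z', y'.
move=> s' Ks'; have s'I : s' \in `[0, 1] by case: Ks'.
rewrite (contract_cell cz' cy' erefl yp' bz'' s'I).
exact: H.
Qed.

Lemma contract_path_cts p (f : R -> X) : {within `[0, 1], continuous f} ->
  (forall t, t \in `[0, 1] -> star p (f t)) ->
  {within `[0, 1] `*` `[0, 1], continuous (fun w : R * R => contract p (f w.2) w.1)}.
Proof.
move=> /subspace_continuousP cf sf; apply/subspace_continuousP => -[s t] [/= sI tI] O /=.
rewrite nbhsE => -[O' [oO' O's] O'O].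
have [e e0 H] := contract_cts oO' (sf t tI) sI O's.
have := cf t tI _ H; rewrite /nbhs /= /within /= => Ht.
have Hs : nbhs s [set s' | `|s - s'| <= e].
  by apply/nbhs_ballP; exists e => //= s'; rewrite -ball_normE /=; exact: ltW.
exists ([set s' | `|s - s'| <= e], [set t' | t' \in `[0, 1] -> star p (f t') /\
      forall s', s' \in `[0, 1] -> `|s - s'| <= e -> O' (contract p (f t') s')]) => //=.
by move=> [s' t'] /= [ss' Ht'] [s'I t'I]; apply: O'O; apply: (Ht' t'I).2.
Qed.

End StarTopology.

(** * Edge paths *)

Section EdgePaths.
Context {R : realType} (X : cubeComplex R).
Local Notation sgb := (@sgb R).
Implicit Types (x y : X).

Definition line n (y z : 'rV[R]_n) (t : R) : 'rV[R]_n := (1 - t) *: y + t *: z.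

Lemma line_cts n (y z : 'rV[R]_n) : {within `[0, 1], continuous (line y z)}.
Proof.
apply: continuous_subspaceT => t; apply: cvgD; apply: cvgZ.
- by apply: cvgB; [exact: cvg_cst|exact: cvg_id].
- exact: cvg_cst.
- exact: cvg_id.
- exact: cvg_cst.
Qed.

Lemma line0 n (y z : 'rV[R]_n) : line y z 0 = y.
Proof. by rewrite /line subr0 scale1r scale0r addr0. Qed.

Lemma line1 n (y z : 'rV[R]_n) : line y z 1 = z.
Proof. by rewrite /line subrr scale0r scale1r add0r. Qed.

Definition cube_path n (y : 'rV[R]_n) (a : R -> 'rV[R]_n) (z : 'rV[R]_n) :=
  is_path y a z /\ forall t, t \in `[0, 1] -> cube (a t).

Lemma cube_path_line n (y z : 'rV[R]_n) : cube y -> cube z -> cube_path y (line y z) z.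
Proof.
move=> cy cz; split; first by split; [exact: line_cts|exact: line0|exact: line1].
by move=> t tI; exact: segment_cube.
Qed.

Lemma cube_path_cat n (y z w : 'rV[R]_n) a b :
  cube_path y a z -> cube_path z b w -> cube_path y (concat_fun a b) w.
Proof.
move=> [pa ca] [pb cb]; split; first exact: is_path_cat pa pb.
move=> t /in01P [? ?]; rewrite /concat_fun; case: ifPn; rewrite -?ltNge => ?.
  by apply: ca; apply/in01P; split; lra.
by apply: cb; apply/in01P; split; lra.
Qed.

Lemma cube_path_reverse n (y z : 'rV[R]_n) a : cube_path y a z -> cube_path z (reverse_path a) y.
Proof.
move=> [pa ca]; split; first exact: is_reverse_path.
by move=> t /in01P [? ?]; apply: ca; apply/in01P; split; lra.
Qed.

Lemma is_path_cmap n (d : cell X n) (y : 'rV[R]_n) a (z : 'rV[R]_n) : cube_path y a z ->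
  is_path (cmap d y) (cmap d \o a) (cmap d z).
Proof.
move=> [[ca a0 a1] cu]; split; rewrite /= ?a0 ?a1//.
by apply: (within_comp (cmap_cts (d := d)) ca) => t; exact: cu.
Qed.

Lemma cmap_homotopic n (d : cell X n) (y : 'rV[R]_n) a b (z : 'rV[R]_n) :
  cube_path y a z -> cube_path y b z ->
  path_homotopic (cmap d \o a) (cmap d \o b).
Proof.
move=> [[ca a0 a1] cua] [[cb b0 b1] cub].
apply: (convex_homotopic (cmap_cts (d := d)) ca cb); rewrite ?a0 ?a1//.
by move=> s t sI tI; apply: segment_cube => //; [exact: cua|exact: cub].
Qed.

Lemma cmap_concat n (d : cell X n) (a b : R -> 'rV[R]_n) :
  cmap d \o concat_fun a b = concat_fun (cmap d \o a) (cmap d \o b).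
Proof. by apply/funext => t; rewrite /concat_fun /=; case: ifP. Qed.

Definition edge_map (a : oedge X) (t : R) : X := oedge_map a (2 * t - 1).

Lemma is_path_edge a : is_path (origin a) (edge_map a) (terminus a).
Proof.
have -> : edge_map a = cmap a.1 \o (line (const_mx (- sgb a.2)) (const_mx (sgb a.2))).
  apply/funext => t; rewrite /edge_map /oedge_map /=; congr (cmap _ _).
  by apply/rowP => i; rewrite !mxE; ring.
have -> : origin a = cmap a.1 (const_mx (- sgb a.2)) by rewrite /origin /oedge_map mulrN1.
have -> : terminus a = cmap a.1 (const_mx (sgb a.2)) by rewrite /terminus /oedge_map mulr1.
by apply/is_path_cmap/cube_path_line; apply/cubeP => i; rewrite mxE ?normrN normr_sgb.
Qed.

Lemma origin_rev a : origin (oedge_rev a) = terminus a :> X.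
Proof.
rewrite /origin /terminus /oedge_map /=; congr (cmap _ (const_mx _)).
by case: a.2; rewrite /Defs.sgb /=; ring.
Qed.

Lemma terminus_rev a : terminus (oedge_rev a) = origin a :> X.
Proof.
rewrite /origin /terminus /oedge_map /=; congr (cmap _ (const_mx _)).
by case: a.2; rewrite /Defs.sgb /=; ring.
Qed.

Lemma edge_map_rev a : edge_map (oedge_rev a) = reverse_path (edge_map a).
Proof.
apply/funext => t; rewrite /reverse_path /edge_map /oedge_map /=.
by congr (cmap _ (const_mx _)); case: a.2; rewrite /Defs.sgb /=; ring.
Qed.

Local Notation edge_path := (@edge_path X (oedge X) (@origin R X) (@terminus R X)).

Fixpoint realize x (p : seq (oedge X)) : R -> X :=
  if p is a :: p' then concat_fun (edge_map a) (realize (terminus a) p') else fun=> x.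

Lemma is_path_cst x : is_path x (fun _ : R => x) x.
Proof. by split=> //; apply: continuous_subspaceT => ?; exact: cvg_cst. Qed.

Lemma is_path_realize x p y : edge_path x p y -> is_path x (realize x p) y.
Proof.
elim: p x => [x /= <-|a p IH x /= [<- /IH]]; first exact: is_path_cst.
exact: is_path_cat (is_path_edge a).
Qed.

Lemma path_homotopic_catl (T : topologicalType) (x y z : T) (f f' g : R -> T) :
  is_path x f y -> is_path y g z -> path_homotopic f f' ->
  path_homotopic (concat_fun f g) (concat_fun f' g).
Proof.
move=> [_ _ f1] [cg g0 _] ff; apply: path_homotopic_cat ff (path_homotopic_refl cg).
by rewrite f1 g0.
Qed.

Lemma path_homotopic_catr (T : topologicalType) (x y z : T) (f g g' : R -> T) :
  is_path x f y -> is_path y g z -> path_homotopic g g' ->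
  path_homotopic (concat_fun f g) (concat_fun f g').
Proof.
move=> [cf _ f1] [_ g0 _] gg; apply: path_homotopic_cat (path_homotopic_refl cf) gg.
by rewrite f1 g0.
Qed.

Lemma realize_cat x p y q z : edge_path x p y -> edge_path y q z ->
  path_homotopic (realize x (p ++ q)) (concat_fun (realize x p) (realize y q)).
Proof.
move=> xp yq; elim: p x xp => [x /= ->|a p IH x /= [_ ap]].
  by apply: path_homotopic_sym; exact: path_1cat (is_path_realize yq).
have pa := is_path_edge a; have pp := is_path_realize ap; have pq := is_path_realize yq.
apply: path_homotopic_trans (path_catA pa pp pq).
have papq := is_path_realize (edge_path_cat ap yq).
exact: path_homotopic_catr pa papq (IH _ ap).
Qed.

Definition corner_row n (s : 'I_n -> bool) : 'rV[R]_n := \row_j sgb (s j).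

Lemma corner_cube n (s : 'I_n -> bool) : cube (corner_row s).
Proof. by apply/cubeP => j; rewrite mxE normr_sgb. Qed.

(* [a] is the [k]-th edge of [d] issuing from the corner with signs [s]. *)
Definition issues n (d : cell X n) (s : 'I_n -> bool) k (a : oedge X) :=
  forall t : R, -1 <= t <= 1 ->
    cmap d (\row_j if j == k then - sgb (s j) * t else sgb (s j)) = oedge_map a t.

(** The midpoint of the edge has a single free coordinate, so its open face is 1-dimensional. *)
Lemma issues_exists n (d : cell X n) (s : 'I_n -> bool) k : exists a, issues d s k a.
Proof.
pose z : 'rV[R]_n := \row_j if j == k then 0 else sgb (s j).
have cz : cube z by apply/cubeP => j; rewrite mxE; case: ifP; rewrite ?normr0 ?normr_sgb.
have [m [g [F [z0 [fF oz0 zE]]]]] := open_face d cz.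
have Fj j : j != k -> F j = (None, s j).
  move=> jk; have zj : z 0 j = sgb (s j) by rewrite mxE (negbTE jk).
  have Fn : (F j).1 = None.
    by apply/(face_const F j oz0); rewrite zE zj normr_sgb.
  have := zj; rewrite -zE mxE Fn /= mulr1 => /sgb_inj.
  by case: (F j) Fn => o b /= -> ->.
have Fk : exists i b, F k = (Some i, b).
  case FkE : (F k) => [[i|] b]; first by exists i, b.
  have := face_const F k oz0; rewrite FkE /= => -[/(_ erefl)].
  by rewrite zE mxE eqxx normr0 => /esym/eqP; rewrite oner_eq0.
have [i [b FkE]] := Fk.
have uniq i' : i' = i.
  have [j Fi'] := fF.1.1 i'; have [jk|/Fj Fj'] := eqVneq j k; last by rewrite Fj' in Fi'.
  by move: Fi'; rewrite jk FkE => -[].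
have m1 : m = 1%N.
  clear -i uniq; case: m i uniq => [|[|m]] i uniq //; first by case: (i).
  by have := uniq ord0; rewrite -(uniq ord_max).
subst m; exists (g, b == ~~ s k) => t t1.
rewrite /oedge_map /= -fF.2.
  congr (cmap d); apply/rowP => j; rewrite !mxE.
  case: eqVneq => [->|/Fj ->] /=; last by rewrite mulr1.
  by rewrite FkE /= mxE sgb_eq mulrA mulrA sgb_sq mul1r; case: (s k); rewrite /Defs.sgb /=; ring.
apply/cubeP => i'; rewrite mxE normrM normr_sgb mul1r ler_norml; exact: t1.
Qed.

Lemma issues_ends n (d : cell X n) (s s' : 'I_n -> bool) k (a : oedge X) : issues d s k a ->
  s' k = ~~ s k -> (forall j, j != k -> s' j = s j) ->
  [/\ origin a = cmap d (corner_row s), terminus a = cmap d (corner_row s') &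
    forall t, t \in `[0, 1] -> edge_map a t = (cmap d \o line (corner_row s) (corner_row s')) t].
Proof.
move=> H s'k s'j.
have E t : t \in `[0, 1] -> edge_map a t = (cmap d \o line (corner_row s) (corner_row s')) t.
  move=> /in01P [t0 t1]; rewrite /edge_map -H; last by apply/andP; split; lra.
  congr (cmap d); apply/rowP => j; rewrite !mxE; case: eqVneq => [->|/s'j ->]; last by ring.
  by rewrite s'k; case: (s k); rewrite /Defs.sgb /=; ring.
have [_ e0 e1] := is_path_edge a.
by split => //; [rewrite -e0 E ?mem01_0//= line0|rewrite -e1 E ?mem01_1//= line1].
Qed.

(** The corners [tau k] lead from [s] to [s'] by changing at most one sign at a time; the edge path
    is homotopic to the segment because the cube is convex. *)
Lemma corner_walk n (d : cell X n) (s s' : 'I_n -> bool) :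
  exists2 p, edge_path (cmap d (corner_row s)) p (cmap d (corner_row s')) &
    path_homotopic (realize (cmap d (corner_row s)) p)
      (cmap d \o line (corner_row s) (corner_row s')).
Proof.
pose tau k (j : 'I_n) := if (j < k)%N then s' j else s j.
suff H k : (k <= n)%N -> exists2 p, edge_path (cmap d (corner_row s)) p (cmap d (corner_row (tau k))) &
    path_homotopic (realize (cmap d (corner_row s)) p)
      (cmap d \o line (corner_row s) (corner_row (tau k))).
  have [p] := H n (leqnn n); rewrite (_ : tau n = s'); first by exists p.
  by apply/funext => j; rewrite /tau ltn_ord.
elim: k => [_|k IH kn].
  have -> : tau 0%N = s by apply/funext => j.
  exists [::] => //=; apply: path_homotopic_ext; first by have [] := is_path_cst (cmap d (corner_row s)).
  by move=> t _ /=; rewrite /line -scalerDl subrK scale1r.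
have [p ep hp] := IH (ltnW kn); pose k' := Ordinal kn.
have [same|diff] := eqVneq (s' k') (s k').
  suff -> : tau k.+1 = tau k by exists p.
  apply/funext => j; rewrite /tau ltnS leq_eqVlt.
  by case: eqVneq => [jk|//] /=; have -> : j = k' by [apply: val_inj]; rewrite ltnn.
have [a sa] := issues_exists d (tau k) k'.
have [||oa ta aE] := @issues_ends n d (tau k) (tau k.+1) k' a sa.
- by rewrite /tau /= ltnn ltnSn; move: diff; case: (s' k'); case: (s k').
- move=> j jk; rewrite /tau ltnS leq_eqVlt (_ : (_ == _ :> nat) = false)//.
  by apply: contra_neqF jk => /eqP jk; apply: val_inj.
have ea : edge_path (cmap d (corner_row (tau k))) [:: a] (cmap d (corner_row (tau k.+1))) by [].
exists (p ++ [:: a]); first exact: edge_path_cat ep ea.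
have pa := is_path_edge a; rewrite oa ta in pa.
have pl := cube_path_line (corner_cube s) (corner_cube (tau k)).
have pl' := cube_path_line (corner_cube (tau k)) (corner_cube (tau k.+1)).
apply: path_homotopic_trans (realize_cat ep ea) _.
apply: (@path_homotopic_trans _ _ (concat_fun (cmap d \o line (corner_row s) (corner_row (tau k)))
    (cmap d \o line (corner_row (tau k)) (corner_row (tau k.+1))))).
  apply: path_homotopic_cat hp _.
    by have [_ _ ->] := is_path_realize ep; have [_ -> _] := is_path_realize ea.
  rewrite /= ta; apply: path_homotopic_trans (path_cat1 pa) _.
  by apply: path_homotopic_ext => //; case: pa.
rewrite -cmap_concat; apply: cmap_homotopic.
  exact: cube_path_cat pl pl'.
exact: cube_path_line (corner_cube s) (corner_cube (tau k.+1)).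
Qed.

Definition vertex_near x : X := cmap (ccell x) (const_mx 1).
Definition to_vertex x : R -> X := cmap (ccell x) \o line (ccoord x) (const_mx 1).

Lemma cube_one n : cube (const_mx 1 : 'rV[R]_n).
Proof. by apply/cubeP => i; rewrite mxE normr1. Qed.

Lemma is_path_to_vertex x : is_path x (to_vertex x) (vertex_near x).
Proof.
rewrite -{1}(ccoordE x); apply/is_path_cmap/cube_path_line; last exact: cube_one.
exact: ccoord_cube.
Qed.

(** An edge path with straight tails, since the ends of a path need not be vertices. *)
Definition lasso x (p : seq (oedge X)) y : R -> X :=
  concat_fun (to_vertex x) (concat_fun (realize (vertex_near x) p) (reverse_path (to_vertex y))).

Lemma is_path_lasso x p y : edge_path (vertex_near x) p (vertex_near y) ->
  is_path x (lasso x p y) y.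
Proof.
move=> ep; apply: is_path_cat (is_path_to_vertex x) (is_path_cat (is_path_realize ep) _).
exact/is_reverse_path/is_path_to_vertex.
Qed.

Lemma lasso_homotopic x p q y : edge_path (vertex_near x) p (vertex_near y) ->
  path_homotopic (realize (vertex_near x) p) (realize (vertex_near x) q) ->
  path_homotopic (lasso x p y) (lasso x q y).
Proof.
move=> ep pq; have pp := is_path_realize ep; have px := is_path_to_vertex x.
have py' := is_reverse_path (is_path_to_vertex y).
apply: (path_homotopic_catr px (is_path_cat pp py')).
exact: path_homotopic_catl pp py' pq.
Qed.

Lemma lasso_cat x p y q z : edge_path (vertex_near x) p (vertex_near y) ->
  edge_path (vertex_near y) q (vertex_near z) ->
  path_homotopic (concat_fun (lasso x p y) (lasso y q z)) (lasso x (p ++ q) z).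
Proof.
move=> ep eq.
have px := is_path_to_vertex x; have py := is_path_to_vertex y; have pz := is_path_to_vertex z.
have py' := is_reverse_path py; have pz' := is_reverse_path pz.
have pp := is_path_realize ep; have pq := is_path_realize eq.
have ppq := is_path_realize (edge_path_cat ep eq).
have pyz := is_path_cat py (is_path_cat pq pz').
apply: path_homotopic_trans (path_homotopic_sym (path_catA px (is_path_cat pp py') pyz)) _.
apply: (path_homotopic_catr px (is_path_cat (is_path_cat pp py') pyz)).
apply: path_homotopic_trans (path_homotopic_sym (path_catA pp py' pyz)) _.
apply: (@path_homotopic_trans _ _ (concat_fun (realize (vertex_near x) p)
    (concat_fun (realize (vertex_near y) q) (reverse_path (to_vertex z))))).
  apply: (path_homotopic_catr pp (is_path_cat py' pyz)).
  apply: path_homotopic_trans (path_catA py' py (is_path_cat pq pz')) _.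
  apply: path_homotopic_trans (path_1cat (is_path_cat pq pz')).
  apply: (path_homotopic_catl (is_path_cat py' py) (is_path_cat pq pz')).
  exact: path_rev_cat py.
apply: path_homotopic_trans (path_catA pp pq pz') _.
apply: (path_homotopic_catl (is_path_cat pp pq) pz').
exact: path_homotopic_sym (realize_cat ep eq).
Qed.

Definition cellular x (f : R -> X) y :=
  exists2 p, edge_path (vertex_near x) p (vertex_near y) & path_homotopic f (lasso x p y).

Lemma cellular_homotopic x f y g : path_homotopic f g -> cellular x g y -> cellular x f y.
Proof. by move=> fg [p ep gp]; exists p => //; exact: path_homotopic_trans fg gp. Qed.

Lemma cellular_cat x f y g z : is_path x f y -> is_path y g z ->
  cellular x f y -> cellular y g z -> cellular x (concat_fun f g) z.
Proof.
move=> [_ _ f1] [_ g0 _] [p ep fp] [q eq gq]; exists (p ++ q); first exact: edge_path_cat ep eq.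
apply: path_homotopic_trans (lasso_cat ep eq); apply: path_homotopic_cat fp gq.
by rewrite f1 g0.
Qed.

(** The carrier of [x] is a face of any cube over [x], so the straight tail is a segment there
    too. *)
Lemma to_vertex_cell n (d : cell X n) (z : 'rV[R]_n) x : cube z -> cmap d z = x ->
  exists2 s : 'I_n -> bool, cmap d (corner_row s) = vertex_near x &
    forall t, t \in `[0, 1] -> (cmap d \o line z (corner_row s)) t = to_vertex x t.
Proof.
move=> cz zx; have [F [fF zE]] := carrier_face cz zx.
have sE : corner_row (fun j => (F j).2) = face_embed F (const_mx 1).
  by apply/rowP => j; rewrite !mxE; case: (F j).1 => [i|] /=; rewrite ?mxE mulr1.
exists (fun j => (F j).2); first by rewrite sE fF.2//; exact: cube_one.
move=> t tI; rewrite /= sE -zE /line -face_embed_segment fF.2//.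
by apply: segment_cube => //; [exact: ccoord_cube|exact: cube_one].
Qed.

Lemma cellular_cube n (d : cell X n) (y : 'rV[R]_n) a (z : 'rV[R]_n) : cube_path y a z ->
  cellular (cmap d y) (cmap d \o a) (cmap d z).
Proof.
move=> ca; have [[_ a0 a1] cua] := ca.
have cy : cube y by rewrite -a0; apply: cua; exact: mem01_0.
have cz : cube z by rewrite -a1; apply: cua; exact: mem01_1.
have [s sx sl] := to_vertex_cell (d := d) cy erefl; have [s' sy sl'] := to_vertex_cell (d := d) cz erefl.
have [p] := corner_walk d s s'; rewrite sx sy => ep hp.
exists p => //; set x := cmap d y in sx sl ep hp *; set w := cmap d z in sy sl' ep hp *.
have l1 := cube_path_line cy (corner_cube s); have l3 := cube_path_line cz (corner_cube s').
have l2 := cube_path_line (corner_cube s) (corner_cube s').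
apply: (@path_homotopic_trans _ _ (cmap d \o concat_fun (line y (corner_row s))
    (concat_fun (line (corner_row s) (corner_row s')) (reverse_path (line z (corner_row s')))))).
  apply: cmap_homotopic ca _.
  exact: cube_path_cat l1 (cube_path_cat l2 (cube_path_reverse l3)).
rewrite !cmap_concat.
have p1 := is_path_cmap d l1; have p2 := is_path_cmap d l2.
have p3 := is_path_cmap d (cube_path_reverse l3).
have px := is_path_to_vertex x; have pw := is_path_to_vertex w.
apply: path_homotopic_cat.
- by case: p1 => _ _ ->; rewrite concat_fun0; case: p2.
- by apply: path_homotopic_ext => //; case: p1.
apply: path_homotopic_cat.
- by case: p2 => _ _ ->; case: p3.
- exact: path_homotopic_sym.
apply: path_homotopic_ext; first by case: p3.
by move=> t /in01P [? ?]; apply: sl'; apply/in01P; split; lra.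
Qed.

(** Meant for homotopies that move the end points: [H (s, 0)] and [H (s, 1)] are their tracks. *)
Lemma square_homotopic (T : topologicalType) (H : R * R -> T) :
  {within `[0, 1] `*` `[0, 1], continuous H} ->
  path_homotopic (fun t => H (0, t)) (concat_fun (fun s => H (s, 0))
    (concat_fun (fun t => H (1, t)) (reverse_path (fun s => H (s, 1))))).
Proof.
move=> cH.
pose e1 (t : R) : R * R := (t, 0); pose e2 (t : R) : R * R := (1, t).
pose e3 (t : R) : R * R := (1 - t, 1).
have c1 : @is_path R (R * R)%type (0, 0) e1 (1, 0).
  by split=> //; apply: continuous_subspaceT; apply: cts_pair => x; [exact: cvg_id|exact: cvg_cst].
have c2 : @is_path R (R * R)%type (1, 0) e2 (1, 1).
  by split=> //; apply: continuous_subspaceT; apply: cts_pair => x; [exact: cvg_cst|exact: cvg_id].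
have c3 : @is_path R (R * R)%type (1, 1) e3 (0, 1).
  split; rewrite /e3 ?subr0 ?subrr//.
  apply: continuous_subspaceT; apply: cts_pair => x; last exact: cvg_cst.
  by apply: cvgB; [exact: cvg_cst|exact: cvg_id].
have [cb b0 b1] := is_path_cat c1 (is_path_cat c2 c3).
apply: (@convex_homotopic _ _ (R^o * R^o)%type (`[0, 1] `*` `[0, 1])%classic H
  (fun t => (0, t)) _ _ _ cH _ cb).
- by apply: continuous_subspaceT; apply: cts_pair => x; [exact: cvg_cst|exact: cvg_id].
- move=> s t /in01P [s0 s1] /in01P [t0 t1].
  rewrite /concat_fun /e1 /e2 /e3; do 2?case: ifPn; rewrite -?ltNge => *;
    split; rewrite /= /GRing.scale /= in_itv /=; apply/andP; split; nra.
- by rewrite b0.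
- by rewrite b1.
- by [].
- by move=> t _; rewrite /concat_fun /reverse_path /e1 /e2 /e3; case: ifP => // _; case: ifP.
Qed.

(** The contraction shrinks [f] to [p] while the end points move along tracks that each stay in one
    cube, where [cellular_cube] applies. *)
Lemma cellular_star p x f y : is_path x f y ->
  (forall t, t \in `[0, 1] -> star p (f t)) -> cellular x f y.
Proof.
move=> [cf f0 f1] sf.
have sx : star p x by rewrite -f0; apply: sf; exact: mem01_0.
have sy : star p y by rewrite -f1; apply: sf; exact: mem01_1.
have H := square_homotopic (contract_path_cts cf sf).
have track q : star p q ->
    [/\ cellular q (contract p q) p, cellular p (reverse_path (contract p q)) q &
        is_path q (contract p q) p].
  move=> sq; have [c0 y0p _] := star_coordP sq.
  have l := cube_path_line (ccoord_cube q) c0.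
  split.
  - by have := cellular_cube (ccell q) l; rewrite ccoordE y0p.
  - by have := cellular_cube (ccell q) (cube_path_reverse l); rewrite ccoordE y0p.
  - by have := is_path_cmap (ccell q) l; rewrite ccoordE y0p.
have [cx _ px] := track x sx; have [_ cy py] := track y sy.
have py' := is_reverse_path py.
apply: (@cellular_homotopic _ _ _ (concat_fun (contract p x) (reverse_path (contract p y)))); last first.
  exact: cellular_cat px py' cx cy.
apply: (@path_homotopic_trans _ _ (concat_fun (contract p x)
    (concat_fun (fun=> p) (reverse_path (contract p y))))); last first.
  apply: (path_homotopic_catr px (is_path_cat (is_path_cst p) py')).
  exact: path_1cat py'.
apply: (@path_homotopic_trans _ _ (fun t => contract p (f t) 0)).
  by apply: path_homotopic_ext => // t _; rewrite contract0.
move: H; rewrite /= f0 f1; move=> H; apply: path_homotopic_trans H _.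
have pc : is_path p (fun t => contract p (f t) 1) p.
  apply: (is_path_homotopic (is_path_cst p)); apply: path_homotopic_ext.
    by case: (is_path_cst p).
  by move=> t tI; rewrite contract1//; exact: sf.
have pE : path_homotopic (fun t => contract p (f t) 1) (fun=> p).
  apply: path_homotopic_ext; first by case: pc.
  by move=> t tI; rewrite contract1//; exact: sf.
apply: (path_homotopic_catr px (is_path_cat pc py')).
exact: path_homotopic_catl pc py' pE.
Qed.

Lemma cellular_path x f y : is_path x f y -> cellular x f y.
Proof.
move=> [cf f0 f1].
have [||N [N0 gf]] := good_subdivision_exists (U := @star R X) _ _ cf.
- by move=> p; exact: star_open.
- by move=> p; exists p; exact: star_center.
have nN : N%:R / N%:R = 1 :> R by rewrite divff// pnatr_eq0 -lt0n.
have le j k : (j <= k)%N -> j%:R / N%:R <= k%:R / N%:R :> R.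
  by move=> jk; rewrite ler_wpM2r ?invr_ge0 ?ler0n ?ler_nat.
have le0 j : 0 <= j%:R / N%:R :> R by rewrite mulr_ge0 ?invr_ge0 ?ler0n.
suff H j : (j <= N)%N -> cellular x (path_between f 0 (j%:R / N%:R)) (f (j%:R / N%:R)).
  by have := H N (leqnn N); rewrite nN path_between01 f1.
elim: j => [_|j IH jN].
  rewrite mul0r f0; apply: (@cellular_homotopic _ _ _ (cmap (ccell x) \o (fun=> ccoord x))).
    apply: path_homotopic_ext.
      by have [] := is_path_between cf (lexx 0) (lexx 0) ler01.
    by move=> t _; rewrite /path_between subrr mul0r add0r f0 /= ccoordE.
  have cc : cube_path (ccoord x) (fun _ : R => ccoord x) (ccoord x).
    split; first by split=> //; apply: continuous_subspaceT => ?; exact: cvg_cst.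
    by move=> t _; exact: ccoord_cube.
  by have := cellular_cube (ccell x) cc; rewrite ccoordE.
have j1 : j.+1%:R / N%:R <= 1 :> R by have := le _ _ jN; rewrite nN.
have jj := le _ _ (leqnSn j).
have p1 := is_path_between cf (lexx 0) (le0 j) (le_trans jj j1).
have p2 := is_path_between cf (le0 j) jj j1.
apply: cellular_homotopic (path_homotopic_sym (path_between_cat cf (lexx 0) (le0 j) jj j1)) _.
rewrite f0 in p1; apply: (cellular_cat p1 p2 (IH (ltnW jN))).
have [p Hp] := gf j jN; apply: (cellular_star p2) => t /in01P [t0 t1].
by rewrite /path_between; apply: Hp; apply/andP; split; nra.
Qed.

End EdgePaths.

(** * Hyperplanes of a special cube complex *)

Section Hyperplanes.
Context {R : realType} (X : cubeComplex R).
Local Notation sgb := (@sgb R).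
Local Notation oedge := (oedge X).
Local Notation edge_path := (@edge_path X oedge (@origin R X) (@terminus R X)).
Implicit Types (x y : X) (a b : oedge) (e f : cell X 1) (h : set (cell X 1)).

Lemma row_cube n (s : 'I_n -> bool) k (t : R) : -1 <= t <= 1 ->
  cube (\row_j if j == k then - sgb (s j) * t else sgb (s j)).
Proof.
move=> t1; apply/cubeP => j; rewrite mxE; case: ifP => _; last by rewrite normr_sgb.
by rewrite mulNr normrN normrM normr_sgb mul1r ler_norml.
Qed.

Lemma corner_edgeE n (k : corner X n) i a : corner_edge k i a <-> issues k.1 k.2 i a.
Proof. by []. Qed.

Definition flip n (s : 'I_n -> bool) k j := if j == k then ~~ s j else s j.

Lemma issues_rev n (d : cell X n) (s s' : 'I_n -> bool) k a : issues d s k a ->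
  s' k = ~~ s k -> (forall j, j != k -> s' j = s j) -> issues d s' k (oedge_rev a).
Proof.
move=> H s'k s'j t t1; have -> : oedge_map (oedge_rev a) t = oedge_map a (- t).
  by rewrite /oedge_map /=; congr (cmap _ (const_mx _)); case: a.2; rewrite /Defs.sgb /=; ring.
rewrite -H; last by case/andP: t1 => ? ?; apply/andP; split; lra.
congr (cmap d); apply/rowP => j; rewrite !mxE; case: eqVneq => [->|/s'j ->//].
by rewrite s'k; case: (s k); rewrite /Defs.sgb /=; ring.
Qed.

Lemma issues_ext n (d : cell X n) (s s' : 'I_n -> bool) k a : issues d s k a ->
  s =1 s' -> issues d s' k a.
Proof. by move=> H ss' t t1; rewrite -H//; congr (cmap d); apply/rowP => j; rewrite !mxE ss'. Qed.

Lemma flip_same n (s : 'I_n -> bool) k : flip s k k = ~~ s k.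
Proof. by rewrite /flip eqxx. Qed.

Lemma flip_other n (s : 'I_n -> bool) k j : j != k -> flip s k j = s j.
Proof. by move=> jk; rewrite /flip (negbTE jk). Qed.

Lemma issues_flip n (d : cell X n) (s : 'I_n -> bool) k a : issues d s k a ->
  [/\ origin a = cmap d (corner_row s), terminus a = cmap d (corner_row (flip s k)) &
    forall t, t \in `[0, 1] ->
      edge_map a t = (cmap d \o line (corner_row s) (corner_row (flip s k))) t].
Proof. by move=> H; apply: issues_ends H (flip_same s k) _ => j; exact: flip_other. Qed.

(* The corner of a square with sign [u] in direction [i], [v] in the other. *)
Definition square_corner (i : 'I_2) (u v : bool) (j : 'I_2) := if j == i then u else v.

Lemma ord2_neq (i j l : 'I_2) : i != j -> l != i -> l = j.
Proof.
move=> ij li; apply: val_inj; move: ij li; rewrite -!val_eqE /=.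
by case: i j l => [[|[|i]] Hi] [[|[|j]] Hj] [[|[|l]] Hl].
Qed.

Lemma square_side_issues (q : cell X 2) i v a : square_side q i v a ->
  issues q (square_corner i false v) i a.
Proof.
move=> H t t1; rewrite -H//; congr (cmap q); apply/rowP => j; rewrite !mxE /square_corner.
by case: (_ == i) => //; rewrite /Defs.sgb opprK mul1r.
Qed.

Lemma issues_square_side (q : cell X 2) (s : 'I_2 -> bool) i j a : i != j -> issues q s i a ->
  square_side q i (s j) (if s i then oedge_rev a else a).
Proof.
move=> ij H.
have H' : issues q (square_corner i false (s j)) i (if s i then oedge_rev a else a).
  case si : (s i); first apply: (issues_rev H); last apply: (issues_ext H).
  - by rewrite si /square_corner eqxx.
  - by move=> l li; rewrite /square_corner (negbTE li) (ord2_neq ij li).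
  - move=> l; rewrite /square_corner; case: eqVneq => [->//|li].
    by rewrite (ord2_neq ij li).
move=> t t1; rewrite -H'//; congr (cmap q); apply/rowP => l; rewrite !mxE /square_corner.
by case: (_ == i) => //; rewrite /Defs.sgb opprK mul1r.
Qed.

Definition hyp e : set (cell X 1) := [set f | clos_refl_sym_trans _ (@opposite_edges R X) e f].

Lemma is_hyperplane_hyp e : is_hyperplane (hyp e).
Proof. by exists e. Qed.

Lemma hyp_refl e : hyp e e.
Proof. exact: rst_refl. Qed.

Lemma hyp_eq e f : hyp e f -> hyp e = hyp f.
Proof.
move=> ef; apply/seteqP; split=> g; first exact: rst_trans (rst_sym _ _ _ _ ef).
exact: rst_trans ef.
Qed.

Lemma hyperplaneE h e : is_hyperplane h -> h e -> h = hyp e.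
Proof. by move=> [f ->] fe; exact: (@hyp_eq f e fe). Qed.

Definition orientation h : cell X 1 -> bool :=
  xget (fun=> true) [set o | consistent_orientation h o].

Definition edge_label a : set (cell X 1) := hyp a.1.
Definition edge_sign a : bool := orientation (hyp a.1) a.1 == a.2.
Definition crossing h k := [/\ is_hyperplane h, is_hyperplane k & cross h k].

Lemma edge_label_rev a : edge_label (oedge_rev a) = edge_label a.
Proof. by []. Qed.

Lemma edge_sign_rev a : edge_sign (oedge_rev a) = ~~ edge_sign a.
Proof. by rewrite /edge_sign /=; case: (orientation _ _); case: a.2. Qed.

Definition edge_homotopic x p q :=
  (exists2 y, edge_path x p y & edge_path x q y) /\ path_homotopic (realize x p) (realize x q).

Lemma edge_path_end x p y y' : edge_path x p y -> edge_path x p y' -> y = y'.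
Proof. by elim: p x => [x /= <- //|a p IH x /= [_ p1] [_ p2]]; exact: IH p1 p2. Qed.

Lemma edge_homotopic_refl x p y : edge_path x p y -> edge_homotopic x p p.
Proof.
move=> ep; split; first by exists y.
by apply: path_homotopic_refl; case: (is_path_realize ep).
Qed.

Lemma edge_homotopic_sym x p q : edge_homotopic x p q -> edge_homotopic x q p.
Proof. by move=> [[y ? ?] ?]; split; [exists y|exact: path_homotopic_sym]. Qed.

Lemma edge_homotopic_trans x p q r :
  edge_homotopic x p q -> edge_homotopic x q r -> edge_homotopic x p r.
Proof.
move=> [[y xp xq] pq] [[y' xq' xr] qr]; split; last exact: path_homotopic_trans pq qr.
by exists y => //; rewrite (edge_path_end xq xq').
Qed.

Lemma edge_homotopic_cat x y p p' q q' : edge_path x p y -> edge_path x p' y ->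
  edge_homotopic x p p' -> edge_homotopic y q q' -> edge_homotopic x (p ++ q) (p' ++ q').
Proof.
move=> xp xp' [_ pp'] [[z yq yq'] qq']; split.
  by exists z; [exact: edge_path_cat xp yq|exact: edge_path_cat xp' yq'].
apply: path_homotopic_trans (realize_cat xp yq) _.
apply: path_homotopic_trans (path_homotopic_sym (realize_cat xp' yq')).
apply: path_homotopic_cat pp' qq'.
by have [_ _ ->] := is_path_realize xp; have [_ -> _] := is_path_realize yq.
Qed.

Lemma realize2 a b : terminus a = origin b :> X ->
  path_homotopic (realize (origin a) [:: a; b]) (concat_fun (edge_map a) (edge_map b)).
Proof.
move=> ab; have pb := is_path_edge b; have pa := is_path_edge a; rewrite ab in pa.
apply: (path_homotopic_catr pa (is_path_cat pb (is_path_cst _))).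
exact: path_cat1 pb.
Qed.

Lemma edge_homotopic_cancel a : edge_homotopic (origin a) [:: a; oedge_rev a] [::].
Proof.
split; first by exists (origin a) => //=; rewrite origin_rev terminus_rev.
apply: path_homotopic_trans (realize2 _) _; first by rewrite origin_rev.
by rewrite edge_map_rev; exact: path_cat_rev (is_path_edge a).
Qed.

Section Special.
Hypothesis hX : special X.

Lemma orientation_consistent e : consistent_orientation (hyp e) (orientation (hyp e)).
Proof.
have [_ ts _ _ _] := hX.
exact: (@xgetPex _ (fun=> true) [set o | consistent_orientation (hyp e) o] (ts _ (is_hyperplane_hyp e))).
Qed.

Lemma opposite_label_sign a b : opposite_oedges a b ->
  edge_label a = edge_label b /\ edge_sign a = edge_sign b.
Proof.
case: a b => e s [f t] H; have ef : hyp e f by apply: rst_step; exists s, t.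
split; first exact: hyp_eq.
have := @orientation_consistent e e f s t (hyp_refl e) ef H.
by rewrite /edge_sign /= -(hyp_eq ef).
Qed.

(** [square_side] orients sides by the increasing coordinate, so both edges are reversed when they
    issue from the positive end. *)
Lemma issues_parallel2 (q : cell X 2) (s s' : 'I_2 -> bool) i j a b : i != j ->
  issues q s i a -> issues q s' i b -> s' i = s i -> s' j = ~~ s j ->
  edge_label a = edge_label b /\ edge_sign a = edge_sign b.
Proof.
move=> ij sa sb s'i s'j.
have := @opposite_label_sign (if s i then oedge_rev a else a) (if s i then oedge_rev b else b).
have -> : edge_label (if s i then oedge_rev a else a) = edge_label a by case: ifP.
have -> : edge_label (if s i then oedge_rev b else b) = edge_label b by case: ifP.
case E : (s i).
  rewrite !edge_sign_rev => H; have [|? /negb_inj ?] := H _; last by split.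
  have A := issues_square_side ij sa; have B := issues_square_side ij sb.
  by exists q, i, (s j); rewrite -s'j; rewrite s'i E in B; rewrite E in A.
apply; have A := issues_square_side ij sa; have B := issues_square_side ij sb.
by exists q, i, (s j); rewrite -s'j; rewrite s'i E in B; rewrite E in A.
Qed.

Lemma issues_consecutive (q : cell X 2) (s : 'I_2 -> bool) i j a b : i != j ->
  issues q s i a -> issues q s j b -> consecutive_edges a.1 b.1.
Proof.
move=> ij sa sb; have A := issues_square_side ij sa.
have ji : j != i by rewrite eq_sym.
have B := issues_square_side ji sb.
exists q, i, j, (s j), (s i), (if s i then ~~ a.2 else a.2), (if s j then ~~ b.2 else b.2).
have S (c : oedge) (u : bool) : (if u then oedge_rev c else c) = (c.1, if u then ~~ c.2 else c.2).
  by case: u; case: c.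
by rewrite S in A; rewrite S in B.
Qed.

Lemma consecutive_crossing a b : consecutive_edges a.1 b.1 -> crossing (edge_label a) (edge_label b).
Proof.
move=> ab; split; try exact: is_hyperplane_hyp.
by exists a.1, b.1; split=> //; exact: hyp_refl.
Qed.

Lemma crossing_sym h k : crossing h k -> crossing k h.
Proof.
move=> [hh hk [e [f [he kf [q [i [j [s [t [b [c [ij A B]]]]]]]]]]]]; split=> //.
exists f, e; split=> //; exists q, j, i, t, s, c, b; split=> //; by rewrite eq_sym.
Qed.

Lemma crossing_irr h : ~ crossing h h.
Proof. by move=> [hh _]; have [_ _ /(_ _ hh)] := hX. Qed.

Lemma spans_corner_crossing a b : spans_corner a b -> crossing (edge_label a) (edge_label b).
Proof.
move=> [k [i [j [ij /corner_edgeE ka /corner_edgeE kb]]]].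
apply: consecutive_crossing; exact: issues_consecutive ij ka kb.
Qed.

(** Edges of one hyperplane span no corner, as no hyperplane crosses itself; two distinct ones at a
    vertex would thus self-osculate. If their sign is negative, they run against the orientation,
    and the vertex is the common terminus of the oriented edges. *)
Lemma edge_determined a b : origin a = origin b :> X -> edge_label a = edge_label b ->
  edge_sign a = edge_sign b -> a = b.
Proof.
move=> oab lab_ab sab; apply: contrapT => nab.
have nspan : ~ spans_corner a b.
  by move=> /spans_corner_crossing; rewrite lab_ab; exact: crossing_irr.
have [_ _ _ nosc _] := hX; apply: (nosc _ (is_hyperplane_hyp a.1)).
exists (orientation (hyp a.1)); split; first exact: orientation_consistent.
have ef : a.1 <> b.1.
  move=> ef; apply: nab; move: sab; rewrite /edge_sign ef.
  by case: a b ef {oab lab_ab nspan} => e s [f t] /= ->; case: (orientation _ _); case: s; case: t.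
exists a.1, b.1; split=> //; first exact: hyp_refl.
  by have := hyp_refl b.1; rewrite -[hyp b.1]/(edge_label b) -lab_ab.
have oE c : edge_label c = edge_label a ->
    (c.1, orientation (hyp a.1) c.1) = if edge_sign c then c else oedge_rev c.
  rewrite /edge_label /edge_sign => <-; case: c => g u /=.
  by case: (orientation _ _); case: u.
rewrite !oE//; case: ifP => sa; rewrite -sab sa; first by left.
right; rewrite !terminus_rev; split=> //.
have revK c : oedge_rev (oedge_rev c) = c by case: c => g u; rewrite /oedge_rev /= negbK.
by rewrite !revK.
Qed.

Lemma crossing_spans a b : origin a = origin b :> X ->
  crossing (edge_label a) (edge_label b) -> spans_corner a b.
Proof.
move=> oab cab; apply: contrapT => ns; case: (cab) => ha hb cr.
have [_ _ _ _ nint] := hX; apply: (nint _ _ ha hb).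
  by move=> e; move: cab; rewrite e; exact: crossing_irr.
by split=> //; exists a, b; split=> //; exact: hyp_refl.
Qed.

Lemma edge_square a b : origin a = origin b :> X -> crossing (edge_label a) (edge_label b) ->
  exists a' b', [/\ origin a' = terminus b :> X, origin b' = terminus a :> X,
    terminus a' = terminus b' :> X &
    [/\ edge_label a' = edge_label a, edge_sign a' = edge_sign a,
        edge_label b' = edge_label b, edge_sign b' = edge_sign b &
        edge_homotopic (origin a) [:: a; b'] [:: b; a']]].
Proof.
move=> oab /(crossing_spans oab) [[q s] [i [j [ij /corner_edgeE /= sa /corner_edgeE /= sb]]]].
have ji : j != i by rewrite eq_sym.
pose si := flip s i; pose sj := flip s j; pose sij := flip si j.
have [a' sa'] := issues_exists q sj i; have [b' sb'] := issues_exists q si j.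
have sii : si i = ~~ s i by rewrite /si /flip eqxx.
have sij' : si j = s j by rewrite /si /flip (negbTE ji).
have sjj : sj j = ~~ s j by rewrite /sj /flip eqxx.
have sji : sj i = s i by rewrite /sj /flip (negbTE ij).
have siji : sij i = ~~ s i by rewrite /sij /flip (negbTE ij).
have sijj : sij j = ~~ s j by rewrite /sij /flip eqxx sij'.
have [oa ta ea] := issues_flip sa.
have [ob tb eb] := issues_flip sb.
have [|l li|oa' ta' ea'] := @issues_ends R X _ q sj sij i a' sa'.
- by rewrite siji sji.
- by rewrite (ord2_neq ij li) sijj sjj.
have [|l lj|ob' tb' eb'] := @issues_ends R X _ q si sij j b' sb'.
- by rewrite sijj sij'.
- by rewrite (ord2_neq ji lj) siji sii.
have [la pa] := issues_parallel2 ij sa sa' sji sjj.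
have [lb pb] := issues_parallel2 ji sb sb' sij' sii.
exists a', b'; split; rewrite ?oa' ?tb ?ob' ?ta ?ta' ?tb'//; split=> //.
(* Two consecutive sides of the square are homotopic to its diagonal; both ways around are compared
   with it. *)
have hab c c' (s1 s2 s3 : 'I_2 -> bool) : terminus c = origin c' :> X ->
    (forall t, t \in `[0, 1] -> edge_map c t = (cmap q \o line (corner_row s1) (corner_row s2)) t) ->
    (forall t, t \in `[0, 1] -> edge_map c' t = (cmap q \o line (corner_row s2) (corner_row s3)) t) ->
    path_homotopic (realize (origin c) [:: c; c']) (cmap q \o line (corner_row s1) (corner_row s3)).
  move=> cc' cE cE'; apply: path_homotopic_trans (realize2 cc') _.
  have l1 := cube_path_line (@corner_cube R _ s1) (@corner_cube R _ s2).
  have l2 := cube_path_line (@corner_cube R _ s2) (@corner_cube R _ s3).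
  apply: (@path_homotopic_trans _ _ (cmap q \o concat_fun (line (corner_row s1) (corner_row s2))
      (line (corner_row s2) (corner_row s3)))); last first.
    apply: cmap_homotopic; first exact: cube_path_cat l1 l2.
    exact: cube_path_line (@corner_cube R _ s1) (@corner_cube R _ s3).
  rewrite cmap_concat; have [c1 _ e1] := is_path_edge c; have [c2 e2 _] := is_path_edge c'.
  by apply: path_homotopic_cat; [rewrite e1 e2|exact: path_homotopic_ext|exact: path_homotopic_ext].
split; first by exists (terminus b'); rewrite /= ?ob' ?ta ?oa' ?tb ?ta' ?tb' ?oab.
apply: path_homotopic_trans (hab _ _ _ _ _ _ ea eb') _; first by rewrite ob' ta.
rewrite oab; apply: path_homotopic_sym; apply: hab eb ea' => //; by rewrite oa' tb.
Qed.

Lemma edge_corner h k : crossing h k ->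
  exists a b, [/\ origin a = origin b :> X, edge_label a = h & edge_label b = k].
Proof.
move=> [hh hk [e [f [he kf [q [i [j [s [t [u [v [ij A B]]]]]]]]]]]].
have ji : j != i by rewrite eq_sym.
have start l m w c (z : bool) : l != m -> square_side q l w c ->
    exists2 c', issues q (square_corner l z w) l c' & c'.1 = c.1.
  move=> lm /square_side_issues H; case: z; last by exists c.
  exists (oedge_rev c) => //; apply: (issues_rev H); first by rewrite /square_corner eqxx.
  by move=> n nl; rewrite /square_corner (negbTE nl).
(* The side along [i] has [j]-th sign [s], the side along [j] has [i]-th sign [t]; they meet in the
   corner with these two signs. *)
have [a sa ae] := start i j s (e, u) t ij A; have [b sb bf] := start j i t (f, v) s ji B.
have sb' : issues q (square_corner i t s) j b.
  apply: (issues_ext sb) => l; rewrite /square_corner; case: (eqVneq l j) => [->|lj].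
    by rewrite (negbTE ji).
  by rewrite (ord2_neq ji lj) eqxx.
exists a, b; rewrite /edge_label ae bf; split.
- have [-> _ _] := issues_flip sa; by have [-> _ _] := issues_flip sb'.
- by rewrite -(hyperplaneE hh he).
- by rewrite -(hyperplaneE hk kf).
Qed.

End Special.
End Hyperplanes.

(** * Hyperplanes dual to the directions of a cube *)

Section Labels.
Context {R : realType} (X : cubeComplex R).
Local Notation sgb := (@sgb R).
Local Notation oedge := (oedge X).
Local Notation edge_path := (@edge_path X oedge (@origin R X) (@terminus R X)).
Implicit Types (x y : X) (a b : oedge) (e f : cell X 1) (h : set (cell X 1)).
Hypothesis hX : special X.

Lemma square_side_corner (q : cell X 2) i v a (z : bool) : square_side q i v a ->
  issues q (square_corner i z v) i (if z then oedge_rev a else a).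
Proof.
move=> /square_side_issues H; case: z; last by [].
apply: (issues_rev H); first by rewrite /square_corner eqxx.
by move=> l li; rewrite /square_corner (negbTE li).
Qed.

Lemma other_ord2 (i : 'I_2) : exists j, i != j.
Proof. by case: i => [[|[|]]] // Hi; [exists ord_max|exists ord0]. Qed.

Lemma oedge_signE e (s s0 : bool) :
  (e, s) = (if s != s0 then oedge_rev (e, s0) else (e, s0)) :> oedge.
Proof. by case: s; case: s0. Qed.

Lemma sign_diff (o o' s s0 t t0 : bool) :
  (o == s) = (o' == t) -> (o == s0) = (o' == t0) -> (s != s0) = (t != t0).
Proof. by move: o o' s s0 t t0; do 6!case. Qed.

(** Induction over the equivalence relation generated by opposite edges. For opposite sides of a
    square the path is the side joining their origins, whose hyperplane crosses theirs. *)
Lemma edge_parallel a b : edge_label a = edge_label b -> edge_sign a = edge_sign b ->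
  exists2 p, edge_path (origin a) p (origin b) &
    forall l, l \in map (@edge_label R X) p -> crossing (edge_label a) l.
Proof.
move=> lab_ab; have : hyp a.1 b.1.
  by have := hyp_refl b.1; rewrite -[hyp b.1]/(edge_label b) -lab_ab.
suff H e f : hyp e f -> forall s t, edge_sign (e, s) = edge_sign (f, t) ->
    exists2 p, edge_path (origin (e, s)) p (origin (f, t)) &
      forall l, l \in map (@edge_label R X) p -> crossing (hyp e) l.
  by move=> /H {}H sab; have := H a.2 b.2; rewrite -!surjective_pairing; apply.
move=> {a b lab_ab}; elim => {e f}[e f [s0 [t0 opp]]|e|e f ef IH|e f g ef IH fg IH'] s t.
- have [le se] := opposite_label_sign hX opp; have [q [i [v [A B]]]] := opp.
  have [j ij] := other_ord2 i; pose z := s != s0 => st.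
  have sE : (e, s) = (if z then oedge_rev (e, s0) else (e, s0)) :> oedge.
    exact: oedge_signE.
  have tE : (f, t) = (if z then oedge_rev (f, t0) else (f, t0)) :> oedge.
    by rewrite (oedge_signE f t t0) /z (sign_diff st se).
  have iA := square_side_corner z A; have iB := square_side_corner z B.
  rewrite -sE in iA; rewrite -tE in iB.
  have [c ic] := issues_exists q (square_corner i z v) j.
  have fi u w l : l != i -> square_corner i (~~ u) w l = square_corner i u w l.
    by move=> li; rewrite /square_corner (negbTE li).
  have ii u w : square_corner i (~~ u) w i = ~~ square_corner i u w i.
    by rewrite /square_corner eqxx.
  have [oe _ _] := issues_ends iA (ii z v) (fi z v).
  have [of_ _ _] := issues_ends iB (ii z (~~ v)) (fi z (~~ v)).
  have [|l lj|oc tc _] := @issues_ends _ _ _ _ _ (square_corner i z (~~ v)) _ _ ic.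
  + by rewrite /square_corner eq_sym (negbTE ij).
  + by rewrite /square_corner; have -> : l = i by [apply: (ord2_neq _ lj); rewrite eq_sym]; rewrite eqxx.
  exists [:: c]; first by rewrite /= oc tc oe of_.
  move=> l; rewrite inE => /eqP ->.
  by have := issues_consecutive ij iA ic; exact: (@consecutive_crossing _ _ (e, s) c).
- move=> st; exists [::] => //=; congr (origin (_, _)); move: st; rewrite /edge_sign /=.
  by case: (orientation _ _); case: s; case: t.
- move=> st; have [p ep cp] := IH _ _ (esym st).
  exists (inv_path (@oedge_rev R X) p).
    by apply: (edge_path_inv (@origin_rev R X) (@terminus_rev R X)).
  move=> l; rewrite /inv_path map_rev mem_rev -map_comp => lp.
  by rewrite -(hyp_eq ef); apply: cp; move: lp; congr (_ \in _); apply: eq_map.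
(* The direction of the intermediate edge [f] that gives it the sign of [(e, s)]. *)
- move=> st; pose u := edge_sign (e, s) == orientation (hyp f) f.
  have su : edge_sign (e, s) = edge_sign (f, u).
    by rewrite /u /edge_sign /=; case: (orientation (hyp f) f); case: (_ == s).
  have ut : edge_sign (f, u) = edge_sign (g, t) by rewrite -su.
  have [p ep cp] := IH _ _ su; have [p' ep' cp'] := IH' _ _ ut.
  exists (p ++ p'); first exact: edge_path_cat ep ep'.
  move=> l; rewrite map_cat mem_cat => /orP [/cp//|/cp'].
  by rewrite -(hyp_eq ef).
Qed.

(** An oriented edge is recovered from one interior point. The parameter 1/2 is off centre, because
    the midpoint, at 0, does not see the direction. *)
Lemma issues_inj n (d : cell X n) (s : 'I_n -> bool) j a b :
  issues d s j a -> issues d s j b -> a = b.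
Proof.
move=> sa sb.
have half : -1 <= (2^-1 : R) <= 1 by apply/andP; split; lra.
have e : oedge_map a 2^-1 = oedge_map b 2^-1 by rewrite -sa// -sb.
have op (c : oedge) : open_cube (const_mx (sgb c.2 * 2^-1) : 'rV[R]_1).
  by apply/open_cubeP => i; rewrite mxE normrM normr_sgb mul1r ger0_norm ?invr_ge0//; lra.
pose P m : cell X m -> 'rV[R]_m -> Prop :=
  match m with
  | 1%N => fun g z => g = a.1 /\ z = const_mx (sgb a.2 * 2^-1)
  | _ => fun _ _ => True
  end.
have [ab /rowP/(_ 0)] : P 1%N b.1 (const_mx (sgb b.2 * 2^-1)).
  exact: (@open_cell_ind _ _ P _ _ _ _ _ _ (op a) (op b) e (conj erefl erefl)).
rewrite !mxE => E.
have h2 : (2^-1 : R) != 0 by rewrite invr_eq0 pnatr_eq0.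
by move/(mulIf h2)/sgb_inj: E; case: a b ab {sa sb e op P} => ? ? [? ?] /= -> ->.
Qed.

(** The centre of this face has exactly two free coordinates, so its open face is a square. *)
Lemma square_face n (d : cell X n) (s : 'I_n -> bool) j k : j != k ->
  exists (q : cell X 2) F i i', [/\ is_face_of d q F, i != i', (F j).1 = Some i,
    (F k).1 = Some i' & forall l, (F l).1 = None -> (F l).2 = s l].
Proof.
move=> jk; pose z : 'rV[R]_n := \row_l if (l == j) || (l == k) then 0 else sgb (s l).
have cz : cube z by apply/cubeP => l; rewrite mxE; case: ifP; rewrite ?normr0 ?normr_sgb.
have [m [g [F [z0 [fF oz0 zE]]]]] := open_face d cz.
have Fn l : (F l).1 = None <-> (l != j) && (l != k).
  rewrite (face_const F l oz0) zE mxE -negb_or; case: (_ || _) => /=.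
    by split=> // /esym/eqP; rewrite normr0 oner_eq0.
  by rewrite normr_sgb.
have Fs l : (F l).1 = None -> (F l).2 = s l.
  move=> Fl; have /Fn := Fl; rewrite -negb_or => /negbTE lE.
  have := congr1 (fun w : 'rV[R]_n => w 0 l) zE.
  by rewrite /z !mxE lE Fl /= mulr1 => /sgb_inj.
case Fj : (F j).1 => [i|]; last by have /Fn := Fj; rewrite eqxx.
case Fk : (F k).1 => [i'|]; last by have /Fn := Fk; rewrite eqxx andbF.
have ii' : i != i'.
  by apply: contra_neq jk => e; rewrite e in Fj; exact: fF.1.2 Fj Fk.
have all u : u = i \/ u = i'.
  have [l Fl] := fF.1.1 u; have [lj|lj] := eqVneq l j.
    by left; move: Fl; rewrite lj Fj => -[].
  have [lk|lk] := eqVneq l k.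
    by right; move: Fl; rewrite lk Fk => -[].
  by have : (F l).1 = None by [apply/Fn; rewrite lj lk]; rewrite Fl.
have m2 : m = 2%N.
  have : #|[set: 'I_m]%SET| = #|[set i; i']%SET|.
    congr (#|pred_of_set _|); apply/setP => u; rewrite !inE.
    by case: (all u) => ->; rewrite eqxx ?orbT.
  by rewrite cardsT card_ord cards2 ii'.
by subst m; exists g, F, i, i'.
Qed.

Lemma issues_face m n (d : cell X n) (g : cell X m) F (s : 'I_n -> bool) (u : 'I_m -> bool) j i a :
  is_face_of d g F -> (F j).1 = Some i ->
  (forall l, (F l).1 = None -> (F l).2 = s l) ->
  (forall l i', (F l).1 = Some i' -> u i' = ((F l).2 == s l)) ->
  issues d s j a <-> issues g u i a.
Proof.
move=> fF Fj Fn Fu.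
have E (t : R) : -1 <= t <= 1 ->
    cmap d (\row_l if l == j then - sgb (s l) * t else sgb (s l)) =
    cmap g (\row_l if l == i then - sgb (u l) * t else sgb (u l)).
  move=> t1; rewrite -fF.2; last exact: row_cube.
  congr (cmap d); apply/rowP => l; rewrite !mxE; case Fl : (F l).1 => [i'|] /=.
    rewrite mxE (Fu _ _ Fl) sgb_eq; have [li|li] := eqVneq l j.
      have -> : i' = i by move: Fl; rewrite li Fj => -[].
      by rewrite eqxx; case: (F l).2; rewrite /Defs.sgb; ring.
    rewrite ifF ?mulrA ?sgb_sq ?mul1r//; apply/eqP => e; move/eqP: li; apply.
    by rewrite e in Fl; exact: fF.1.2 Fl Fj.
  rewrite Fn// mulr1 ifF//; apply/eqP => e; by rewrite e Fj in Fl.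
by split=> H t t1; [rewrite -E// H|rewrite E// H].
Qed.

(** Parallel edges are compared through the corners [tau k], which change one sign at a time; each
    change passes between opposite sides of a 2-dimensional face. *)
Lemma issues_label n (d : cell X n) (s s' : 'I_n -> bool) j a a' :
  issues d s j a -> issues d s' j a' -> s j = s' j ->
  edge_label a = edge_label a' /\ edge_sign a = edge_sign a'.
Proof.
move=> sa sa' sj; pose tau k (l : 'I_n) := if (l < k)%N then s' l else s l.
suff H k b : (k <= n)%N -> issues d (tau k) j b ->
    edge_label a = edge_label b /\ edge_sign a = edge_sign b.
  apply: (H n) => //; apply: (issues_ext sa') => l; by rewrite /tau ltn_ord.
elim: k b => [|k IH] b kn tb; first by rewrite (issues_inj sa tb).
have [c tc] := issues_exists d (tau k) j.
have [la lc] := IH c (ltnW kn) tc; rewrite la lc; pose k' := Ordinal kn.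
have off l : l != k' -> tau k.+1 l = tau k l.
  move=> lk; rewrite /tau ltnS leq_eqVlt (_ : (_ == _ :> nat) = false)//.
  by apply: contra_neqF lk => /eqP lk; apply: val_inj.
have [same|diff] := eqVneq (tau k.+1 k') (tau k k').
  rewrite (issues_inj tc (b := b))//; apply: (issues_ext tb) => l.
  by have [->|/off] := eqVneq l k'.
have jk : j != k'.
  apply: contra_neq diff => <-; rewrite /tau; by do 2?case: ifP.
have [q [F [i [i' [fF ii' Fj Fk Fn]]]]] := square_face d (tau k) jk.
have Fn' l : (F l).1 = None -> (F l).2 = tau k.+1 l.
  move=> Fl; rewrite Fn// off//; apply/eqP => e; by rewrite e Fk in Fl.
have [sel selP] := choice fF.1.1.
have selE l w : (F l).1 = Some w -> sel w = l by move=> Fl; exact: fF.1.2 (selP w) Fl.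
pose u t (w : 'I_2) := (F (sel w)).2 == tau t (sel w).
have uP t l w : (F l).1 = Some w -> u t w = ((F l).2 == tau t l) by move=> /selE <-.
have /(issues_face c fF Fj Fn (uP k)) qc := tc.
have /(issues_face b fF Fj Fn' (uP k.+1)) qb := tb.
apply: (issues_parallel2 hX ii' qc qb).
  by rewrite !(uP _ _ _ Fj) off.
by rewrite !(uP _ _ _ Fk); move: diff; case: (tau k.+1 k'); case: (tau k k'); case: (F k').2.
Qed.

Definition cell_edge n (d : cell X n) (j : 'I_n) : oedge :=
  proj1_sig (cid (issues_exists d (fun=> false) j)).

Definition cell_label n (d : cell X n) j := edge_label (cell_edge d j).
Definition cell_sign n (d : cell X n) j := edge_sign (cell_edge d j).

Lemma cell_edgeP n (d : cell X n) j : issues d (fun=> false) j (cell_edge d j).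
Proof. exact: (proj2_sig (cid (issues_exists d (fun=> false) j))). Qed.

Lemma issues_cell_label n (d : cell X n) s j a : issues d s j a ->
  edge_label a = cell_label d j /\ edge_sign a = (cell_sign d j == ~~ s j).
Proof.
move=> sa; case sj : (s j) => /=.
  have [||le] := @issues_label _ _ (flip s j) _ _ (oedge_rev a) _ _ (cell_edgeP d j).
  - apply: (issues_rev sa); first by rewrite /flip eqxx.
    by move=> l lj; rewrite /flip (negbTE lj).
  - by rewrite /flip eqxx sj.
  by rewrite edge_sign_rev /cell_sign => <-; split=> //; case: (edge_sign a).
have [//|-> ->] := issues_label sa (cell_edgeP d j).
by split=> //; rewrite /cell_sign; case: (edge_sign _).
Qed.

Lemma face_cell_label m n (d : cell X n) (g : cell X m) F j i :
  is_face_of d g F -> (F j).1 = Some i ->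
  cell_label d j = cell_label g i /\ cell_sign d j = (cell_sign g i == (F j).2).
Proof.
move=> fF Fj; have ga := cell_edgeP g i.
(* The corner of [d] to which [F] sends the all-negative corner of [g]. *)
pose s l := if (F l).1 is Some _ then ~~ (F l).2 else (F l).2.
have /issues_cell_label : issues d s j (cell_edge g i).
  apply/(issues_face _ fF Fj (u := fun=> false)) => // l; rewrite /s; first by move=> ->.
  by move=> i' ->; case: (F l).2.
rewrite /s Fj negbK => -[<- H]; split=> //.
by move: H; rewrite -/(cell_sign g i) => ->; case: (cell_sign d j); case: (F j).2.
Qed.

Lemma cell_label_crossing n (d : cell X n) j k : j != k ->
  crossing (cell_label d j) (cell_label d k).
Proof.
move=> jk; have [q [F [i [i' [fF ii' Fj Fk Fn]]]]] := square_face d (fun=> false) jk.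
have [sel selP] := choice fF.1.1.
have selE l w : (F l).1 = Some w -> sel w = l by move=> Fl; exact: fF.1.2 (selP w) Fl.
pose u (w : 'I_2) := (F (sel w)).2 == false.
have uP l w : (F l).1 = Some w -> u w = ((F l).2 == false) by move=> /selE <-.
have /(issues_face _ fF Fj Fn uP) qj := cell_edgeP d j.
have /(issues_face _ fF Fk Fn uP) qk := cell_edgeP d k.
by apply: consecutive_crossing; exact: issues_consecutive ii' qj qk.
Qed.

End Labels.

(** * Holonomy in the free group *)

Section Marks.
Context {R : realType} (X : cubeComplex R) (h k : set (cell X 1)).
Local Notation sgb := (@sgb R).
Local Notation oedge := (oedge X).
Local Notation edge_path := (@edge_path X oedge (@origin R X) (@terminus R X)).
Implicit Types (x y p : X) (a b : oedge).
Hypothesis hX : special X.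
Hypothesis nhk : ~ crossing h k.

Definition marked (l : set (cell X 1)) := (l == h) || (l == k).

Lemma marked_unique n (d : cell X n) i j :
  marked (cell_label d i) -> marked (cell_label d j) -> i = j.
Proof.
move=> mi mj; apply/eqP; apply: contraT => ij; exfalso.
have := cell_label_crossing d ij; move: mi mj.
by move=> /orP [] /eqP -> /orP [] /eqP -> //; try exact: crossing_irr; move/crossing_sym.
Qed.

(* Which of the two hyperplanes is dual to the open cube of [x], and the
   oriented coordinate of [x] across it. *)
Definition cell_mark n (d : cell X n) (z : 'rV[R]_n) : option (bool * R) :=
  if [pick j | marked (cell_label d j)] is Some j then
    Some (cell_label d j == h, sgb (cell_sign d j) * z 0 j) else None.

Definition mark x := cell_mark (ccell x) (ccoord x).

Lemma cell_markE n (d : cell X n) (z : 'rV[R]_n) j : marked (cell_label d j) ->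
  cell_mark d z = Some (cell_label d j == h, sgb (cell_sign d j) * z 0 j).
Proof.
move=> mj; rewrite /cell_mark; case: pickP => [i mi|/(_ j)]; last by rewrite mj.
by rewrite (marked_unique mi mj).
Qed.

Lemma cell_mark_None n (d : cell X n) (z : 'rV[R]_n) :
  (forall j, ~~ marked (cell_label d j)) -> cell_mark d z = None.
Proof. by move=> H; rewrite /cell_mark; case: pickP => // i; rewrite (negbTE (H i)). Qed.

Lemma mark_cell n (d : cell X n) (z : 'rV[R]_n) : open_cube z -> mark (cmap d z) = cell_mark d z.
Proof.
move=> oz; apply: (@open_cell_ind _ _ (fun m g w => mark (cmap d z) = cell_mark g w)
  _ _ _ _ _ _ (ccoord_open (cmap d z)) oz) => //.
exact: ccoordE.
Qed.

Lemma star_mark_Some p x u : mark p = Some u -> star p x ->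
  exists2 t, mark x = Some (u.1, t) & `|t - u.2| < 2^-1.
Proof.
rewrite {1}/mark /cell_mark; case: pickP => // i mi [<-] /star_carrier [y [cy yp /row_ballE [r0 by_]]].
have [F [fF yE]] := carrier_face cy yp.
have [j Fj] := fF.1.1 i; have [lj sj] := face_cell_label hX fF Fj.
exists (sgb (cell_sign (ccell x) j) * ccoord x 0 j).
  by rewrite /mark (cell_markE _ (j := j)) ?lj.
rewrite /= sj sgb_eq; apply: lt_le_trans (star_radius_le p); have := by_ j.
rewrite -yE mxE Fj /=; apply: le_lt_trans.
have -> : sgb (cell_sign (ccell p) i) * sgb (F j).2 * ccoord x 0 j -
    sgb (cell_sign (ccell p) i) * ccoord p 0 i =
    - (sgb (cell_sign (ccell p) i) * sgb (F j).2) * (sgb (F j).2 * ccoord p 0 i - ccoord x 0 j).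
  by case: (cell_sign _ _); case: (F j).2; rewrite /Defs.sgb; ring.
by rewrite normrM normrN normrM !normr_sgb !mul1r.
Qed.

(** The preimage of [p] has coordinate 1 or -1 in the marked direction, and [x] is less than 1/2
    away from it. *)
Lemma star_mark_None p x u : mark p = None -> star p x -> mark x = Some u -> 2^-1 < `|u.2|.
Proof.
rewrite {1}/mark /cell_mark; case: pickP => // none _ /star_carrier [y [cy yp /row_ballE [r0 by_]]].
have [F [fF yE]] := carrier_face cy yp.
rewrite /mark /cell_mark; case: pickP => // j mj [<-] /=.
rewrite normrM normr_sgb mul1r.
case Fj : (F j).1 => [i|].
  by have [lj _] := face_cell_label hX fF Fj; rewrite lj none in mj.
have y1 : `|y 0 j| = 1 by rewrite -yE; apply/(face_const F j (ccoord_open p)).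
have := lt_le_trans (by_ j) (star_radius_le p).
have := ler_normB (y 0 j - ccoord x 0 j) (- ccoord x 0 j); rewrite normrN opprK subrK y1.
lra.
Qed.

Definition generator (g : bool) : freeGroup bool := @FreeGroup bool [:: (g, true)] isT.

Definition level (u : bool * R) : freeGroup bool := if 0 <= u.2 then generator u.1 else 1%g.

(** It compares the sides of the hyperplane on which two nearby points lie. The threshold 1 matches
    star radii of at most 1/2: in the star of a marked point, coordinates differ by less than 1; in
    the star of an unmarked point, marked coordinates exceed 1/2 in absolute value, so that
    coordinates less than 1 apart have the same sign. *)
Definition jump x y : freeGroup bool :=
  match mark x, mark y with
  | Some u, Some v =>
      if (u.1 == v.1) && (`|u.2 - v.2| < 1) then ((level u)^-1 * level v)%g else 1%g
  | _, _ => 1%g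
  end.

Lemma jump_cocycle p x y z : star p x -> star p y -> star p z ->
  (jump x y * jump y z)%g = jump x z.
Proof.
move=> sx sy sz; case mp : (mark p) => [u|].
  have [t mx tx] := star_mark_Some mp sx; have [t' my ty] := star_mark_Some mp sy.
  have [t'' mz tz] := star_mark_Some mp sz; rewrite /jump mx my mz /= eqxx /=.
  have close (r s : R) : `|r - u.2| < 2^-1 -> `|s - u.2| < 2^-1 -> `|r - s| < 1.
    by rewrite !ltr_norml => /andP [? ?] /andP [? ?]; apply/andP; split; lra.
  by rewrite !close// -mulgA (mulgA (level _)) mulgV mul1g.
have trivial v w : star p v -> star p w -> jump v w = 1%g.
  move=> sv sw; rewrite /jump; case mv : (mark v) => [a|//]; case mw : (mark w) => [b|//].
  have ha := star_mark_None mp sv mv; have hb := star_mark_None mp sw mw.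
  case: eqVneq => //= ab; case: ifP => //; rewrite ltr_norml => /andP [l1 l2].
  have : (0 <= a.2) = (0 <= b.2).
    move: ha hb; case: (lerP 0 a.2) => a0; case: (lerP 0 b.2) => b0 //.
      by rewrite ger0_norm// ltr0_norm// => *; exfalso; clear mp mv mw ab; lra.
    by rewrite ltr0_norm// ger0_norm// => *; exfalso; clear mp mv mw ab; lra.
  by rewrite /level ab => ->; rewrite mulVg.
by rewrite !trivial// mulg1.
Qed.

Lemma mark_edge a (t : R) : 0 < t < 1 -> mark (edge_map a t) =
  if marked (edge_label a) then Some (edge_label a == h, sgb (edge_sign a) * (2 * t - 1)) else None.
Proof.
move=> t01; rewrite /edge_map /oedge_map mark_cell; last first.
  apply/open_cubeP => i; rewrite mxE normrM normr_sgb mul1r ltr_norml.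
  by case/andP: t01 => ? ?; apply/andP; split; lra.
have ie : issues a.1 (fun=> false) 0 (a.1, true).
  move=> s s1; rewrite /oedge_map /=; congr (cmap _ _); apply/rowP => i.
  by rewrite !mxE ord1 eqxx /Defs.sgb; ring.
have [le se] := issues_cell_label hX ie.
have la : cell_label a.1 0 = edge_label a by rewrite -le.
case: ifPn => ma.
  rewrite (cell_markE _ (j := 0)) ?la// mxE mulrA; congr (Some (_, _ * _)).
  have -> : cell_sign a.1 0 = edge_sign (a.1, true) by rewrite se; case: (cell_sign _ _).
  by rewrite -sgb_eq /edge_sign /=; case: (orientation _ _); case: a.2.
by apply: cell_mark_None => j; rewrite ord1 la.
Qed.

Lemma mark_vertex (e : cell X 1) s : mark (cmap e (const_mx (sgb s))) = None.
Proof.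
set z := const_mx _; have cz : cube z by apply/cubeP => i; rewrite mxE normr_sgb.
have [F [fF zE]] := carrier_face cz (erefl (cmap e z)).
apply: cell_mark_None => i; have [j Fj] := fF.1.1 i.
by have := face_const F j (ccoord_open (cmap e z)); rewrite Fj zE mxE normr_sgb => -[_ /(_ erefl)].
Qed.

Lemma mark_origin a : mark (origin a) = None.
Proof.
rewrite /origin /oedge_map mulrN1 (_ : - sgb a.2 = sgb (~~ a.2)) ?mark_vertex//.
by case: a.2; rewrite /Defs.sgb ?opprK.
Qed.

Lemma mark_terminus a : mark (terminus a) = None.
Proof. by rewrite -origin_rev mark_origin. Qed.

Definition holonomy : (R -> X) -> freeGroup bool := transport (@star R X) jump.

Lemma holonomy_cat x f y g z : is_path x f y -> is_path y g z ->
  holonomy (concat_fun f g) = (holonomy f * holonomy g)%g.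
Proof.
apply: transport_cat; first by move=> p; exact: star_open.
  by move=> p; exists p; exact: star_center.
by move=> p; exact: jump_cocycle.
Qed.

Lemma holonomy_homotopic f g : path_homotopic f g -> holonomy f = holonomy g.
Proof.
apply: transport_homotopic; first by move=> p; exact: star_open.
  by move=> p; exists p; exact: star_center.
by move=> p; exact: jump_cocycle.
Qed.

Lemma holonomy_cst x : holonomy (fun=> x) = 1%g.
Proof.
apply: transport_cst; first by move=> p; exact: star_open.
  by move=> p; exists p; exact: star_center.
by move=> p; exact: jump_cocycle.
Qed.

Lemma holonomy_reverse x f y : is_path x f y -> holonomy (reverse_path f) = (holonomy f)^-1%g.
Proof.
apply: transport_rev; first by move=> p; exact: star_open.
  by move=> p; exists p; exact: star_center.
by move=> p; exact: jump_cocycle.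
Qed.

(** For a marked label, the partial products [lev j] are trivial as long as the coordinate across
    the hyperplane is negative, and equal to the generator afterwards. The end steps contribute
    nothing, since vertices are unmarked. *)
Lemma holonomy_edge_positive a : edge_sign a -> holonomy (edge_map a) =
  if marked (edge_label a) then generator (edge_label a == h) else 1%g.
Proof.
move=> sa; have [ca e0 e1] := is_path_edge a.
have oU (p : X) : open (star p) := star_open p.
have cU (x : X) : exists p, star p x by exists x; exact: star_center.
have [N gN] := good_subdivision_exists oU cU ca.
(* With at least three pieces, consecutive nodes differ by at most 2/3 in this coordinate, below the
   threshold of [jump]; the first inner node is on the negative side and the last one on the
   positive side. *)
have [G _] := good_subdivision_mul cU (fun p => @jump_cocycle p) gN (isT : 0 < 3)%N.
rewrite /holonomy (transportE cU (fun p => @jump_cocycle p) G).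
have [N0 _] := gN; set M := (N * 3)%N; have M3 : (3 <= M)%N by rewrite /M; lia.
have MR : (3 : R) <= M%:R by rewrite ler_nat.
have M0 : 0 < M%:R :> R by lra.
pose lev j : freeGroup bool := if 2 * (j%:R / M%:R) - 1 < (0 : R) then 1%g else
  if marked (edge_label a) then generator (edge_label a == h) else 1%g.
have inner j : (0 < j < M)%N -> mark (edge_map a (j%:R / M%:R)) =
    if marked (edge_label a) then Some (edge_label a == h, 2 * (j%:R / M%:R) - 1) else None.
  move=> /andP [j0 jM]; rewrite mark_edge; last first.
    apply/andP; split; first by rewrite divr_gt0// ltr0n.
    by rewrite ltr_pdivrMr// mul1r ltr_nat.
  by rewrite sa; case: ifP => // _; rewrite [sgb true]/(1 : R) mul1r.
have lev0 : lev 0%N = 1%g by rewrite /lev mul0r mulr0 ifT//; lra.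
have low j : (j <= 1)%N -> lev j = 1%g.
  move=> j1; rewrite /lev ifT//.
  have : (j%:R : R) <= 1 by rewrite (ler_nat _ _ 1).
  by move=> jR; rewrite subr_lt0 mulrA ltr_pdivrMr// mul1r; lra.
have high j : (M.-1 <= j)%N ->
    lev j = if marked (edge_label a) then generator (edge_label a == h) else 1%g.
  move=> jM; rewrite /lev ifF//; apply/negbTE; rewrite -leNgt subr_ge0 mulrA ler_pdivlMr// mul1r.
  have : (M%:R : R) <= j.+1%:R by rewrite ler_nat; lia.
  rewrite -natr1; lra.
have H j : (j <= M)%N -> transport_upto jump (edge_map a) M j = lev j.
  elim: j => [|j IH] jM; first by rewrite lev0.
  rewrite /= IH ?(ltnW jM)//; have [j0|j0] := posnP j.
    by rewrite j0 mul0r e0 /jump mark_origin mulg1 !low.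
  have [jE|jlt] := eqVneq j.+1 M.
    rewrite jE divff ?(gt_eqF M0)// e1 /jump mark_terminus.
    by case: (mark _) => [?|] /=; rewrite mulg1 !high -?jE.
  rewrite /jump !inner; [|lia|lia]; rewrite /lev.
  have [ma|_] := boolP (marked (edge_label a)); last by rewrite mulg1 !if_same.
  have -> : `|2 * (j%:R / M%:R) - 1 - (2 * (j.+1%:R / M%:R) - 1)| < (1 : R).
    have -> : 2 * (j%:R / M%:R) - 1 - (2 * (j.+1%:R / M%:R) - 1) = - (2 * M%:R^-1) :> R.
      by rewrite -natr1; ring.
    have m0 : 0 < M%:R^-1 :> R by rewrite invr_gt0.
    have m1 : M%:R^-1 <= 3^-1 :> R by rewrite lef_pV2 ?posrE.
    by rewrite ltr_norml; apply/andP; split; lra.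
  rewrite eqxx.
  rewrite /level /=.
  case: (lerP 0 (2 * (j%:R / M%:R) - 1)) => _; case: (lerP 0 (2 * (j.+1%:R / M%:R) - 1)) => _;
    by rewrite mulgA ?mulgV ?invg1 ?mulg1 ?mul1g.
by rewrite H// high// leq_pred.
Qed.

End Marks.

(** * Conclusion *)

Lemma path_cancel_right (R : realType) (T : topologicalType) (x y z : T) (f g h : R -> T) :
  is_path x f y -> is_path x g y -> is_path y h z ->
  path_homotopic (concat_fun f h) (concat_fun g h) -> path_homotopic f g.
Proof.
move=> pf pg ph fg; have ph' := is_reverse_path ph.
have absorb e : is_path x e y ->
    path_homotopic (concat_fun (concat_fun e h) (reverse_path h)) e.
  move=> pe; apply: path_homotopic_trans (path_homotopic_sym (path_catA pe ph ph')) _.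
  apply: path_homotopic_trans (path_cat1 pe).
  exact: path_homotopic_catr pe (is_path_cat ph ph') (path_cat_rev ph).
apply: path_homotopic_trans (path_homotopic_sym (absorb f pf)) _.
apply: path_homotopic_trans (absorb g pg).
exact: path_homotopic_catl (is_path_cat pf ph) ph' fg.
Qed.

Section Conclusion.
Context {R : realType} (X : cubeComplex R).
Local Notation oedge := (oedge X).
Local Notation edge_path := (@edge_path X oedge (@origin R X) (@terminus R X)).
Implicit Types (x y : X) (a b : oedge).
Hypothesis hX : special X.

Definition independent_hyperplanes (v : X) :=
  independent_pair (@origin R X) (@terminus R X) (@edge_label R X) (@edge_sign R X)
    (@crossing R X) v.

(** Followed by the inverse [r] of [q ++ p], both products have all crossing numbers zero, so both
    are null-homotopic and [r] can be cancelled. *)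
Lemma edge_loops_commute v p q : ~ independent_hyperplanes v ->
  edge_path v p v -> edge_path v q v ->
  path_homotopic (realize v (p ++ q)) (realize v (q ++ p)).
Proof.
move=> noi ep eq; have epq := edge_path_cat ep eq; have eqp := edge_path_cat eq ep.
pose r := inv_path (@oedge_rev R X) (q ++ p).
have er : edge_path v r v := edge_path_inv (@origin_rev R X) (@terminus_rev R X) eqp.
have null s : edge_path v s v -> (forall l, crossings (@edge_label R X) (@edge_sign R X) l s = 0) ->
    path_homotopic (realize v s) (fun=> v).
  move=> es s0.
  have rv : reachable (@origin R X) (@terminus R X) v v by exists [::].
  exact: (balanced_loop_null (@origin_rev R X) (@terminus_rev R X) (@edge_label_rev R X)
    (@edge_sign_rev R X) (@crossing_sym R X) (crossing_irr hX) (edge_determined hX)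
    (edge_square hX) (edge_parallel hX) (@edge_corner R X) (@edge_homotopic_refl R X)
    (@edge_homotopic_sym R X) (@edge_homotopic_trans R X) (@edge_homotopic_cat R X)
    (@edge_homotopic_cancel R X) noi rv es s0).2.
apply: (path_cancel_right (is_path_realize epq) (is_path_realize eqp) (is_path_realize er)).
apply: path_homotopic_trans (path_homotopic_sym (realize_cat epq er)) _.
apply: path_homotopic_trans (realize_cat eqp er).
have cr s : crossings (@edge_label R X) (@edge_sign R X) s r =
    - (crossings (@edge_label R X) (@edge_sign R X) s q +
       crossings (@edge_label R X) (@edge_sign R X) s p).
  by rewrite (crossings_inv (@edge_label_rev R X) (@edge_sign_rev R X)) crossings_cat.
apply: path_homotopic_trans (null _ (edge_path_cat epq er) _) _.
  by move=> l; rewrite crossings_cat cr crossings_cat [X in X - _]addrC subrr.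
apply/path_homotopic_sym/null; first exact: edge_path_cat eqp er.
by move=> l; rewrite crossings_cat cr crossings_cat subrr.
Qed.

Section Holonomy.
Context (h k : set (cell X 1)).
Hypothesis nhk : ~ crossing h k.
Local Notation hol := (@holonomy R X h k).

Lemma holonomy_edge a : hol (edge_map a) =
  if marked h k (edge_label a) then
    (if edge_sign a then generator (edge_label a == h) else (generator (edge_label a == h))^-1)%g
  else 1%g.
Proof.
case sa : (edge_sign a); first exact: holonomy_edge_positive.
have -> : edge_map a = reverse_path (edge_map (oedge_rev a)).
  by rewrite edge_map_rev reverse_pathK.
rewrite (holonomy_reverse hX nhk (is_path_edge (oedge_rev a))) (holonomy_edge_positive hX nhk).
  by rewrite edge_label_rev; case: ifP => // _; rewrite invg1.
by rewrite edge_sign_rev sa.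
Qed.

Fixpoint word_value (s : seq (set (cell X 1) * bool)) : freeGroup bool :=
  if s is u :: s' then
    ((if u.2 then generator (u.1 == h) else (generator (u.1 == h))^-1) * word_value s')%g
  else 1%g.

Lemma holonomy_realize x p y : edge_path x p y ->
  hol (realize x p) = word_value (dual_word (@edge_label R X) (@edge_sign R X) h k p).
Proof.
elim: p x => [x _|a p IH x /= [ax ap]]; first exact: holonomy_cst.
rewrite (holonomy_cat hX nhk (is_path_edge a) (is_path_realize ap)) (IH _ ap) holonomy_edge.
by rewrite /dual_word /= /marked; case: ifP => // _; rewrite mul1g.
Qed.

End Holonomy.
End Conclusion.

(** * Generators of the free group, and the dichotomy *)

Lemma freeGroup_generated (S : freeGroup bool -> Prop) : S 1%g ->
  (forall u v, S u -> S v -> S (u * v)%g) -> (forall u, S u -> S (u^-1)%g) ->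
  (forall g, S (generator g)) -> forall w, S w.
Proof.
move=> S1 SM SV Sg [u ru]; elim: u ru => [|l u IH] ru.
  by rewrite (_ : FreeGroup ru = 1%g)//; exact: val_inj.
have ru' := reduced_behead ru.
have -> : FreeGroup ru = ((if l.2 then generator l.1 else (generator l.1)^-1) * FreeGroup ru')%g.
  apply: val_inj; transitivity (push_letter l u).
    by case: (u) ru => //= m u' /andP [/negbTE -> _].
  by case: l {ru} => [] [] [].
by apply: SM; [case: l.2; [exact: Sg|apply: SV; exact: Sg]|exact: IH].
Qed.

Lemma homotopic_path_homotopic (R : realType) (T : topologicalType) (p : T) (f g : loop R p) :
  homotopic f g <-> path_homotopic f g.
Proof.
by split=> -[H [cH H0 H1 Hp]]; exists H; split=> // s sI; rewrite ?loop0 ?loop1;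
  have := Hp s sI; rewrite ?loop0 ?loop1.
Qed.

Lemma is_path_loop (R : realType) (T : topologicalType) (p : T) (f : loop R p) : is_path p f p.
Proof. by split; [exact: loop_cts|exact: loop0|exact: loop1]. Qed.

Local Open Scope group_scope.

Theorem theorem1p1 (R : realType) (X : cubeComplex R) (x0 : X)
    (hdim : finite_dimensional X) (hX : special X) :
  (forall x y : pi1 R x0, x * y = y * x) \/
  (exists phi : {multiplicative pi1 R x0 -> freeGroup bool},
     forall w : freeGroup bool, exists x : pi1 R x0, phi x = w).
Proof.
have [indep|noi] := pselect (independent_hyperplanes (vertex_near x0)).
  have [h [k [hk nhk loops]]] := independent_pair_connected (@origin_rev R X)
    (@terminus_rev R X) (@edge_label_rev R X) (@edge_sign_rev R X)
    (@crossing_sym R X) (crossing_irr hX) (edge_parallel hX) indep.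
  right; pose phi (x : pi1 R x0) : freeGroup bool := holonomy h k (repr x).
  have phiE (f : loop R x0) : phi (pi1_class f) = holonomy h k f.
    apply: holonomy_homotopic => //; apply/homotopic_path_homotopic; exact: homotopic_repr.
  have phiM : {morph phi : x y / x * y >-> x * y}.
    move=> x y; rewrite -[x * y]/(pi1_mul x y) /pi1_mul phiE /=.
    exact: (holonomy_cat hX nhk (is_path_loop _) (is_path_loop _)).
  pose phi_mul := isMultiplicative.Build _ _ phi phiM.
  pose Phi : {multiplicative pi1 R x0 -> freeGroup bool} := HB.pack phi phi_mul.
  exists Phi => w.
  set v := vertex_near x0 in loops.
  pose S u := exists2 p, edge_path (@origin R X) (@terminus R X) v p v & holonomy h k (realize v p) = u.
  have allS : forall u, S u.
    have SM p q : edge_path (@origin R X) (@terminus R X) v p v ->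
        edge_path (@origin R X) (@terminus R X) v q v ->
        holonomy h k (realize v (p ++ q)) = holonomy h k (realize v p) * holonomy h k (realize v q).
      move=> ep eq; rewrite -(holonomy_cat hX nhk (is_path_realize ep) (is_path_realize eq)).
      exact: (holonomy_homotopic hX nhk (realize_cat ep eq)).
    apply: freeGroup_generated.
    - by exists [::] => //; exact: holonomy_cst.
    - by move=> u u' [p ep <-] [q eq <-]; exists (p ++ q); [exact: edge_path_cat ep eq|exact: SM].
    - move=> u [p ep <-]; exists (inv_path (@oedge_rev R X) p).
        exact: (edge_path_inv (@origin_rev R X) (@terminus_rev R X) ep).
      apply: (mulgI (holonomy h k (realize v p))); rewrite mulgV -SM//; last first.
        exact: (edge_path_inv (@origin_rev R X) (@terminus_rev R X) ep).
      rewrite -(holonomy_cst hX nhk v); apply: (holonomy_homotopic hX nhk).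
      exact: (hp_cancel_path (@origin_rev R X) (@terminus_rev R X) (@edge_homotopic_refl R X)
        (@edge_homotopic_trans R X) (@edge_homotopic_cat R X) (@edge_homotopic_cancel R X) ep).2.
    - move=> g; have [|p ep wp] := loops (if g then h else k); first by case: g; [left|right].
      exists p => //; rewrite (holonomy_realize hX nhk ep) wp /= mulg1; congr generator.
      by case: g {wp}; [exact: eqxx|apply/eqP => /esym].
  (* The tails of the lasso conjugate the holonomy by [z]; the choice of [p] compensates for
     this. *)
  pose z := holonomy h k (to_vertex x0).
  have [p ep pw] := allS (z^-1 * w * z).
  have [cl l0 l1] := is_path_lasso ep.
  exists (pi1_class (Loop cl l0 l1)); rewrite -[Phi _]/(phi _) phiE /=.
  have pv := is_path_to_vertex x0; have pp := is_path_realize ep.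
  rewrite (holonomy_cat hX nhk pv (is_path_cat pp (is_reverse_path pv))).
  rewrite (holonomy_cat hX nhk pp (is_reverse_path pv)) (holonomy_reverse hX nhk pv) pw -/z.
  by rewrite -!mulgA mulgV mulg1 mulgA mulgV mul1g.
left=> x y; rewrite -(pi1_class_repr x) -(pi1_class_repr y) -[_ * _]/(pi1_mul _ _).
rewrite -[_ * _ in RHS]/(pi1_mul _ _) !pi1_mulE; apply: pi1_class_eq.
move: (repr x) (repr y) => f g; apply/homotopic_path_homotopic => /=.
(* Both loops become lassos with the same tails, so only their edge loops at [vertex_near x0] have
   to commute. *)
have [p ep fp] := cellular_path (is_path_loop f); have [q eq gq] := cellular_path (is_path_loop g).
apply: (@path_homotopic_trans _ _ (lasso x0 (p ++ q) x0)).
  apply: path_homotopic_trans (lasso_cat ep eq); apply: path_homotopic_cat fp gq.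
  by rewrite loop1 loop0.
apply: (@path_homotopic_trans _ _ (lasso x0 (q ++ p) x0)).
  apply: lasso_homotopic; first exact: edge_path_cat ep eq.
  exact: edge_loops_commute.
apply: path_homotopic_sym; apply: path_homotopic_trans (lasso_cat eq ep).
by apply: path_homotopic_cat gq fp; rewrite loop1 loop0.
Qed.
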